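(* Let $(\mathcal{A},\mathcal{B},E,E')$ be a $C^*$-OVI probability space. Let $x=x^*$ and $y=y^*$ be two elements of $\mathcal{A}$ that are infinitesimally free with respect to $(E,E')$ and such that $E(x)$ and $E(y)$ are invertible. Then for $\|w\|$ small enough ($w\in\mathcal{B}$), \begin{align*} \partial S_{xy}(w)={}&S_y(w)\,S_x'\big(S_y(w)^{-1}wS_y(w)\big)\Big(S_y(w)^{-1}w\,\partial S_y(w)-S_y(w)^{-1}\,\partial S_y(w)\,S_y(w)^{-1}wS_y(w)\Big)\\ &+S_y(w)\,\partial S_x\big(S_y(w)^{-1}wS_y(w)\big)+\partial S_y(w)\,S_x\big(S_y(w)^{-1}wS_y(w)\big). \end{align*}
   Context: A $C^*$-OVI (operator-valued infinitesimal) probability space $(\mathcal{A},\mathcal{B},E,E')$ consists of a unital $C^*$-algebra $\mathcal{A}$, a unital $C^*$-subalgebra $\mathcal{B}$ of $\mathcal{A}$, a completely positive linear map $E:\mathcal{A}\to\mathcal{B}$ with $E(b)=b$ and $E(b_1ab_2)=b_1E(a)b_2$, and a bounded selfadjoint linear map $E':\mathcal{A}\to\mathcal{B}$ with $E'(b_1ab_2)=b_1E'(a)b_2$ and $E'(1)=0$, for all $b,b_1,b_2\in\mathcal{B}$, $a\in\mathcal{A}$. Subalgebras $(\mathcal{A}_i)_{i\in I}$ of $\mathcal{A}$ containing $\mathcal{B}$ are infinitesimally free with respect to $(E,E')$ if for all $n\ge1$, all $i_1\neq i_2\neq\cdots\neq i_n$ in $I$ (consecutive indices distinct) and all $a_j\in\mathcal{A}_{i_j}$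 with $E(a_j)=0$, one has $E(a_1\cdots a_n)=0$ and $E'(a_1\cdots a_n)=\sum_{j=1}^nE(a_1\cdots a_{j-1}E'(a_j)a_{j+1}\cdots a_n)$. Elements $x,y$ are infinitesimally free if the subalgebras generated by $\mathcal{B}\cup\{x\}$ and by $\mathcal{B}\cup\{y\}$ are. For $z\in\mathcal{A}$ and $b\in\mathcal{B}$ with $\|b\|<1/\|z\|$, put $\psi_z(b)=E\big((1-bz)^{-1}-1\big)$ and $\partial\psi_z(b)=E'\big((1-bz)^{-1}-1\big)=\sum_{n\ge1}E'((bz)^n)$. If $E(z)$ is invertible, then $\psi_z$ is invertible with respect to composition around $0$, with inverse $\psi_z^{\langle-1\rangle}$, and the $S$-transform of $z$ is $S_z(w)=w^{-1}(1+w)\psi_z^{\langle-1\rangle}(w)$ for $\|w\|$ small enough (for non-invertible $w$ understood through analytic extension). The infinitesimal $S$-transform of $z$ is $$\partial S_z(w)=-(\psi_z^{\langle-1\rangle})'(w)\Big(\partial\psi_z\big(\psi_z^{\langle-1\rangle}(w)\big)\Big)$$ for $w\in\mathcal{B}$ with $\|w\|$ small. For a map $f$, $f'(w)$ denotes the Fréchet derivative at $w$; it is a linear map, and $f'(w)(u)$ is its value at $u$.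
   Formalization: The infinitesimal S-transform is taken with the factor w^{-1}(1+w) in front of -(ψ_z^{<-1>})'(w)(∂ψ_z(ψ_z^{<-1>}(w))), extended analytically to non-invertible w; without this factor the product formula fails for noncommutative B, e.g. B = M_2(C). *)

(* Defs.v *)
From HB Require Import structures.
From mathcomp Require Import all_boot all_order all_algebra.
From mathcomp Require Import complex.
From mathcomp Require Import all_classical all_reals all_analysis.

Set Implicit Arguments.
Unset Strict Implicit.
Unset Printing Implicit Defensive.

Import Order.TTheory GRing.Theory Num.Theory.
Import numFieldNormedType.Exports.

Local Open Scope classical_set_scope.
Local Open Scope ring_scope.
Local Open Scope complex_scope.

(* A unital C*-algebra, as a Banach space over R[i] with a product and a star.
   Norms are R[i]-valued (and nonnegative, hence real), as in any normedModType
   over R[i].  No HB structure joins the normed modules with the noncommutative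
   rings, so the ring structure is put by hand on the carrier, below. *)
Record cstarAlgType (R : realType) : Type := CStarAlg {
  cs_space : completeNormedModType R[i] ;
  cs_one : cs_space ;
  cs_mul : cs_space -> cs_space -> cs_space ;
  cs_star : cs_space -> cs_space ;
  cs_mulA : associative cs_mul ;
  cs_mul1l : left_id cs_one cs_mul ;
  cs_mul1r : right_id cs_one cs_mul ;
  cs_mulDl : left_distributive cs_mul +%R ;
  cs_mulDr : right_distributive cs_mul +%R ;
  cs_one_neq0 : cs_one != 0 ;
  cs_scaleAl : forall (k : R[i]) a b, k *: cs_mul a b = cs_mul (k *: a) b ;
  cs_scaleAr : forall (k : R[i]) a b, k *: cs_mul a b = cs_mul a (k *: b) ;
  cs_starK : involutive cs_star ;
  cs_starD : {morph cs_star : a b / a + b} ;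
  cs_starZ : forall (k : R[i]) a, cs_star (k *: a) = ((k^*)%R : R[i]) *: cs_star a ;
  cs_starM : forall a b, cs_star (cs_mul a b) = cs_mul (cs_star b) (cs_star a) ;
  cs_norm_mul : forall a b, `|cs_mul a b| <= `|a| * `|b| ;
  cs_norm_star : forall a, `|cs_mul (cs_star a) a| = `|a| ^+ 2
}.

Definition cs_sort (R : realType) (A : cstarAlgType R) : Type := cs_space A.
Coercion cs_sort : cstarAlgType >-> Sortclass.

Section CStarRing.
Context {R : realType} (A : cstarAlgType R).

HB.instance Definition _ := CompleteNormedModule.on (cs_sort A).
HB.instance Definition _ := GRing.Zmodule_isNzRing.Build (cs_sort A)
  (@cs_mulA R A) (@cs_mul1l R A) (@cs_mul1r R A)
  (@cs_mulDl R A) (@cs_mulDr R A) (@cs_one_neq0 R A).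
HB.instance Definition _ := GRing.Lmodule_isLalgebra.Build R[i] (cs_sort A)
  (@cs_scaleAl R A).
HB.instance Definition _ := GRing.Lalgebra_isAlgebra.Build R[i] (cs_sort A)
  (@cs_scaleAr R A).

Definition is_inverse (a b : A) : Prop := b * a = 1 /\ a * b = 1.
Definition cs_unit (a : A) : bool := `[< exists b, is_inverse a b >].
Definition cs_inv (a : A) : A := xget a [set b | is_inverse a b].

Let cs_invP (a : A) : cs_unit a -> is_inverse a (cs_inv a).
Proof. by move=> /asboolP[b ab]; rewrite /cs_inv; case: xgetP => // /(_ b). Qed.

Let cs_mulVr : {in cs_unit, left_inverse 1 cs_inv *%R}.
Proof. by move=> a /cs_invP[]. Qed.

Let cs_divrr : {in cs_unit, right_inverse 1 cs_inv *%R}.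
Proof. by move=> a /cs_invP[]. Qed.

Let cs_unitP (a b : A) : b * a = 1 /\ a * b = 1 -> cs_unit a.
Proof. by move=> ab; apply/asboolP; exists b. Qed.

Let cs_inv_out : {in [predC cs_unit], cs_inv =1 id}.
Proof.
move=> a /negP na; rewrite /cs_inv; case: xgetP => // b _ ab.
by case: na; apply/asboolP; exists b.
Qed.

HB.instance Definition _ := GRing.NzRing_hasMulInverse.Build (cs_sort A)
  cs_mulVr cs_divrr cs_unitP cs_inv_out.

End CStarRing.

Definition star {R : realType} {A : cstarAlgType R} (a : A) : A := cs_star a.

Section Positivity.
Context {R : realType} {A : cstarAlgType R}.

Definition mx_invertible n (M : 'M[A]_n) : Prop :=
  exists N : 'M[A]_n, M *m N = 1%:M /\ N *m M = 1%:M.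

(* Positivity in the C*-algebra M_n(A): selfadjoint with spectrum in
   [0, +oo[.  In R[i], 0 <= l means that l is real and nonnegative. *)
Definition positive_mx n (M : 'M[A]_n) : Prop :=
  map_mx star M^T = M /\
  forall l : R[i], ~~ (0 <= l) -> mx_invertible (M - (l%:A)%:M).

End Positivity.

Definition completely_positive (R : realType) (A B : cstarAlgType R)
    (E : A -> B) : Prop :=
  forall n (M : 'M[A]_n), positive_mx M -> positive_mx (map_mx E M).

(* The unital C*-subalgebra B of A is given as a C*-algebra B together with
   its inclusion iota : B -> A, an isometric unital *-homomorphism. *)
Record cstar_ovi (R : realType) (A B : cstarAlgType R)
    (iota : {lrmorphism B -> A}) (E E' : {linear A -> B}) : Prop := CStarOVI {
  iota_star : forall b, iota (star b) = star (iota b) ;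
  iota_norm : forall b, `|iota b| = `|b| ;
  E_cp : completely_positive E ;
  E_id : forall b, E (iota b) = b ;
  E_bimod : forall b1 a b2, E (iota b1 * a * iota b2) = b1 * E a * b2 ;
  E'_bounded : exists C : R[i], forall a, `|E' a| <= C * `|a| ;
  E'_selfadjoint : forall a, E' (star a) = star (E' a) ;
  E'_bimod : forall b1 a b2, E' (iota b1 * a * iota b2) = b1 * E' a * b2 ;
  E'_1 : E' 1 = 0
}.

Section Freeness.
Context {R : realType} {A B : cstarAlgType R}.
Variables (iota : {lrmorphism B -> A}) (E E' : {linear A -> B}).

Definition inf_free_family (I : Type) (Ai : I -> set A) : Prop :=
  forall (n : nat) (i : nat -> I) (a : nat -> A), (0 < n)%N ->
    (forall k, (k.+1 < n)%N -> i k <> i k.+1) ->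
    (forall k, (k < n)%N -> Ai (i k) (a k)) ->
    (forall k, (k < n)%N -> E (a k) = 0) ->
    E (\prod_(0 <= k < n) a k) = 0 /\
    E' (\prod_(0 <= k < n) a k) =
      \sum_(0 <= j < n)
        E (\prod_(0 <= k < j) a k * iota (E' (a j))
             * \prod_(j.+1 <= k < n) a k).

Definition gen_subalgebra (x : A) : set A :=
  smallest [set S : set A | GRing.subalg_closed (mem S)]
           (range iota `|` [set x]).

Definition inf_free (x y : A) : Prop :=
  inf_free_family
    (fun second : bool => gen_subalgebra (if second then y else x)).

End Freeness.

Section LocalMaps.
Context {R : realType} {B : cstarAlgType R}.
Implicit Types f g h : B -> B.

Definition is_local_inverse f g : Prop :=
  [/\ g 0 = 0, {for 0, continuous g},
      \forall w \near (0 : B), f (g w) = w &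
      \forall b \near (0 : B), g (f b) = b].

Definition local_inverse f : B -> B :=
  xget (fun=> 0) [set g | is_local_inverse f g].

(* h is holomorphic near 0 and agrees with f at the invertible points near 0.
   The germ of h at 0 is unique: for every w, w + l is invertible as soon as
   |l| > `|w|, and one applies the identity theorem in l. *)
Definition is_analytic_extension f h : Prop :=
  (\forall w \near (0 : B), differentiable h w) /\
  (\forall w \near (0 : B), w \is a GRing.unit -> h w = f w).

Definition analytic_extension f : B -> B :=
  xget (fun=> 0) [set h | is_analytic_extension f h].

End LocalMaps.

Section Transforms.
Context {R : realType} {A B : cstarAlgType R}.
Variables (iota : {lrmorphism B -> A}) (E E' : {linear A -> B}).

Definition psi (z : A) (b : B) : B := E ((1 - iota b * z)^-1 - 1).

Definition dpsi (z : A) (b : B) : B := E' ((1 - iota b * z)^-1 - 1).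

Definition psi_inv (z : A) : B -> B := local_inverse (psi z).

Definition S_transform (z : A) : B -> B :=
  analytic_extension (fun w => w^-1 * (1 + w) * psi_inv z w).

(* The first-order term in e of the compositional inverse of
   psi z + e dpsi z. *)
Definition dpsi_inv (z : A) (w : B) : B :=
  - ('d (psi_inv z) w : B -> B) (dpsi z (psi_inv z w)).

(* The first-order term in e of the S-transform attached to E + e E', i.e.
   dpsi_inv normalised by the same factor w^-1 (1 + w) as the S-transform.
   The factor is needed: with dpsi_inv itself in the role of dS_transform,
   the product formula for dS_transform (x * y) holds for commutative B but
   fails in general, e.g. for B = M_2(C). *)
Definition dS_transform (z : A) : B -> B :=
  analytic_extension (fun w => w^-1 * (1 + w) * dpsi_inv z w).

End Transforms.

(* Main.v *)
Require Import Defs.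
From HB Require Import structures.
From mathcomp Require Import all_boot all_order all_algebra.
From mathcomp Require Import complex ring lra.
From mathcomp Require Import all_classical all_reals all_analysis.
Import Order.TTheory GRing.Theory Num.Theory.
Import numFieldNormedType.Exports.
Local Open Scope classical_set_scope.
Local Open Scope ring_scope.

Set Implicit Arguments.
Unset Strict Implicit.
Unset Printing Implicit Defensive.

(** The infinitesimal S-transform is the first-order part of an S-transform.
    Adjoin to A and B a central element eps with eps^2 = 0, and let
    EE = E + eps E'.  This is a conditional expectation of A[eps] onto B[eps], and
    infinitesimal freeness of x and y for (E, E') makes the algebras generated by
    x and by y over B[eps] free with amalgamation for EE ([dual_free]).  The
    S-transform of z for EE is w + eps u |-> S_z(w) + eps (S_z'(w)(u) + dS_z(w))
    ([dual_germ]).  The formula to be proved is thus the coefficient of eps in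

      S_xy(w) = S_y(w) S_x(S_y(w)^-1 w S_y(w))

    over the dual numbers, at a point w of B ([infinitesimal_product]).

    This multiplicativity ([S_transform_mul]) is proved in any Banach algebra with
    a bounded conditional expectation, a setting stable under the passage to dual
    numbers.  Write psi_z(b) = b theta(b), where theta(b) = E(z (1 - b z)^-1) and
    theta(0) = E(z) is invertible.  The inverse chi of psi_z satisfies
    chi(w) = w theta(chi(w))^-1, so it is found as the fixed point of a contraction
    ([S_germ_exists]), and the S-transform is (1 + w) theta(chi(w))^-1, which makes
    sense without inverting w.  Rescaling x and y by elements of B reduces
    multiplicativity to the case where S_x(w) = S_y(w) = 1.  There an identity
    between resolvents ([product_identity]) writes x y (1 - rho x y)^-1, with
    rho = (1 + w)^-1 w, as x (1 - rho x)^-1 plus a convergent series of alternating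
    products of centred elements, whose expectation vanishes by freeness.

    Two facts connect this with the definitions.  The map E is only known to be
    completely positive; it is bounded because the norm of a selfadjoint element
    is attained on its spectrum ([norm_in_spectrum],
    [completely_positive_bounded]).  The transforms are defined by analytic
    extension from the invertible elements, among functions that are merely
    differentiable near 0; that the extension is unique ([analytic_unique]) is
    reduced to the vanishing of compactly supported holomorphic functions of one
    variable with vector values ([compact_support_holomorphic_eq0]), proved by
    Goursat's theorem and a maximum principle. *)

(** * Banach algebras with a real-valued norm *)

(** Norms over R[i] take values in R[i], which is only partially ordered;
    estimates are made with their real parts. *)
Definition rnorm {R : realType} {V : normedZmodType R[i]} (v : V) : R :=
  complex.Re `|v|.

(** The argument moves from an algebra to its dual numbers, which have no
    involution; this is the structure that both share. *)
HB.mixin Record Algebra_isBanach (R : realType) A of GRing.Algebra R[i] A := {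
  bnorm : A -> R ;
  bnorm_ge0 : forall a, 0 <= bnorm a ;
  bnorm_eq0 : forall a, bnorm a = 0 -> a = 0 ;
  bnormD : forall a b, bnorm (a + b) <= bnorm a + bnorm b ;
  bnormZ : forall (k : R[i]) a, bnorm (k *: a) = rnorm k * bnorm a ;
  bnormM : forall a b, bnorm (a * b) <= bnorm a * bnorm b ;
  bnorm1 : bnorm 1 = 1 ;
  bnorm_complete : forall u : nat -> A,
    (forall e, 0 < e -> exists N, forall m n, (N <= m)%N -> (N <= n)%N ->
       bnorm (u m - u n) <= e) ->
    exists l, forall e, 0 < e -> exists N, forall n, (N <= n)%N ->
       bnorm (u n - l) <= e
}.

#[short(type="banachAlgType")]
HB.structure Definition BanachAlg (R : realType) :=
  {A of GRing.Algebra R[i] A & Algebra_isBanach R A}.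

(** The running time of lra grows quickly with the number of hypotheses. *)
Tactic Notation "lra_from" hyp_list(hs) := revert hs; clear; lra.

Section RNorm.
Context {R : realType} {V : normedModType R[i]}.
Implicit Types v w : V.

Lemma rnormE v : `|v| = (rnorm v)%:C%C.
Proof. by rewrite /rnorm RRe_real // ger0_real. Qed.

Lemma rnorm_ge0 v : 0 <= rnorm v.
Proof. by rewrite -ler0c -rnormE. Qed.

Lemma rnormD v w : rnorm (v + w) <= rnorm v + rnorm w.
Proof. by rewrite -lecR rmorphD /= -!rnormE ler_normD. Qed.

Lemma rnorm_eq0 v : rnorm v = 0 -> v = 0.
Proof. by move=> v0; apply/normr0_eq0; rewrite rnormE v0. Qed.

Lemma rnormN v : rnorm (- v) = rnorm v.
Proof. by rewrite /rnorm normrN. Qed.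

Lemma rnormB v w : rnorm (v - w) <= rnorm v + rnorm w.
Proof. by rewrite -(rnormN w) rnormD. Qed.

Lemma rnorm0 : rnorm (0 : V) = 0.
Proof. by rewrite /rnorm normr0. Qed.

Lemma rnormZ (k : R[i]) v : rnorm (k *: v) = rnorm k * rnorm v.
Proof.
apply: complexI; rewrite rmorphM /= -rnormE normrZ rnormE.
by congr (_ * _); rewrite /rnorm RRe_real // ger0_real.
Qed.

End RNorm.

Lemma rnorm_real {R : realType} (r : R) : rnorm (r%:C%C : R[i]) = `|r|.
Proof. by rewrite /rnorm normc_def /= expr0n addr0 sqrtr_sqr. Qed.

Lemma rnorm_i {R : realType} : rnorm ('i%C : R[i]) = 1.
Proof. by rewrite /rnorm normc_def /= expr0n add0r expr1n sqrtr1. Qed.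

Section BanachBasics.
Context {R : realType} {A : banachAlgType R}.
Implicit Types a b : A.

Lemma bnormN a : bnorm (- a) = bnorm a.
Proof. by rewrite -scaleN1r bnormZ /rnorm normrN normr1 mul1r. Qed.

Lemma bnorm0 : bnorm (0 : A) = 0.
Proof. by rewrite -(scale0r (0 : A)) bnormZ /rnorm normr0 mul0r. Qed.

Lemma bnormB a b : bnorm (a - b) <= bnorm a + bnorm b.
Proof. by rewrite -(bnormN b) bnormD. Qed.

Lemma bnormBC a b : bnorm (a - b) = bnorm (b - a).
Proof. by rewrite -bnormN opprB. Qed.

Lemma bnorm_tri c a b : bnorm (a - b) <= bnorm (a - c) + bnorm (c - b).
Proof. by rewrite -[in leLHS](subrKA c) bnormD. Qed.

Lemma bnorm_eq0_small a : (forall e, 0 < e -> bnorm a <= e) -> a = 0.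
Proof.
move=> small; apply: bnorm_eq0; apply/eqP; rewrite eq_le bnorm_ge0 andbT.
rewrite leNgt; apply/negP => a0; have /= := small (bnorm a / 2).
have -> : 0 < bnorm a / 2 by lra.
by move=> /(_ isT); lra.
Qed.

Lemma bnormM_le a b x y : bnorm a <= x -> bnorm b <= y -> bnorm (a * b) <= x * y.
Proof.
move=> ax bY; apply: le_trans (bnormM _ _) _.
by apply: ler_pM => //; apply: bnorm_ge0.
Qed.

End BanachBasics.

Lemma small_expr {R : realType} (q M e : R) : 0 <= q -> q < 1 -> 0 < e ->
  exists n, q ^+ n * M <= e.
Proof.
move=> q0 q1 e0.
have cv : (fun n => q ^+ n) @ \oo --> (0 : R) by apply: cvg_expr; rewrite ger0_norm.
have M0 : 0 < e / (`|M| + 1) by rewrite divr_gt0 // ltr_wpDl.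
move/cvgrPdist_le: cv => /(_ _ M0)[n _ /(_ n (leqnn n)) /=].
rewrite sub0r normrN ger0_norm ?exprn_ge0 // => qe; exists n.
have M1 : M <= `|M| + 1 by have := ler_norm M; lra.
apply: (@le_trans _ _ (q ^+ n * (`|M| + 1))).
  by rewrite ler_wpM2l // exprn_ge0.
by rewrite -ler_pdivlMr // ltr_wpDl.
Qed.

(** The invariant set D may carry algebraic constraints (selfadjointness,
    commutation, membership in a closed subspace) beside a norm bound; the fixed
    point then inherits them. *)
Section Contraction.
Context {R : realType} {A : banachAlgType R}.
Variables (D : A -> Prop) (T : A -> A) (q : R) (x0 : A).
Hypothesis Dx0 : D x0.
Hypothesis DT : forall x, D x -> D (T x).
Hypothesis Dcl : forall (u : nat -> A) l, (forall n, D (u n)) ->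
  (forall e, 0 < e -> exists n, bnorm (u n - l) <= e) -> D l.
Hypotheses (q0 : 0 <= q) (q1 : q < 1).
Hypothesis lipT : forall x y, D x -> D y -> bnorm (T x - T y) <= q * bnorm (x - y).

Lemma contraction_fixpoint : exists2 c, D c & T c = c.
Proof.
pose u n := iter n T x0.
have Du n : D (u n) by elim: n => //= n; apply: DT.
pose c := bnorm (T x0 - x0); pose C := c / (1 - q).
have c0 : 0 <= c by apply: bnorm_ge0.
have q10 : 0 < 1 - q by rewrite subr_gt0.
have C0 : 0 <= C by rewrite divr_ge0 // ltW.
have CE : C * (1 - q) = c by rewrite divfK // gt_eqF.
have u0 k : bnorm (u k - x0) <= C.
  elim: k => [|k IH]; first by rewrite subrr bnorm0.
  rewrite (le_trans (bnorm_tri (T x0) _ _)) //.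
  have := lipT (Du k) Dx0; have : q * bnorm (u k - x0) <= q * C by rewrite ler_wpM2l.
  have -> : bnorm (T x0 - x0) = c by [].
  rewrite -[T (u k)]/(u k.+1); lra.
have un n k : bnorm (u (n + k)%N - u n) <= q ^+ n * C.
  elim: n => [|n IH]; first by rewrite expr0 mul1r u0.
  rewrite addSn (le_trans (lipT (Du _) (Du _))) // exprS -mulrA.
  by rewrite ler_wpM2l.
have ucv e : 0 < e -> exists N, forall n, (N <= n)%N -> bnorm (u n - u N) <= e.
  move=> e0; have [N qN] := small_expr C q0 q1 e0.
  by exists N => n Nn; rewrite -(subnKC Nn) (le_trans (un _ _)).
have [|l ul] := bnorm_complete u.
  move=> e e0; have [N uN] := ucv (e / 2) ltac:(lra).
  exists N => m n Nm Nn; rewrite (le_trans (bnorm_tri (u N) _ _)) //.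
  by have := uN m Nm; have := uN n Nn; rewrite (bnormBC (u n)); lra.
have Dl : D l.
  apply: (Dcl Du) => e /ul[N uN]; exists N; exact: uN.
exists l => //; apply/subr0_eq/bnorm_eq0_small => e e0.
have [N uN] := ul (e / 2) ltac:(lra).
rewrite (le_trans (bnorm_tri (u N.+1) _ _)) //.
have := lipT Dl (Du N); have := uN N (leqnn _); have := uN N.+1 (leqnSn _).
rewrite /= (bnormBC l) => h1 h2 h3.
have := bnorm_ge0 (u N - l) => h4.
have : q * bnorm (u N - l) <= bnorm (u N - l) by rewrite ler_piMl // ltW.
by lra.
Qed.

End Contraction.

Section Inverses.
Context {R : realType} {A : banachAlgType R}.
Implicit Types a b c : A.

Definition bunit a := exists b, a * b = 1 /\ b * a = 1.
Definition binv a : A := xget 0 [set b | a * b = 1 /\ b * a = 1].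

Lemma binvP a : bunit a -> a * binv a = 1 /\ binv a * a = 1.
Proof. by move=> [b ab]; rewrite /binv; case: xgetP => // /(_ b). Qed.

Lemma mulrbV a : bunit a -> a * binv a = 1.
Proof. by case/binvP. Qed.

Lemma mulbVr a : bunit a -> binv a * a = 1.
Proof. by case/binvP. Qed.

Lemma binv_uniq a b : a * b = 1 -> b * a = 1 -> binv a = b.
Proof.
move=> ab ba; have [h1 h2] : a * binv a = 1 /\ binv a * a = 1.
  by apply: binvP; exists b.
by rewrite -[LHS]mulr1 -ab mulrA h2 mul1r.
Qed.

Lemma bunitM a b : bunit a -> bunit b -> bunit (a * b).
Proof.
move=> [a' [h1 h2]] [b' [h3 h4]]; exists (b' * a'); split.
  by rewrite mulrA -(mulrA a) h3 mulr1.
by rewrite mulrA -(mulrA b') h2 mulr1.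
Qed.

Lemma bunitV a : bunit a -> bunit (binv a).
Proof. by case/binvP => h1 h2; exists a. Qed.

Lemma ball_closed (r : R) (u : nat -> A) l : (forall n, bnorm (u n) <= r) ->
  (forall e, 0 < e -> exists n, bnorm (u n - l) <= e) -> bnorm l <= r.
Proof.
move=> ur ul; rewrite leNgt; apply/negP => rl.
have [n un] := ul ((bnorm l - r) / 2) ltac:(lra).
have := bnorm_tri (u n) l 0; rewrite !subr0 (bnormBC l); have := ur n; lra.
Qed.

(** The fixed points of u |-> 1 + a u and u |-> 1 + u a are a right and a left
    inverse of 1 - a, hence coincide. *)
Lemma neumann a : bnorm a < 1 -> bunit (1 - a).
Proof.
move=> a1.
have [b _ bE] := @contraction_fixpoint R A (fun=> True) (fun u => 1 + a * u)
  (bnorm a) 0 I (fun _ _ => I) (fun _ _ _ _ => I) (bnorm_ge0 a) a1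
  (fun x y _ _ => ltac:(by rewrite opprD addrACA subrr add0r -mulrBr bnormM)).
have [c _ cE] := @contraction_fixpoint R A (fun=> True) (fun u => 1 + u * a)
  (bnorm a) 0 I (fun _ _ => I) (fun _ _ _ _ => I) (bnorm_ge0 a) a1
  (fun x y _ _ => ltac:(by rewrite opprD addrACA subrr add0r -mulrBl [leRHS]mulrC bnormM)).
have h1 : (1 - a) * b = 1 by rewrite mulrBl mul1r -[X in X - _]bE addrK.
have h2 : c * (1 - a) = 1 by rewrite mulrBr mulr1 -[X in X - _]cE addrK.
exists b; split => //.
by rewrite (_ : b = c) // -[RHS]mulr1 -h1 mulrA h2 mul1r.
Qed.

Lemma neumann_bound a (q : R) : bnorm a <= q -> q < 1 ->
  bnorm (binv (1 - a)) <= (1 - q)^-1.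
Proof.
move=> aq q1; have /neumann/mulrbV : bnorm a < 1 by exact: le_lt_trans q1.
set u := binv _ => h.
have uE : u = 1 + a * u by rewrite -h mulrBl mul1r subrK.
have : bnorm u <= 1 + q * bnorm u.
  rewrite {1}uE (le_trans (bnormD _ _)) // bnorm1 lerD2l.
  by apply: bnormM_le.
by move=> uq; rewrite -[leRHS]mul1r ler_pdivlMr ?subr_gt0 //; lra.
Qed.

Lemma binv_perturb a h (K : R) : bunit a -> bnorm (binv a) <= K ->
  K * bnorm h <= 1 / 2 -> bunit (a + h) /\ bnorm (binv (a + h)) <= 2 * K.
Proof.
move=> au aK Kh.
have E : a + h = a * (1 - - (binv a * h)).
  by rewrite opprK mulrDr mulr1 mulrA mulrbV // mul1r.
have s : bnorm (- (binv a * h)) <= 1 / 2.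
  by rewrite bnormN (le_trans (bnormM _ _)) // (le_trans _ Kh) // ler_wpM2r // bnorm_ge0.
have u1 : bunit (1 - - (binv a * h)) by apply: neumann; lra.
split; first by rewrite E; apply: bunitM.
have -> : binv (a + h) = binv (1 - - (binv a * h)) * binv a.
  apply: binv_uniq; rewrite E.
    by rewrite mulrA -(mulrA a) mulrbV // mulr1 mulrbV.
  by rewrite mulrA -(mulrA _ (binv a)) mulbVr // mulr1 mulbVr.
apply: bnormM_le => //.
have := neumann_bound s ltac:(lra); have -> : (1 - 1 / 2 : R)^-1 = 2 by field.
by [].
Qed.

End Inverses.

(** * Linear identities in modules and noncommutative algebras *)

Section SquareZero.
Variables (K : comNzRingType) (V : lmodType K).

(** In the commutative ring K + V with V * V = 0, an identity between K-linear
    combinations of vectors is a ring identity, which ring decides. *)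
Definition sqzext : Type := (K * V)%type.
HB.instance Definition _ := GRing.Zmodule.on sqzext.

Definition sqz_mul (x y : sqzext) : sqzext := (x.1 * y.1, x.1 *: y.2 + y.1 *: x.2).
Definition sqz_one : sqzext := (1, 0).

Fact sqz_mulA : associative sqz_mul.
Proof.
move=> [a u] [b v] [c w]; congr pair => /=; first by rewrite mulrA.
by rewrite !scalerDr !scalerA addrA (mulrC c a) (mulrC c b).
Qed.
Fact sqz_mulC : commutative sqz_mul.
Proof. by move=> [a u] [b v]; congr pair => /=; rewrite 1?mulrC // addrC. Qed.
Fact sqz_mul1 : left_id sqz_one sqz_mul.
Proof. by move=> [b v]; congr pair => /=; rewrite ?mul1r // scaler0 addr0 scale1r. Qed.
Fact sqz_mulDl : left_distributive sqz_mul +%R.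
Proof.
move=> [a u] [b v] [c w]; congr pair => /=; first by rewrite mulrDl.
by rewrite scalerDl scalerDr addrACA.
Qed.
Fact sqz_one_neq0 : sqz_one != 0.
Proof. by apply/eqP => -[] /eqP; rewrite oner_eq0. Qed.

HB.instance Definition _ := GRing.Zmodule_isComNzRing.Build sqzext
  sqz_mulA sqz_mulC sqz_mul1 sqz_mulDl sqz_one_neq0.

Definition sqz_sc (k : K) : sqzext := (k, 0).
Definition sqz_vec (v : V) : sqzext := (0, v).

Fact sqz_sc_add : {morph sqz_sc : x y / x - y}.
Proof. by move=> x y; congr pair; rewrite /= subr0. Qed.
Fact sqz_sc_mul : monoid_morphism sqz_sc.
Proof. by split=> // x y; congr pair; rewrite /= !scaler0 addr0. Qed.
Fact sqz_vecD u v : sqz_vec (u + v) = sqz_vec u + sqz_vec v.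
Proof. by congr pair; rewrite /= addr0. Qed.
Fact sqz_vecN u : sqz_vec (- u) = - sqz_vec u.
Proof. by congr pair; rewrite /= oppr0. Qed.
Fact sqz_vec0 : sqz_vec 0 = 0.
Proof. by []. Qed.
HB.instance Definition _ := GRing.isZmodMorphism.Build K sqzext sqz_sc sqz_sc_add.
HB.instance Definition _ := GRing.isMonoidMorphism.Build K sqzext sqz_sc sqz_sc_mul.

Lemma sqz_vecZ k v : sqz_vec (k *: v) = sqz_sc k * sqz_vec v.
Proof. by congr pair; rewrite /= ?mulr0 // scale0r addr0. Qed.

Lemma sqz_vec_inj : injective sqz_vec.
Proof. by move=> u v []. Qed.

End SquareZero.

Ltac lmod_ring := apply: sqz_vec_inj;
  rewrite ?(sqz_vecD, sqz_vecN, sqz_vecZ, sqz_vec0); ring.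

(** * Bisection of rectangles *)

Section Bisection.
Context {R : realType}.
Variable P : R -> R -> R -> R -> Prop.
Hypothesis Psplit : forall a b c d m n,  m = (a + b) / 2 -> n = (c + d) / 2 ->
  a <= b -> c <= d ->
  P a m c n -> P m b c n -> P a m n d -> P m b n d -> P a b c d.

Let rect := (R * R * (R * R))%type.
Let Pr (r : rect) := P r.1.1 r.1.2 r.2.1 r.2.2.
Let quarter (i j : bool) (r : rect) : rect :=
  let m := (r.1.1 + r.1.2) / 2 in let n := (r.2.1 + r.2.2) / 2 in
  ((if i then (m, r.1.2) else (r.1.1, m)), (if j then (n, r.2.2) else (r.2.1, n))).
Let step (r : rect) : rect :=
  if ~~ `[< Pr (quarter false false r) >] then quarter false false r else
  if ~~ `[< Pr (quarter true false r) >] then quarter true false r else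
  if ~~ `[< Pr (quarter false true r) >] then quarter false true r else
  quarter true true r.

Let stepE r : exists i j, step r = quarter i j r.
Proof. by rewrite /step; do 3 (case: ifP => _; first by eexists; eexists); eexists; eexists. Qed.

Let step_bad r : r.1.1 <= r.1.2 -> r.2.1 <= r.2.2 -> ~ Pr r -> ~ Pr (step r).
Proof.
move=> h1 h2 bad; rewrite /step.
case: ifP => [/asboolPn //|/negbT/negPn/asboolP p1].
case: ifP => [/asboolPn //|/negbT/negPn/asboolP p2].
case: ifP => [/asboolPn //|/negbT/negPn/asboolP p3].
move=> p4; apply: bad; exact: (Psplit erefl erefl h1 h2 p1 p2 p3 p4).
Qed.

(** If a rectangle is bad, so is one of its quarters; nested bad quarters shrink
    to a point, around which small rectangles are good.  Rectangles may be
    degenerate, so that intervals are covered too. *)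
Lemma rect_bisection a b c d :
  (forall p q, a <= p <= b -> c <= q <= d -> exists2 e, 0 < e &
     forall a' b' c' d', a <= a' <= p -> p <= b' <= b -> c <= c' <= q -> q <= d' <= d ->
       b' - a' <= e -> d' - c' <= e -> P a' b' c' d') ->
  a <= b -> c <= d -> P a b c d.
Proof.
move=> loc ab cd; apply: contrapT => bad.
pose r n := iter n step ((a, b), (c, d)).
pose ok (s : rect) := [/\ s.1.1 <= s.1.2, s.2.1 <= s.2.2 & ~ Pr s].
have okr n : ok (r n).
  elim: n => [|n [h1 h2 h3]]; first by split.
  have [i [j E]] := stepE (r n).
  split; last exact: step_bad.
    by rewrite /= E; case: (i) => /=; lra.
  by rewrite /= E; case: (j) => /=; lra.
have mon n : [/\ (r n).1.1 <= (r n.+1).1.1, (r n.+1).1.2 <= (r n).1.2,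
    (r n).2.1 <= (r n.+1).2.1 & (r n.+1).2.2 <= (r n).2.2].
  have [h1 h2 _] := okr n; have [i [j E]] := stepE (r n).
  by rewrite /= E; case: (i); case: (j) => /=; split; lra.
have wid n : (r n).1.2 - (r n).1.1 = (1 / 2) ^+ n * (b - a) /\
             (r n).2.2 - (r n).2.1 = (1 / 2) ^+ n * (d - c).
  elim: n => [|n [w1 w2]]; first by rewrite !expr0 !mul1r.
  have [i [j E]] := stepE (r n).
  rewrite !exprS -!mulrA -w1 -w2 /= E.
  by case: (i); case: (j) => /=; split; lra.
have mono (m n : nat) : (m <= n)%N -> [/\ (r m).1.1 <= (r n).1.1, (r n).1.2 <= (r m).1.2,
    (r m).2.1 <= (r n).2.1 & (r n).2.2 <= (r m).2.2].
  move=> /subnKC <-; elim: (n - m)%N => [|k [h1 h2 h3 h4]]; first by rewrite addn0.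
  by rewrite addnS; have [g1 g2 g3 g4] := mon (m + k)%N; split; lra.
have cross (m n : nat) : (r m).1.1 <= (r n).1.2 /\ (r m).2.1 <= (r n).2.2.
  have [h1 h2 _] := okr (maxn m n).
  have [g1 _ g3 _] := mono _ _ (leq_maxl m n).
  have [_ g2 _ g4] := mono _ _ (leq_maxr m n).
  by split; lra.
pose p := sup (range (fun n => (r n).1.1)); pose q := sup (range (fun n => (r n).2.1)).
have pP n : (r n).1.1 <= p <= (r n).1.2.
  apply/andP; split.
    apply: ub_le_sup; last by exists n.
    by exists b => _ [m _ <-]; have [] := cross m 0%N.
  apply: ge_sup; first by exists (r 0%N).1.1; exists 0%N.
  by move=> _ [m _ <-]; have [] := cross m n.
have qP n : (r n).2.1 <= q <= (r n).2.2.
  apply/andP; split.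
    apply: ub_le_sup; last by exists n.
    by exists d => _ [m _ <-]; have [] := cross m 0%N.
  apply: ge_sup; first by exists (r 0%N).2.1; exists 0%N.
  by move=> _ [m _ <-]; have [] := cross m n.
have [e e0 small] := loc p q (pP 0%N) (qP 0%N).
have [n ne] := small_expr ((b - a) + (d - c)) (q := 1 / 2) ltac:(lra) ltac:(lra) e0.
have [_ _ badn] := okr n; apply: badn.
have [w1 w2] := wid n; have /andP[p1 p2] := pP n; have /andP[q1 q2] := qP n.
have [m1 m2 m3 m4] := mono _ _ (leq0n n).
rewrite /= in m1 m2 m3 m4.
have x0 : 0 <= (1 / 2 : R) ^+ n by rewrite exprn_ge0.
apply: small; rewrite ?w1 ?w2; try (by apply/andP; split).
  by rewrite (le_trans _ ne) // ler_wpM2l //; lra.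
by rewrite (le_trans _ ne) // ler_wpM2l //; lra.
Qed.

End Bisection.

(** * Antiderivatives of vector-valued functions *)

Lemma posC {R : realType} (e : R[i]) : 0 < e -> e = (complex.Re e)%:C%C /\ 0 < complex.Re e.
Proof.
move=> e0; have eE : e = (complex.Re e)%:C%C by rewrite RRe_real ?gtr0_real.
by split=> //; rewrite -ltcR -eE.
Qed.

Lemma rnorm_complete {R : realType} (V : completeNormedModType R[i]) (u : nat -> V) :
  (forall e, 0 < e -> exists N, forall m n, (N <= m)%N -> (N <= n)%N ->
     rnorm (u m - u n) <= e) ->
  exists l, forall e, 0 < e -> exists N, forall n, (N <= n)%N ->
     rnorm (u n - l) <= e.
Proof.
move=> cau.
have : cvg (u @ \oo).
  apply/cauchy_cvgP/cauchy_exP => e /posC[eE e0].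
  have [N uN] := cau (complex.Re e / 2) ltac:(lra).
  exists (u N); exists N => // n /= Nn.
  rewrite -ball_normE /ball_ /= rnormE eE ltcR.
  by rewrite (le_lt_trans (uN _ _ (leqnn N) Nn)) //; lra.
move=> /cvg_ex[l ul]; exists l => e e0.
move/cvgrPdist_le : ul => /(_ e%:C%C); rewrite ltcR => /(_ e0)[N _ uN].
by exists N => n Nn; rewrite -lecR -rnormE distrC; apply: uN.
Qed.

Section RealScaling.
Context {R : realType} {V : normedModType R[i]}.

Lemma rnormZr (r : R) (v : V) : rnorm (r%:C%C *: v) = `|r| * rnorm v.
Proof. by rewrite rnormZ rnorm_real. Qed.

Lemma rnormZr_ge0 (r : R) (v : V) : 0 <= r -> rnorm (r%:C%C *: v) = r * rnorm v.
Proof. by move=> r0; rewrite rnormZr ger0_norm. Qed.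

Lemma rnormZi (v : V) : rnorm ('i%C *: v) = rnorm v.
Proof. by rewrite rnormZ rnorm_i mul1r. Qed.

Lemma rnorm_tri (c a b : V) : rnorm (a - b) <= rnorm (a - c) + rnorm (c - b).
Proof. by rewrite -[in leLHS](subrKA c) rnormD. Qed.

Lemma rnormBC (a b : V) : rnorm (a - b) = rnorm (b - a).
Proof. by rewrite -rnormN opprB. Qed.

Lemma rnorm_eq0_small (v : V) : (forall e, 0 < e -> rnorm v <= e) -> v = 0.
Proof.
move=> small; apply: rnorm_eq0; apply/eqP; rewrite eq_le rnorm_ge0 andbT.
apply/ler_addgt0Pr => e e0; rewrite add0r; exact: small.
Qed.

End RealScaling.

Section Antiderivative.
Context {R : realType} {V : completeNormedModType R[i]}.
Variable f : R -> V.
Hypothesis fcont : forall p e : R, 0 < e -> exists2 d, 0 < d &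
  forall t, `|t - p| <= d -> rnorm (f t - f p) <= e.

Let h n : R := n.+1%:R^-1.
Let j n (x : R) := Num.truncn (x * n.+1%:R).
(** F n x is a Riemann sum of f over [0, x] with mesh h n. *)
Let F n x : V := (h n)%:C%C *: \sum_(0 <= k < j n x) f (k%:R * h n).

Let h_gt0 n : 0 < h n. Proof. by rewrite invr_gt0 ltr0n. Qed.

Let jP n x : 0 <= x -> (j n x)%:R * h n <= x /\ x <= (j n x)%:R * h n + h n.
Proof.
move=> x0; have n0 : 0 < n.+1%:R :> R by rewrite ltr0n.
have /truncn_itv/andP[h1 h2] : 0 <= x * n.+1%:R by rewrite mulr_ge0 // ltW.
split; first by rewrite ler_pdivrMr.
by rewrite -[X in _ + X]mul1r -mulrDl ler_pdivlMr // natr1 ltW.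
Qed.

Let small_h e : 0 < e -> exists N, forall n, (N <= n)%N -> h n <= e.
Proof.
move=> e0; exists (Num.truncn e^-1) => n Nn.
rewrite /h -[leRHS]invrK lef_pV2 ?posrE ?ltr0n ?invr_gt0 //.
apply: ltW; apply: lt_le_trans (truncnS_gt _) _.
by rewrite ler_nat ltnS.
Qed.

Let F_step n a b c e : 0 <= a <= b ->
  (forall t, a - h n <= t <= b -> rnorm (f t - c) <= e) ->
  rnorm (F n b - F n a - (b - a)%:C%C *: c) <= (b - a + h n) * e + h n * rnorm c.
Proof.
move=> /andP[a0 ab] fc.
have b0 : 0 <= b by lra.
have [a1 a2] := jP n a0; have [b1 b2] := jP n b0.
have jab : (j n a <= j n b)%N.
  by apply: le_truncn; rewrite ler_pM2r // ltr0n.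
have hn := h_gt0 n.
pose N := (j n b - j n a)%N.
have NE : N%:R = (j n b)%:R - (j n a)%:R :> R by rewrite natrB.
have e0 : 0 <= e by apply: le_trans (fc a _); [exact: rnorm_ge0 | lra].
pose T := \sum_(j n a <= k < j n b) (f (k%:R * h n) - c).
have TE : F n b - F n a - (b - a)%:C%C *: c =
    (h n)%:C%C *: T + (N%:R * h n - (b - a))%:C%C *: c.
  rewrite /F (big_cat_nat (n := j n a)) //= /T sumrB sumr_const_nat -/N.
  rewrite -scaler_nat (_ : N%:R = (N%:R : R)%:C%C :> R[i]); last by rewrite rmorph_nat.
  lmod_ring.
have Tb : rnorm T <= N%:R * e.

  have : forall m, (j n a + m <= j n b)%N ->
      rnorm (\sum_(j n a <= k < j n a + m) (f (k%:R * h n) - c)) <= m%:R * e.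
    elim=> [|m IH] mb; first by rewrite addn0 big_geq // rnorm0 mul0r.
    rewrite addnS big_nat_recr ?leq_addr //= (le_trans (rnormD _ _)) //.
    rewrite -natr1 mulrDl mul1r lerD //.
      by apply: IH; apply: leq_trans mb; rewrite addnS.
    apply: fc; apply/andP; split.
      have : (j n a)%:R * h n <= (j n a + m)%:R * h n.
        by rewrite ler_pM2r // ler_nat leq_addr.
      lra.
    apply: le_trans b1; rewrite ler_pM2r // ler_nat; apply: leq_trans mb.
    by rewrite addnS.
  by move=> /(_ N); rewrite /T subnKC // => /(_ (leqnn _)).
rewrite TE (le_trans (rnormD _ _)) // lerD //.
  rewrite rnormZr_ge0; last exact: ltW.
  have : h n * rnorm T <= h n * (N%:R * e) by rewrite ler_pM2l.
  move=> /le_trans; apply; rewrite mulrA; apply: ler_wpM2r => //.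
  by rewrite NE mulrC mulrBl; lra.
rewrite rnormZr; apply: ler_wpM2r; first exact: rnorm_ge0.
by rewrite ler_norml NE mulrBl; lra.
Qed.

(** Continuity at one point of a short interval controls the Riemann sums over
    it; the resulting bound is additive in the interval, so that bisection
    extends it to all intervals without uniform continuity. *)
Let F_cauchy x e : 0 <= x -> 0 < e -> exists N, forall m n, (N <= m)%N -> (N <= n)%N ->
  rnorm ((F m x - F m 0) - (F n x - F n 0)) <= e * (x - 0).
Proof.
move=> x0 e0.
apply: (@rect_bisection R (fun a b _ _ => exists N, forall m n, (N <= m)%N -> (N <= n)%N ->
  rnorm ((F m b - F m a) - (F n b - F n a)) <= e * (b - a)) _ 0 x 0 0) => //.
  move=> a b _ _ m _ _ _ ab _ [N1 h1] [N2 h2] _ _.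
  exists (maxn N1 N2) => p q; rewrite !geq_max => /andP[p1 p2] /andP[q1 q2].
  have -> : F p b - F p a - (F q b - F q a) =
    (F p m - F p a - (F q m - F q a)) + (F p b - F p m - (F q b - F q m)) by lmod_ring.
  rewrite (le_trans (rnormD _ _)) //.
  by have := h1 p q p1 q1; have := h2 p q p2 q2; lra.
move=> p q pP _; pose e' := e / 4.
have [d d0 fd] := fcont p (e := e') ltac:(rewrite /e'; lra).
exists (d / 2); first by lra.
move=> a b _ _ aP bP _ _ bad _.
have [<-|neq] := eqVneq a b.
  by exists 0%N => m n _ _; rewrite !subrr mulr0 rnorm0.
have ab : 0 < b - a by rewrite subr_gt0 lt_neqAle neq; lra.
pose C := e' + rnorm (f p) + 1.
have C0 : 0 < C by rewrite /C /e'; have := rnorm_ge0 (f p); lra.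
have e1 : 0 < e' * (b - a) / C.
  by rewrite divr_gt0 // mulr_gt0 // /e'; lra.
have [N1 hN1] := small_h (e := d / 2) ltac:(lra); have [N2 hN2] := small_h e1.
have key m : (maxn N1 N2 <= m)%N ->
    rnorm (F m b - F m a - (b - a)%:C%C *: f p) <= 2 * e' * (b - a).
  rewrite geq_max => /andP[/hN1 m1 /hN2].
  rewrite ler_pdivlMr // => m2.
  have := @F_step m a b (f p) e' ltac:(lra).
  have H : forall t, a - h m <= t <= b -> rnorm (f t - f p) <= e'.
    by move=> t tP; apply: fd; rewrite ler_norml; lra.
  move=> /(_ H) /le_trans; apply.
  have : 0 < h m by [].
  have := rnorm_ge0 (f p).
  move: m2; rewrite /C mulrDl.
  set x1 := h m; set y1 := rnorm _; move=> *.
  have : 0 <= x1 * 1 by lra.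
  nra.
exists (maxn N1 N2) => m n /key k1 /key k2.
rewrite (le_trans (rnorm_tri ((b - a)%:C%C *: f p) _ _)) //.
by rewrite (rnormBC ((b - a)%:C%C *: f p)); move: k1 k2; rewrite /e'; lra.
Qed.

Lemma antiderivative_exists : exists F : R -> V, F 0 = 0 /\
  forall p e, 0 <= p -> 0 < e -> exists2 d, 0 < d &
    forall a b, 0 <= a <= p -> p <= b -> b - a <= d ->
      rnorm (F b - F a - (b - a)%:C%C *: f p) <= e * (b - a).
Proof.
have F0 n : F n 0 = 0 by rewrite /F /j mul0r truncn0 big_geq // scaler0.
have lim x : exists l, 0 <= x -> forall e, 0 < e -> exists N, forall n, (N <= n)%N ->
    rnorm (F n x - l) <= e.
  have [x0|x0] := lerP 0 x; last by exists 0 => ?; lra.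
  have [e e0|l ul] := @rnorm_complete R V (F^~ x); last by exists l.
  have [N hN] := F_cauchy x0 (e := e / (x + 1)) ltac:(by rewrite divr_gt0 //; lra).
  exists N => m n mN nN; have := hN m n mN nN; rewrite !F0 !subr0 => /le_trans; apply.
  rewrite mulrAC ler_pdivrMr; last by lra.
  by rewrite ler_pM2l //; lra.
have [G GP] := choice lim.
exists G; split.
  apply: rnorm_eq0_small => e e0; have [N /(_ N (leqnn N))] := GP 0 (lexx 0) e e0.
  by rewrite F0 sub0r rnormN.
move=> p e p0 e0.
have [d d0 fd] := fcont p (e := e) e0.
exists (d / 2); first by lra.
move=> a b aP pb bad; apply/ler_addgt0Pr => eta eta0.
have C0 : 0 < e + rnorm (f p) + 1 by have := rnorm_ge0 (f p); lra.
have [N1 hN1] := small_h (e := d / 2) ltac:(lra).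
have [N2 hN2] := small_h (e := eta / 3 / (e + rnorm (f p) + 1))
  ltac:(by rewrite divr_gt0 //; lra).
have [N3 hN3] := GP a ltac:(lra) (eta / 3) ltac:(lra).
have [N4 hN4] := GP b ltac:(lra) (eta / 3) ltac:(lra).
pose n := (N1 + N2 + N3 + N4)%N.
have n1 : (N1 <= n)%N by rewrite /n -!addnA leq_addr.
have n2 : (N2 <= n)%N by rewrite /n -!addnA addnCA leq_addr.
have n3 : (N3 <= n)%N by rewrite /n addnAC leq_addl.
have n4 : (N4 <= n)%N by rewrite /n leq_addl.
have k1 := hN1 _ n1; have := hN2 _ n2; have k3 := hN3 _ n3; have k4 := hN4 _ n4.
rewrite ler_pdivlMr // => k2.
have E : G b - G a - (b - a)%:C%C *: f p =
  (F n b - F n a - (b - a)%:C%C *: f p) - (F n b - G b) + (F n a - G a) by lmod_ring.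
have H : forall t, a - h n <= t <= b -> rnorm (f t - f p) <= e.
  by move=> t tP; apply: fd; rewrite ler_norml; lra.
have := @F_step n a b (f p) e ltac:(lra) H.
rewrite E; set X := _ - _ - _ *: _.
have := rnormD (X - (F n b - G b)) (F n a - G a).
have := rnormB X (F n b - G b).
have : 0 < h n by [].
have := rnorm_ge0 (f p).
move: k2; nra.
Qed.

End Antiderivative.

(** * Holomorphic functions with compact support *)

Section MeanValue.
Context {R : realType} {V : completeNormedModType R[i]}.

(** Increments are taken over all short intervals around p, the form of
    differentiability that bisection consumes. *)
Definition antideriv (F f : R -> V) := forall p e : R, 0 <= p -> 0 < e ->
  exists2 d : R, 0 < d & forall a b : R, 0 <= a <= p -> p <= b -> b - a <= d ->
      rnorm (F b - F a - (b - a)%:C%C *: f p) <= e * (b - a).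

(** After subtraction of the antiderivative of the affine function this is a
    mean value inequality, proved by bisection because values are vectors.  The
    second-order term is what makes the four-point estimate below work. *)
Lemma antideriv_affine (F f : R -> V) a b p0 c d e : antideriv F f ->
  0 <= a <= b ->
  (forall t, a <= t <= b -> rnorm (f t - c - (t - p0)%:C%C *: d) <= e) ->
  rnorm (F b - F a - (b - a)%:C%C *: c
         - (((b - p0) ^+ 2 - (a - p0) ^+ 2) / 2)%:C%C *: d) <= e * (b - a).
Proof.
move=> Ff /andP[a0 ab] fcd.
pose G t := F t - t%:C%C *: c - ((t - p0) ^+ 2 / 2)%:C%C *: d.
have -> : F b - F a - (b - a)%:C%C *: c
         - (((b - p0) ^+ 2 - (a - p0) ^+ 2) / 2)%:C%C *: d = G b - G a.
  by rewrite /G; lmod_ring.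
suff key eta : 0 < eta -> rnorm (G b - G a) <= (e + eta) * (b - a).
  apply/ler_addgt0Pr => eta eta0.
  have [/eqP ba|ba] := eqVneq (b - a) 0.
    by have := key 1 ltr01; move: ba => /eqP ->; lra.
  have ba0 : 0 < b - a by rewrite lt_neqAle eq_sym ba; lra.
  have := key (eta / (b - a)) ltac:(by rewrite divr_gt0).
  by rewrite mulrDl divfK.
move=> eta0.
apply: (@rect_bisection R (fun a b _ _ => rnorm (G b - G a) <= (e + eta) * (b - a)) _
  a b 0 0) => //.
  move=> x y x' y' m n mE nE xy x'y' h1 h2 h3 h4.
  by have := rnorm_tri (G m) (G y) (G x); lra.
move=> p q pP qP.
have [d1 d10 Fp] := Ff p (eta / 2) ltac:(lra) ltac:(lra).
have nd := rnorm_ge0 d.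
exists (Num.min d1 (eta / 2 / (rnorm d + 1))).
  by rewrite lt_min d10 divr_gt0 //; lra.
move=> x y x' y' xP yP xP' yP'; rewrite le_min => /andP[yx1]; rewrite ler_pdivlMr; last by lra.
move=> yx2 yx3.
have -> : G y - G x = (F y - F x - (y - x)%:C%C *: f p)
   + (y - x)%:C%C *: (f p - c - (p - p0)%:C%C *: d)
   + ((y - x) * (p - p0) - ((y - p0) ^+ 2 - (x - p0) ^+ 2) / 2)%:C%C *: d.
  by rewrite /G; lmod_ring.
have b1 := Fp x y ltac:(lra) ltac:(lra) yx1.
have b2 := fcd p ltac:(lra).
rewrite (le_trans (rnormD _ _)) // (le_trans (lerD (rnormD _ _) (lexx _))) //.
rewrite !rnormZr (_ : _ - _ / 2 = (y - x) * (p - (x + y) / 2)); last by field.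
rewrite normrM (ger0_norm (x := y - x)); last by lra.
have b3 : `|p - (x + y) / 2| <= y - x by rewrite ler_norml; lra.
have yx0 : 0 <= y - x by lra.
set X := rnorm _ in b1 *; set Y := rnorm _ in b2 *; set Z := rnorm d in nd yx2 *.
have : (y - x) * Y <= (y - x) * e by rewrite ler_wpM2l.
have : (y - x) * `|p - (x + y) / 2| * Z <= (y - x) * ((y - x) * (Z + 1)).
  rewrite -mulrA ler_wpM2l // (le_trans (y := (y - x) * Z)) ?ler_wpM2r //.
  by rewrite ler_wpM2l //; lra.
have : (y - x) * ((y - x) * (Z + 1)) <= (y - x) * (eta / 2) by rewrite ler_wpM2l.
by lra.
Qed.

Lemma antideriv_bound (F f : R -> V) a b e : antideriv F f ->
  0 <= a -> 0 <= b ->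
  (forall t, Num.min a b <= t <= Num.max a b -> rnorm (f t) <= e) ->
  rnorm (F b - F a) <= e * `|b - a|.
Proof.
move=> Ff.
wlog ab : a b / a <= b.
  case/orP: (le_total a b) => [ab H|ba H b0 a0 fe]; first exact: H.
  rewrite rnormBC distrC; apply: (H b a) => // t; rewrite minC maxC; exact: fe.
move=> a0 b0 fe; rewrite ger0_norm ?subr_ge0 //.
have := @antideriv_affine F f a b 0 0 0 e Ff; rewrite a0 ab => /(_ isT).
rewrite !scaler0 !subr0; apply => t tP; rewrite scaler0 !subr0; apply: fe.
by rewrite (min_idPl ab) (max_idPr ab).
Qed.

Lemma antideriv0 (F f : R -> V) b : antideriv F f -> F 0 = 0 ->
  0 <= b -> (forall t, f t = 0) -> F b = 0.
Proof.
move=> Ff F0 b0 f0; apply: rnorm_eq0; apply: le_anti; rewrite rnorm_ge0 andbT.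
have := @antideriv_bound F f 0 b 0 Ff (lexx _) b0; rewrite F0 subr0 mul0r; apply.
by move=> t _; rewrite f0 rnorm0.
Qed.

End MeanValue.

Section PlaneMax.
Context {R : realType}.

Lemma square_max (u : R -> R -> R) (L : R) : 0 <= L ->
  (forall p q e, 0 <= p <= L -> 0 <= q <= L -> 0 < e ->
    exists2 d, 0 < d & forall x y, 0 <= x <= L -> 0 <= y <= L ->
      `|x - p| <= d -> `|y - q| <= d -> `|u x y - u p q| <= e) ->
  exists p q, [/\ 0 <= p <= L, 0 <= q <= L &
    forall x y, 0 <= x <= L -> 0 <= y <= L -> u x y <= u p q].
Proof.
move=> L0 ucont.
pose A : set (R * R) := `[0, L] `*` `[0, L].
have AP x y : A (x, y) <-> (0 <= x <= L) && (0 <= y <= L).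
  rewrite /A /= !in_itv /=; split; first by case=> -> ->.
  by case/andP.
have [| | |[p q] /[!inE] /AP/andP[pL qL] umax] := @compact_EVT_max _ R (fun z => u z.1 z.2) A.
- by exists (0, 0); apply/AP; rewrite !lexx L0.
- by apply: compact_setX; apply: segment_compact.
- apply/subspace_continuousP => -[p q] /AP/andP[pL qL].
  apply/cvgrPdist_le => e e0.
  have [d d0 ud] := ucont p q e pL qL e0.
  rewrite near_withinE.
  exists (ball p d, ball q d); first by split; apply: nbhsx_ballx.
  move=> [x y] [/= xp yq] /AP/andP[xL yL].
  rewrite distrC; apply: ud => //; rewrite distrC ltW //.
by exists p, q; split=> // x y xL yL; apply: (umax (x, y)); rewrite inE; apply/AP; rewrite xL.
Qed.

End PlaneMax.

(** Below, k is a function of x + i y which has a complex derivative D at every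
    point, not supposed continuous in the point, and whose support lies in an
    open square. *)
Section Goursat.
Context {R : realType} {V : completeNormedModType R[i]}.
Variables (k : R -> R -> V) (L : R).
Hypothesis kdiff : forall x y, exists D : V, forall e : R, 0 < e -> exists2 d : R, 0 < d &
  forall a b : R, `|a - x| <= d -> `|b - y| <= d ->
    rnorm (k a b - k x y - ((a - x)%:C%C + 'i%C * (b - y)%:C%C) *: D)
      <= e * (`|a - x| + `|b - y|).
Hypothesis ksupp : forall x y : R, ~~ ((0 < x < L) && (0 < y < L)) -> k x y = 0.

Let kbound x y : exists B : R, exists2 d : R, 0 < d &
  forall a b : R, `|a - x| <= d -> `|b - y| <= d -> rnorm (k a b) <= B /\
    rnorm (k a b - k x y) <= B * (`|a - x| + `|b - y|).
Proof.
have [D kD] := kdiff x y; have [d d0 kd] := kD 1 ltr01.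
exists (rnorm (k x y) + (rnorm D + 1) * (1 + 1)), (Num.min d 1).
  by rewrite lt_min d0 ltr01.
move=> a b; rewrite !le_min => /andP[a1 a2] /andP[b1 b2].
have := kd a b a1 b1; rewrite mul1r => h.
have nD := rnorm_ge0 D; have nk := rnorm_ge0 (k x y).
have h1 : rnorm (((a - x)%:C%C + 'i%C * (b - y)%:C%C) *: D) <= (`|a - x| + `|b - y|) * rnorm D.
  rewrite scalerDl -scalerA (le_trans (rnormD _ _)) //.
  by rewrite rnormZi !rnormZr mulrDl.
have h2 : rnorm (k a b - k x y) <= (rnorm D + 1) * (`|a - x| + `|b - y|).
  have := rnormD (k a b - k x y - ((a - x)%:C%C + 'i%C * (b - y)%:C%C) *: D)
    (((a - x)%:C%C + 'i%C * (b - y)%:C%C) *: D).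
  by rewrite subrK; lra.
have a0 := normr_ge0 (a - x); have b0 := normr_ge0 (b - y).
split.
  have := rnormD (k a b - k x y) (k x y); rewrite subrK.
  have : (rnorm D + 1) * (`|a - x| + `|b - y|) <= (rnorm D + 1) * (1 + 1).
    by apply: ler_wpM2l; lra.
  by lra.
by apply: le_trans h2 _; apply: ler_wpM2r; lra.
Qed.

Let kcont_at x y e : 0 < e -> exists2 d : R, 0 < d &
  forall a b : R, `|a - x| <= d -> `|b - y| <= d -> rnorm (k a b - k x y) <= e.
Proof.
move=> e0; have [B [d d0 kB]] := kbound x y.
have B0 : 0 <= B.
  have [+ _] := kB x y ltac:(by rewrite subrr normr0 ltW) ltac:(by rewrite subrr normr0 ltW).
  by apply: le_trans; exact: rnorm_ge0.
exists (Num.min d (e / 2 / (B + 1))).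
  by rewrite lt_min d0 !divr_gt0 //; lra.
move=> a b; rewrite !le_min => /andP[a1 a2] /andP[b1 b2].
have [_ /le_trans] := kB a b a1 b1; apply.
move: a2 b2; rewrite !ler_pdivlMr; try lra.
have := normr_ge0 (a - x); have := normr_ge0 (b - y).
by nra.
Qed.

Let horiz y : exists F, F 0 = 0 /\ antideriv F (k^~ y).
Proof.
apply: antiderivative_exists => p e e0; have [d d0 kd] := kcont_at p y e0.
by exists d => // t tp; apply: kd => //; rewrite subrr normr0 ltW.
Qed.

Let vert x : exists F, F 0 = 0 /\ antideriv F (k x).
Proof.
apply: antiderivative_exists => p e e0; have [d d0 kd] := kcont_at x p e0.
by exists d => // t tp; apply: kd => //; rewrite subrr normr0 ltW.
Qed.

(** H and Y integrate k along horizontal and vertical lines.  As dz = i dy on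
    vertical lines, the mixed difference of W = H - i Y over a rectangle is, up
    to sign, the contour integral of k along its boundary. *)
Section Primitives.
Variables (H Y : R -> R -> V).
Hypotheses (H0 : forall y, H 0 y = 0) (HP : forall y, antideriv (H^~ y) (k^~ y)).
Hypotheses (Y0 : forall x, Y x 0 = 0) (YP : forall x, antideriv (Y x) (k x)).

Let W x y := H x y - 'i%C *: Y x y.
Let mixed a b c d := W b d - W a d - W b c + W a c.

(** Goursat's argument: near each point the contour integral of the affine part
    of k vanishes exactly, which leaves o(size^2), and bisection adds this up. *)
Let goursat x y : 0 <= x -> 0 <= y -> mixed 0 x 0 y = 0.
Proof.
move=> x0 y0; apply: rnorm_eq0_small => eps eps0.
pose s := x + y + 1; have s0 : 0 < s by rewrite /s; lra.
pose e := eps / 2 / s ^+ 2.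
have e0 : 0 < e by rewrite !divr_gt0 // exprn_gt0.
apply: (@le_trans _ _ (2 * e * ((x - 0) + (y - 0)) ^+ 2)); last first.
  have -> : eps = 2 * e * s ^+ 2 by rewrite /e; field; rewrite gt_eqF.
  rewrite ler_pM2l; last by lra.
  by rewrite ler_sqr ?nnegrE /s; lra.
apply: (@rect_bisection R (fun a b c d =>
  rnorm (mixed a b c d) <= 2 * e * ((b - a) + (d - c)) ^+ 2) _ 0 x 0 y) => //.
  move=> a b c d m n -> -> _ _ h1 h2 h3 h4.
  set m' := (a + b) / 2 in h1 h2 h3 h4; set n' := (c + d) / 2 in h1 h2 h3 h4.
  have -> : mixed a b c d = mixed a m' c n' + mixed m' b c n' + mixed a m' n' d
    + mixed m' b n' d by rewrite /mixed; lmod_ring.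
  have E : 2 * e * (b - a + (d - c)) ^+ 2 = 4 * (2 * e * ((b - a + (d - c)) / 2) ^+ 2).
    by field.
  rewrite (_ : m' - a + (n' - c) = (b - a + (d - c)) / 2) in h1; last by rewrite /m' /n'; field.
  rewrite (_ : b - m' + (n' - c) = (b - a + (d - c)) / 2) in h2; last by rewrite /m' /n'; field.
  rewrite (_ : m' - a + (d - n') = (b - a + (d - c)) / 2) in h3; last by rewrite /m' /n'; field.
  rewrite (_ : b - m' + (d - n') = (b - a + (d - c)) / 2) in h4; last by rewrite /m' /n'; field.
  rewrite E; move: h1 h2 h3 h4.
  set v1 := mixed a m' _ _; set v2 := mixed m' b _ _; set v3 := mixed a m' _ _.
  set v4 := mixed m' b _ _ => h1 h2 h3 h4.
  have := rnormD (v1 + v2 + v3) v4; have := rnormD (v1 + v2) v3; have := rnormD v1 v2.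
  by lra.
move=> p q pP qP; have [D kD] := kdiff p q.
have [d d0 kd] := kD e e0; exists d => // a b c c' aP bP cP dP ba dc.
set sg := (b - a) + (c' - c).
have hor z : c <= z <= c' -> rnorm (H b z - H a z
    - (b - a)%:C%C *: (k p q + (z - q)%:C%C *: ('i%C *: D))
    - (((b - p) ^+ 2 - (a - p) ^+ 2) / 2)%:C%C *: D) <= e * sg * (b - a).
  move=> zP; apply: (antideriv_affine (HP z)); first by lra.
  move=> t tP.
  have -> : k t z - (k p q + (z - q)%:C%C *: ('i%C *: D)) - (t - p)%:C%C *: D =
     k t z - k p q - ((t - p)%:C%C + 'i%C * (z - q)%:C%C) *: D by lmod_ring.
  have t1 : `|t - p| <= b - a by rewrite ler_norml; lra.
  have z1 : `|z - q| <= c' - c by rewrite ler_norml; lra.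
  apply: (le_trans (kd _ _ (le_trans t1 ba) (le_trans z1 dc))).
  by rewrite ler_pM2l // lerD.
have ver z : a <= z <= b -> rnorm (Y z c' - Y z c
    - (c' - c)%:C%C *: (k p q + (z - p)%:C%C *: D)
    - (((c' - q) ^+ 2 - (c - q) ^+ 2) / 2)%:C%C *: ('i%C *: D)) <= e * sg * (c' - c).
  move=> zP; apply: (antideriv_affine (YP z)); first by lra.
  move=> t tP.
  have -> : k z t - (k p q + (z - p)%:C%C *: D) - (t - q)%:C%C *: ('i%C *: D) =
     k z t - k p q - ((z - p)%:C%C + 'i%C * (t - q)%:C%C) *: D by lmod_ring.
  have z1 : `|z - p| <= b - a by rewrite ler_norml; lra.
  have t1 : `|t - q| <= c' - c by rewrite ler_norml; lra.
  apply: (le_trans (kd _ _ (le_trans z1 ba) (le_trans t1 dc))).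
  by rewrite ler_pM2l // lerD.
have ab : a <= b by lra.
have cc : c <= c' by lra.
have := hor c' ltac:(by rewrite cc lexx); have := hor c ltac:(by rewrite cc lexx).
have := ver a ltac:(by rewrite ab lexx); have := ver b ltac:(by rewrite ab lexx).
set v1 := (X in rnorm X <= _ -> _); set v2 := (X in _ -> rnorm X <= _ -> _).
set v3 := (X in _ -> _ -> rnorm X <= _ -> _).
set v4 := (X in _ -> _ -> _ -> rnorm X <= _ -> _).
have -> : mixed a b c c' = v4 - v3 - 'i%C *: (v1 - v2).
  by rewrite /mixed /W /v1 /v2 /v3 /v4; lmod_ring.
have := rnormB (v4 - v3) ('i%C *: (v1 - v2)); rewrite rnormZi.
have := rnormB v4 v3; have := rnormB v1 v2.
have : e * sg * (b - a) + e * sg * (c' - c) = e * (sg * sg) by rewrite -mulrDr mulrA.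
by rewrite expr2 -/sg; lra.
Qed.

(** W vanishes on the axes, hence everywhere: H is a complex primitive of k. *)
Let in_first_quadrant x y : 0 <= x -> 0 <= y -> H x y = 'i%C *: Y x y.
Proof.
move=> x0 y0; apply/eqP; rewrite -subr_eq0 -/(W x y); apply/eqP.
have Yz : Y 0 y = 0.
  apply: (antideriv0 (YP 0)) => // t; apply: ksupp; by rewrite ltxx.
have Hz : H x 0 = 0.
  apply: (antideriv0 (HP 0)) => // t; apply: ksupp; by rewrite ltxx andbF.
have := goursat x0 y0; rewrite /mixed /W !H0 !Y0 Yz Hz !scaler0 !subr0.
by rewrite addr0.
Qed.

Let H_outside x y : 0 <= x -> 0 <= y -> ~~ ((0 < x < L) && (0 < y < L)) -> H x y = 0.
Proof.
move=> x0 y0; rewrite negb_and => /orP[] bad.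
  rewrite in_first_quadrant //.
  rewrite (antideriv0 (YP x)) ?scaler0 // => t; apply: ksupp; by rewrite negb_and bad.
by apply: (antideriv0 (HP y)) => // t; apply: ksupp; rewrite negb_and bad orbT.
Qed.

Let H_cont p q e : 0 <= p -> 0 <= q -> 0 < e -> exists2 d : R, 0 < d &
  forall x y, 0 <= x -> 0 <= y -> `|x - p| <= d -> `|y - q| <= d ->
    rnorm (H x y - H p q) <= e.
Proof.
move=> p0 q0 e0; have [B [d d0 kB]] := kbound p q.
have kB1 a b : `|a - p| <= d -> `|b - q| <= d -> rnorm (k a b) <= B.
  by move=> h1 h2; have [] := kB a b h1 h2.
have B0 : 0 <= B.
  apply: (le_trans (rnorm_ge0 (k p q))); apply: kB1; by rewrite subrr normr0 ltW.
exists (Num.min d (e / 2 / (B + 1))).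
  by rewrite lt_min d0 !divr_gt0 //; lra.
move=> x y x0 y0; rewrite !le_min => /andP[x1 x2] /andP[y1 y2].
have b1 : rnorm (H x y - H p y) <= B * `|x - p|.
  apply: (antideriv_bound (HP y)) => // t /andP[t1 t2]; apply: kB1 => //.
  by move: x1 t1 t2; rewrite !ler_norml ge_min le_max => /andP[? ?] /orP[?|?] /orP[?|?]; lra.
have b2 : rnorm (H p y - H p q) <= B * `|y - q|.
  rewrite !in_first_quadrant // -scalerBr rnormZi.
  apply: (antideriv_bound (YP p)) => // t /andP[t1 t2]; apply: kB1.
    by rewrite subrr normr0 ltW.
  by move: y1 t1 t2; rewrite !ler_norml ge_min le_max => /andP[? ?] /orP[?|?] /orP[?|?]; lra.
have := rnorm_tri (H p y) (H x y) (H p q).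
move: x2 y2; rewrite !ler_pdivlMr; try lra.
by have := normr_ge0 (x - p); have := normr_ge0 (y - q); lra.
Qed.

(** The primitive H has a second-order expansion at each point, whose terms of
    order 1 and 2 cancel in the sum over the directions 1, i, -1, -i. *)
Let four_point p q e : 0 < p < L -> 0 < q < L -> 0 < e -> exists2 d : R, 0 < d &
  forall r, 0 < r <= d -> r <= p -> r <= q ->
    rnorm (H (p + r) q + H (p - r) q + H p (q + r) + H p (q - r) - 4%:R *: H p q)
      <= 4 * e * r ^+ 2.
Proof.
move=> pL qL e0; have [D kD] := kdiff p q.
have [d d0 kd] := kD e e0; exists d => // r rd rp rq.
pose jD := 'i%C *: D.
have jjD : 'i%C *: jD = - D by rewrite scalerA -expr2 sqr_i scaleN1r.
have hor a b : p - r <= a <= b -> b <= p + r -> rnorm (H b q - H a q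
    - (b - a)%:C%C *: k p q - (((b - p) ^+ 2 - (a - p) ^+ 2) / 2)%:C%C *: D)
       <= e * r * (b - a).
  move=> ab br; apply: (antideriv_affine (HP q)); first by lra.
  move=> t tP; have : `|t - p| <= r by rewrite ler_norml; lra.
  have /= := kd t q; rewrite subrr normr0 mulr0 !addr0 => h tr.
  apply: (le_trans (h _ _)); try lra.
  by rewrite ler_pM2l.
have ver a b : q - r <= a <= b -> b <= q + r -> rnorm (Y p b - Y p a
    - (b - a)%:C%C *: k p q - (((b - q) ^+ 2 - (a - q) ^+ 2) / 2)%:C%C *: jD)
       <= e * r * (b - a).
  move=> ab br; apply: (antideriv_affine (YP p)); first by lra.
  move=> t tP; have : `|t - q| <= r by rewrite ler_norml; lra.
  have -> : k p t - k p q - (t - q)%:C%C *: jD =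
    k p t - k p q - ((p - p)%:C%C + 'i%C * (t - q)%:C%C) *: D by rewrite /jD; lmod_ring.
  move=> tr; apply: (le_trans (kd _ _ _ _)); rewrite ?subrr ?normr0 ?add0r; try lra.
  by rewrite ler_pM2l.
rewrite !(@in_first_quadrant p); try lra.
have := hor p (p + r) ltac:(lra) ltac:(lra); have := hor (p - r) p ltac:(lra) ltac:(lra).
have := ver q (q + r) ltac:(lra) ltac:(lra); have := ver (q - r) q ltac:(lra) ltac:(lra).
have -> : 4%:R *: ('i%C *: Y p q) = (H p q + H p q) + ('i%C *: Y p q + 'i%C *: Y p q).
  have -> : H p q = 'i%C *: Y p q by apply: in_first_quadrant; lra.
  by lmod_ring.
set v1 := (X in rnorm X <= _ -> _); set v2 := (X in _ -> rnorm X <= _ -> _).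
set v3 := (X in _ -> _ -> rnorm X <= _ -> _).
set v4 := (X in _ -> _ -> _ -> rnorm X <= _ -> _).
rewrite [X in rnorm X <= 4 * _ * _](_ : _ = (v4 - v3) + 'i%C *: (v2 - v1)); last first.
  have Dj : D = - ('i%C *: jD) by rewrite jjD opprK.
  by rewrite /v1 /v2 /v3 /v4 [in RHS]Dj; lmod_ring.
have := rnormD (v4 - v3) ('i%C *: (v2 - v1)); rewrite rnormZi.
have := rnormB v4 v3; have := rnormB v2 v1.
rewrite expr2 => h1 h2 h3 h4 h5 h6 h7.
have : e * r * (q - (q - r)) = e * (r * r) by ring.
have : e * r * (q + r - q) = e * (r * r) by ring.
have : e * r * (p - (p - r)) = e * (r * r) by ring.
have : e * r * (p + r - p) = e * (r * r) by ring.
by lra.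
Qed.

(** Maximum principle: at an interior maximum of |H| + e (x^2 + y^2), the mean
    over the four neighbours at distance r would exceed the value at the centre
    by e r^2 + o(r^2). *)
Let H_eq0 x y : 0 <= x <= L -> 0 <= y <= L -> H x y = 0.
Proof.
move=> xL yL; apply: contrapT => Hn.
pose mu := rnorm (H x y).
have mu0 : 0 < mu.
  by rewrite lt_neqAle rnorm_ge0 andbT; apply/eqP => /esym/rnorm_eq0.
have L0 : 0 < L.
  have : 0 <= L by lra.
  rewrite le_eqVlt => /orP[/eqP E|]; last by [].
  case: Hn; apply: H_outside; try lra.
pose e := mu / (4 * L ^+ 2).
have e0 : 0 < e by rewrite divr_gt0 // mulr_gt0 // exprn_gt0.
pose u a b := rnorm (H a b) + e * (a ^+ 2 + b ^+ 2).
have [p [q [pL qL umax]]] : exists p q, [/\ 0 <= p <= L, 0 <= q <= L &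
    forall a b, 0 <= a <= L -> 0 <= b <= L -> u a b <= u p q].
  apply: square_max => [|p q eta pL qL eta0]; first exact: ltW.
  have [d d0 Hd] := @H_cont p q (eta / 2) ltac:(lra) ltac:(lra) ltac:(lra).
  have eL0 : 0 < e * L by apply: mulr_gt0.
  have C0 : 0 < e * (4 * L) * 2 by lra.
  exists (Num.min d (eta / 2 / (e * (4 * L) * 2))).
    by rewrite lt_min d0 !divr_gt0.
  move=> a b aL bL; rewrite !le_min => /andP[a1 a2] /andP[b1 b2].
  have h := Hd a b ltac:(lra) ltac:(lra) a1 b1.
  have sq c z : 0 <= c <= L -> 0 <= z <= L -> `|c - z| <= eta / 2 / (e * (4 * L) * 2) ->
      `|e * (c ^+ 2 - z ^+ 2)| <= eta / 4.
    move=> cL zL; rewrite ler_pdivlMr // => cz.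
    rewrite normrM (ger0_norm (ltW e0)) subr_sqr normrM.
    have cz2 : `|c + z| <= 2 * L by rewrite ler_norml; lra.
    have : e * (`|c - z| * `|c + z|) <= e * (`|c - z| * (2 * L)).
      by rewrite ler_pM2l // ler_wpM2l.
    by lra.
  have s1 := sq a p aL pL a2; have s2 := sq b q bL qL b2.
  rewrite /u (_ : _ - _ = (rnorm (H a b) - rnorm (H p q)) + e * (a ^+ 2 - p ^+ 2) +
    e * (b ^+ 2 - q ^+ 2)); last by ring.
  have h' : `|rnorm (H a b) - rnorm (H p q)| <= eta / 2.
    have := rnorm_tri (H p q) (H a b) 0; have := rnorm_tri (H a b) (H p q) 0.
    by rewrite !subr0 (rnormBC (H p q)) ler_norml; lra.
  rewrite (le_trans (ler_normD _ _)) // (le_trans (lerD (ler_normD _ _) (lexx _))) //.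
  by lra.
have uH : mu <= u p q.
  apply: le_trans (umax x y xL yL); rewrite /u -/mu lerDl mulr_ge0 ?(ltW e0) //.
  by rewrite addr_ge0 // sqr_ge0.
have inside : (0 < p < L) && (0 < q < L).
  apply: contrapT => /negP out; move: uH; rewrite /u (H_outside _ _ out); try lra.
  rewrite rnorm0 add0r => le.
  have : e * (p ^+ 2 + q ^+ 2) <= e * (L ^+ 2 + L ^+ 2).
    by rewrite ler_pM2l // lerD // ler_sqr ?nnegrE; lra.
  have : e * (L ^+ 2 + L ^+ 2) = mu / 2 by rewrite /e; field; rewrite gt_eqF.
  by lra.
have /andP[pL' qL'] := inside.
have [d d0 fp] := four_point pL' qL' (e := e / 2) ltac:(lra).
pose r := Num.min d (Num.min (Num.min p q) (Num.min (L - p) (L - q))).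
have r0 : 0 < r by rewrite !lt_min d0 /=; lra.
have : r <= r by []; rewrite {2}/r !le_min => /and3P[rd /andP[rp rq] /andP[rp' rq']].
have := fp r ltac:(by rewrite r0) rp rq.
have := umax (p + r) q ltac:(lra) qL; have := umax (p - r) q ltac:(lra) qL.
have := umax p (q + r) pL ltac:(lra); have := umax p (q - r) pL ltac:(lra).
rewrite /u.
set h1 := H (p + r) q; set h2 := H (p - r) q; set h3 := H p (q + r).
set h4 := H p (q - r); set h0 := H p q => u4 u3 u2 u1 S.
have : rnorm (4%:R *: h0) = 4 * rnorm h0.
  rewrite (_ : 4%:R = (4 : R)%:C%C :> R[i]); last by rewrite rmorph_nat.
  by rewrite rnormZr_ge0.
have := rnormB (h1 + h2 + h3 + h4) (h1 + h2 + h3 + h4 - 4%:R *: h0).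
rewrite opprB addrC subrK.
have := rnormD (h1 + h2 + h3) h4; have := rnormD (h1 + h2) h3; have := rnormD h1 h2.
have : 0 < e * r ^+ 2 by rewrite mulr_gt0 // exprn_gt0.
by lra.
Qed.

Lemma eq0_of_primitives x y : k x y = 0.
Proof.
have [inside|out] := boolP ((0 < x < L) && (0 < y < L)); last exact: ksupp.
apply: rnorm_eq0_small => e e0.
have [d d0 Hd] := HP y (p := x) ltac:(lra) e0.
pose r := Num.min d (L - x).
have r0 : 0 < r by rewrite lt_min d0 /=; lra.
have : r <= r by []; rewrite {2}/r !le_min => /andP[rd rL].
have := Hd x (x + r) ltac:(lra) ltac:(lra) ltac:(lra).
rewrite !H_eq0; try lra.
rewrite subrr sub0r rnormN (addrC x) addrK rnormZr_ge0 ?(ltW r0) //.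
by rewrite mulrC ler_pM2r.
Qed.

End Primitives.

(** The primitive of k is compactly supported as well, and has the second-order
    expansions that k itself may lack; the maximum principle kills it. *)
Theorem compact_support_holomorphic_eq0 x y : k x y = 0.
Proof.
have [F FP] := choice horiz; have [G GP] := choice vert.
apply: (@eq0_of_primitives (fun a b => F b a) G) => a; by have [] := FP a; have [] := GP a.
Qed.

End Goursat.

(** * Derivatives in Banach algebras *)

(** Once a noncommutative expression is fully expanded, its monomials can be
    treated as independent vectors. *)
Ltac nc_ring := rewrite ?(mulrDl, mulrDr, mulNr, mulrN, opprK, mulr1, mul1r, mulr0, mul0r, mulrA); lmod_ring.

Section Derivative.
Context {R : realType}.

(** Frechet differentiability with a C-linear derivative, in terms of the real
    norms. *)
Definition frechet {A C : banachAlgType R} (f : A -> C) (x : A) (L : A -> C) : Prop :=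
  [/\ linear L, exists2 K : R, 0 <= K & forall h, bnorm (L h) <= K * bnorm h &
   forall e : R, 0 < e -> exists2 d : R, 0 < d & forall h, bnorm h <= d ->
     bnorm (f (x + h) - f x - L h) <= e * bnorm h].

Definition locally_lip {A C : banachAlgType R} (f : A -> C) (x : A) : Prop :=
  exists2 K : R, 0 <= K & exists2 d : R, 0 < d & forall h, bnorm h <= d ->
    bnorm (f (x + h) - f x) <= K * bnorm h.

Lemma frechet_lip {A C : banachAlgType R} (f : A -> C) x L : frechet f x L -> locally_lip f x.
Proof.
move=> [_ [K K0 LK] fD]; exists (K + 1); first by lra.
have [d d0 fd] := fD 1 ltr01; exists d => // h hd.
rewrite -[X in bnorm X](subrK (L h)) (le_trans (bnormD _ _)) //.
by have := fd h hd; have := LK h; lra.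
Qed.

Lemma frechet_blin {A C : banachAlgType R} (L : A -> C) x : linear L ->
  (exists2 K : R, 0 <= K & forall h, bnorm (L h) <= K * bnorm h) -> frechet L x L.
Proof.
move=> Ll Lb; split=> // e e0; exists 1 => // h _.
have -> : L (x + h) = L x + L h by have := Ll 1 x h; rewrite !scale1r.
by rewrite (_ : _ - _ - _ = 0) ?bnorm0 ?mulr_ge0 ?bnorm_ge0 ?(ltW e0) //; lmod_ring.
Qed.

Lemma frechet_id {A : banachAlgType R} (x : A) : frechet id x id.
Proof. by apply: frechet_blin => //; exists 1 => // h; rewrite mul1r. Qed.

Lemma frechet_cst {A C : banachAlgType R} (c : C) (x : A) : frechet (fun=> c) x (fun=> 0).
Proof.
split; first by move=> a u v; rewrite scaler0 addr0.
  by exists 0 => // h; rewrite bnorm0 mul0r.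
move=> e e0; exists 1 => // h _.
by rewrite subr0 subrr bnorm0 mulr_ge0 ?bnorm_ge0 ?(ltW e0).
Qed.

Lemma frechet_ext {A C : banachAlgType R} (f g : A -> C) x L L' : frechet f x L ->
  L =1 L' ->
  (exists2 d : R, 0 < d & forall h, bnorm h <= d -> f (x + h) = g (x + h)) -> frechet g x L'.
Proof.
move=> [Ll [K K0 LK] fD] LL' [d d0 fg].
have -> : L' = L by apply/funext.
split=> //; first by exists K.
move=> e /fD[d' d'0 fd]; exists (Num.min d d'); first by rewrite lt_min d0.
move=> h; rewrite le_min => /andP[hd hd'].
have gx : f x = g x by have := fg 0; rewrite bnorm0 addr0; apply; exact: ltW.
by rewrite -fg // -gx; apply: fd.
Qed.

Lemma frechet_add {A C : banachAlgType R} (f g : A -> C) x L M : frechet f x L -> frechet g x M ->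
  frechet (fun a => f a + g a) x (fun h => L h + M h).
Proof.
move=> [Ll [K K0 LK] fD] [Ml [K' K'0 MK] gD]; split.
- by move=> a u v; rewrite Ll Ml; lmod_ring.
- exists (K + K'); first by lra.
  move=> h; rewrite (le_trans (bnormD _ _)) // mulrDl.
  by have := LK h; have := MK h; lra.
move=> e e0; have [d d0 fd] := fD (e / 2) ltac:(lra).
have [d' d'0 gd] := gD (e / 2) ltac:(lra).
exists (Num.min d d'); first by rewrite lt_min d0.
move=> h; rewrite le_min => /andP[/fd hf /gd hg].
rewrite (_ : _ - _ - _ = (f (x + h) - f x - L h) + (g (x + h) - g x - M h)); last by lmod_ring.
by rewrite (le_trans (bnormD _ _)) //; lra.
Qed.

Lemma frechet_mul {A C : banachAlgType R} (f g : A -> C) x L M : frechet f x L -> frechet g x M ->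
  frechet (fun a => f a * g a) x (fun h => L h * g x + f x * M h).
Proof.
move=> fL gM; have [Kf Kf0 [df df0 lf]] := frechet_lip fL; have [Kg Kg0 [dg dg0 lg]] := frechet_lip gM.
move: fL gM => [Ll [K K0 LK] fD] [Ml [K' K'0 MK] gD].
have f0 := bnorm_ge0 (f x); have g0 := bnorm_ge0 (g x).
split.
- by move=> a u v; rewrite Ll Ml mulrDl mulrDr -scalerAl -scalerAr; lmod_ring.
- exists (K * bnorm (g x) + bnorm (f x) * K'); first by rewrite addr_ge0 // mulr_ge0.
  move=> h; rewrite (le_trans (bnormD _ _)) //.
  have := bnormM_le (LK h) (lexx (bnorm (g x))).
  have := bnormM_le (lexx (bnorm (f x))) (MK h).
  by lra.
move=> e e0; pose S := bnorm (f x) + bnorm (g x) + 1; have S0 : 0 < S by rewrite /S; lra.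
have e1 : 0 < e / 2 / S by rewrite !divr_gt0.
have [d d0 fd] := fD _ e1; have [d' d'0 gd] := gD _ e1.
pose P := Kf * Kg + 1; have P0 : 0 < P by rewrite /P; have := mulr_ge0 Kf0 Kg0; lra.
have e2 : 0 < e / 2 / P by rewrite !divr_gt0.
exists (Num.min (Num.min d d') (Num.min (Num.min df dg) (e / 2 / P))).
  by rewrite !lt_min d0 d'0 df0 dg0.
move=> h; rewrite !le_min => /andP[/andP[/fd hf /gd hg] /andP[/andP[/lf kf /lg kg] hP]].
have h0 := bnorm_ge0 h.
rewrite (_ : _ - _ - _ = (f (x + h) - f x - L h) * g x + f x * (g (x + h) - g x - M h)
  + (f (x + h) - f x) * (g (x + h) - g x)); last by nc_ring.
rewrite (le_trans (bnormD _ _)) // (le_trans (lerD (bnormD _ _) (lexx _))) //.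
have b1 := bnormM_le hf (lexx (bnorm (g x))).
have b2 := bnormM_le (lexx (bnorm (f x))) hg.
have b3 := bnormM_le kf kg.
have E : e / 2 / S * bnorm h * bnorm (g x) + bnorm (f x) * (e / 2 / S * bnorm h)
  <= e / 2 * bnorm h.
  have -> : e / 2 / S * bnorm h * bnorm (g x) + bnorm (f x) * (e / 2 / S * bnorm h) =
    (e / 2 / S * bnorm h) * (bnorm (f x) + bnorm (g x)) by ring.
  have -> : e / 2 * bnorm h = (e / 2 / S * bnorm h) * S by field; rewrite gt_eqF.
  by apply: ler_wpM2l; [rewrite mulr_ge0 // ltW | rewrite /S; lra].
have E2 : Kf * bnorm h * (Kg * bnorm h) <= e / 2 * bnorm h.
  have -> : Kf * bnorm h * (Kg * bnorm h) = (Kf * Kg) * bnorm h * bnorm h by ring.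
  apply: ler_wpM2r => //; move: hP; rewrite ler_pdivlMr // /P.
  by lra.
by lra.
Qed.

Lemma frechet_comp {A C F : banachAlgType R} (f : A -> C) (g : C -> F) x L M :
  frechet f x L -> frechet g (f x) M -> frechet (g \o f) x (M \o L).
Proof.
move=> fL gM; have [Kf Kf0 [df df0 lf]] := frechet_lip fL.
move: fL gM => [Ll [K K0 LK] fD] [Ml [K' K'0 MK] gD]; split.
- by move=> a u v; rewrite /= Ll Ml.
- exists (K' * K); first by rewrite mulr_ge0.
  by move=> h /=; rewrite (le_trans (MK _)) // -mulrA ler_wpM2l.
move=> e e0.
have e1 : 0 < e / 2 / (Kf + 1) by rewrite !divr_gt0 //; lra.
have e2 : 0 < e / 2 / (K' + 1) by rewrite !divr_gt0 //; lra.
have [d d0 gd] := gD _ e1; have [d' d'0 fd] := fD _ e2.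
exists (Num.min (Num.min df d') (d / (Kf + 1))).
  by rewrite !lt_min df0 d'0 divr_gt0 //; lra.
move=> h; rewrite !le_min => /andP[/andP[/lf kf /fd hf]]; rewrite ler_pdivlMr; last by lra.
move=> hd; have h0 := bnorm_ge0 h.
pose u := f (x + h) - f x.
have ud : bnorm u <= d by apply: le_trans kf _; lra.
have /= := gd u ud; rewrite [f x + u](_ : _ = f (x + h)); last by rewrite /u; lmod_ring.
move=> gu.
have Mu : M u = M (u - L h) + M (L h).
  by have := Ml 1 (u - L h) (L h); rewrite !scale1r subrK.
rewrite (_ : _ - _ - _ = (g (f (x + h)) - g (f x) - M u) + M (u - L h)); last first.
  by rewrite Mu /=; lmod_ring.
rewrite (le_trans (bnormD _ _)) //.
have b1 : e / 2 / (Kf + 1) * bnorm u <= e / 2 * bnorm h.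
  apply: (@le_trans _ _ (e / 2 / (Kf + 1) * ((Kf + 1) * bnorm h))).
    by apply: ler_wpM2l; [exact: ltW|rewrite /u; lra].
  by rewrite mulrA divfK // gt_eqF //; lra.
have b2 : K' * bnorm (u - L h) <= e / 2 * bnorm h.
  apply: (@le_trans _ _ ((K' + 1) * (e / 2 / (K' + 1) * bnorm h))).
    apply: ler_pM => //; try lra; exact: bnorm_ge0.
  by rewrite mulrA (mulrC (K' + 1)) divfK // gt_eqF //; lra.
by have := MK (u - L h); lra.
Qed.

Lemma frechet_inv {A : banachAlgType R} (a : A) : bunit a ->
  frechet binv a (fun h => - (binv a * h * binv a)).
Proof.
move=> au; pose K := bnorm (binv a); have K0 : 0 <= K by apply: bnorm_ge0.
split.
- by move=> k u v; rewrite mulrDr mulrDl -scalerAr -scalerAl; lmod_ring.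
- exists (K * K); first by rewrite mulr_ge0.
  move=> h; rewrite bnormN (mulrAC K); apply: bnormM_le => //; exact: bnormM_le.
move=> e e0; pose D := 2 * K * (K * K) + 1.
have D0 : 0 < D by rewrite /D; have := mulr_ge0 K0 (mulr_ge0 K0 K0); lra.
exists (Num.min (1 / 2 / (K + 1)) (e / D)); first by rewrite lt_min !divr_gt0 //; lra.
move=> h; rewrite le_min !ler_pdivlMr //; last by lra.
move=> /andP[hK he]; have h0 := bnorm_ge0 h.
have [ahu ahb] := @binv_perturb _ _ a h K au (lexx _) ltac:(lra).
set b := binv (a + h) in ahb *.
have bE : b = binv a - b * h * binv a.
  have := mulbVr ahu; rewrite -/b mulrDr => bah.
  have : (b * a + b * h) * binv a = binv a by rewrite bah mul1r.
  by rewrite mulrDl -(mulrA b a) mulrbV // mulr1 => E; rewrite -[X in X - _]E addrK.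
have ib : binv a - b = b * h * binv a by rewrite [X in _ - X]bE; lmod_ring.
rewrite -[b - binv a]opprB ib.
rewrite (_ : _ - _ = b * h * binv a * h * binv a); last by rewrite -[in RHS]ib; nc_ring.
have h1 : bnorm (b * h * binv a * h * binv a) <= 2 * K * bnorm h * K * bnorm h * K.
  by do 4 (apply: bnormM_le => //).
apply: le_trans h1 _.
rewrite (_ : 2 * K * bnorm h * K * bnorm h * K = (2 * K * (K * K)) * bnorm h * bnorm h); last by ring.
by apply: ler_wpM2r => //; rewrite /D in he; lra.
Qed.

End Derivative.

(** * The local inverse of psi and the S-transform *)

(** Apply M to the expansion at g w of h = f (g (w + h)) - f (g w); the error
    is o(h) because g is Lipschitz at w. *)
Lemma frechet_inverse {R : realType} {A C : banachAlgType R} (f : A -> C) (g : C -> A) w L M :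
  frechet f (g w) L -> locally_lip g w -> linear M ->
  (exists2 K : R, 0 <= K & forall h, bnorm (M h) <= K * bnorm h) ->
  (forall v, M (L v) = v) ->
  (exists2 d : R, 0 < d & forall h, bnorm h <= d -> f (g (w + h)) = w + h) ->
  frechet g w M.
Proof.
move=> [Ll _ fD] [C0 C00 [d0 d00 gl]] Ml [K K0 MK] ML [d1 d10 fg].
split=> //; first by exists K.
move=> e e0.
have P0 : 0 < K * C0 + 1 by have := mulr_ge0 K0 C00; lra.
have [d d'0 fd] := fD (e / (K * C0 + 1)) ltac:(by rewrite divr_gt0).
exists (Num.min (Num.min d0 d1) (d / (C0 + 1))).
  by rewrite !lt_min d00 d10 divr_gt0 //; lra.
move=> h; rewrite !le_min => /andP[/andP[/gl kg /fg fgh]].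
rewrite ler_pdivlMr; last by lra.
move=> hd; have h0 := bnorm_ge0 h.
pose u := g (w + h) - g w.
have ud : bnorm u <= d by rewrite /u; lra.
have := fd u ud; rewrite [g w + u](_ : _ = g (w + h)); last by rewrite /u; lmod_ring.
have fgw : f (g w) = w.
  have := fg 0; rewrite addr0; apply; rewrite bnorm0; exact: ltW.
rewrite fgh fgw [w + h - w](_ : _ = h); last by lmod_ring.
move=> hu.
have Mh : M h = u + M (h - L u).
  by have := Ml 1 (L u) (h - L u); rewrite !scale1r ML [L u + _]addrC subrK.
rewrite -/u Mh (_ : u - _ = - M (h - L u)); last by lmod_ring.
rewrite bnormN (le_trans (MK _)) //.
have b1 : K * bnorm (h - L u) <= K * (e / (K * C0 + 1) * (C0 * bnorm h)).
  apply: ler_wpM2l => //; apply: (le_trans hu); apply: ler_wpM2l; last by rewrite /u.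
  by rewrite divr_ge0 // ltW.
apply: (le_trans b1).
have -> : e * bnorm h = e / (K * C0 + 1) * bnorm h * (K * C0 + 1).
  by field; rewrite gt_eqF.
have -> : K * (e / (K * C0 + 1) * (C0 * bnorm h)) =
   e / (K * C0 + 1) * bnorm h * (K * C0) by ring.
apply: ler_wpM2l; last by lra.
by rewrite mulr_ge0 // divr_ge0 // ltW.
Qed.

(** The part of a C*-OVI structure that concerns E, with boundedness in place of
    positivity, which has no meaning over the dual numbers. *)
Record ncps {R : realType} {A B : banachAlgType R} (iota : {lrmorphism B -> A})
    (E : {linear A -> B}) : Prop := NCPS {
  ncps_iota : forall b, bnorm (iota b) = bnorm b ;
  ncps_bounded : exists K : R, forall a, bnorm (E a) <= K * bnorm a ;
  ncps_id : forall b, E (iota b) = b ;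
  ncps_bimod : forall b1 a b2, E (iota b1 * a * iota b2) = b1 * E a * b2
}.

Section STransform.
Context {R : realType} {A B : banachAlgType R}.
Variables (iota : {lrmorphism B -> A}) (E : {linear A -> B}).
Variable z : A.

Definition resolvent (b : B) : A := binv (1 - iota b * z).
(** The function psi_z. *)
Definition moment (b : B) : B := E (resolvent b - 1).
(** psi_z(b) = b theta(b), and theta(0) = E z; so theta(b) is invertible for
    small b, while psi_z(b) need not be. *)
Definition theta (b : B) : B := E (z * resolvent b).
(** The derivative of theta at b, evaluated at v. *)
Definition dtheta (b v : B) : B := E (z * (resolvent b * iota v * z * resolvent b)).
(** The factor that turns the S-transform into the inverse of psi_z. *)
Definition rho (w : B) : B := binv (1 + w) * w.

(** The local theory of psi_z: chi is its inverse between balls of radii r1 and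
    r0, dchi the derivative of chi, and s the S-transform.  Since
    chi(w) = w theta(chi(w))^-1, the expression w^-1 (1 + w) chi(w) is
    (1 + w) theta(chi(w))^-1 for invertible w, and the latter is used for all w. *)
Record S_germ (chi s : B -> B) (dchi : B -> B -> B) (r0 r1 C : R) : Prop := SGerm {
  sg_r0 : 0 < r0 ;
  sg_r1 : 0 < r1 <= 1 / 2 ;
  sg_C : 0 <= C ;
  sg_res : forall b, bnorm b <= r0 -> bunit (1 - iota b * z) ;
  sg_theta : forall b, bnorm b <= r0 -> bunit (theta b) ;
  sg_momentE : forall b, bnorm b <= r0 -> moment b = b * theta b ;
  sg_chi_r0 : forall w, bnorm w <= r1 -> bnorm (chi w) <= r0 ;
  sg_chi_small : forall w, bnorm w <= r1 -> bnorm (chi w) <= C * bnorm w ;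
  sg_moment_chi : forall w, bnorm w <= r1 -> moment (chi w) = w ;
  sg_chi_moment : forall c, bnorm c <= r0 -> bnorm (moment c) <= r1 -> chi (moment c) = c ;
  sg_chiD : forall w, bnorm w < r1 -> frechet chi w (dchi w) ;
  sg_dchi : forall w u, bnorm w <= r1 ->
    dchi w u * theta (chi w) + chi w * dtheta (chi w) (dchi w u) = u ;
  sg_dchi_bound : forall w u, bnorm w <= r1 -> bnorm (dchi w u) <= C * bnorm u ;
  sg_s : forall w, bnorm w <= r1 -> s w = (1 + w) * binv (theta (chi w)) ;
  sg_chi_s : forall w, bnorm w <= r1 -> chi w = rho w * s w ;
  sg_sunit : forall w, bnorm w <= r1 -> bunit (s w) ;
  sg_s_bound : forall w, bnorm w <= r1 -> bnorm (s w) <= C ;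
  sg_sV_bound : forall w, bnorm w <= r1 -> bnorm (binv (s w)) <= C ;
  sg_sD : forall w, bnorm w < r1 -> frechet s w (fun u =>
    u * binv (theta (chi w)) - (1 + w) *
      (binv (theta (chi w)) * dtheta (chi w) (dchi w u) * binv (theta (chi w))))
}.

Hypothesis HE : ncps iota E.
Hypothesis Ez : bunit (E z).

Lemma EiotaM b a : E (iota b * a) = b * E a.
Proof. by have := ncps_bimod HE b a 1; rewrite rmorph1 !mulr1. Qed.

Lemma EMiota b a : E (a * iota b) = E a * b.
Proof. by have := ncps_bimod HE 1 a b; rewrite rmorph1 !mul1r. Qed.

Lemma res_bound b : bnorm b * bnorm z <= 1 / 2 ->
  bunit (1 - iota b * z) /\ bnorm (resolvent b) <= 2.
Proof.
move=> bz.
have n1 : bnorm (iota b * z) <= 1 / 2 by apply: le_trans bz; rewrite -(ncps_iota HE) bnormM.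
split; first by apply: neumann; lra.
have := neumann_bound n1 ltac:(lra); have -> : (1 - 1 / 2 : R)^-1 = 2 by field.
by [].
Qed.

Lemma resB b c : bunit (1 - iota b * z) -> bunit (1 - iota c * z) ->
  resolvent b - resolvent c = resolvent b * iota (b - c) * z * resolvent c.
Proof.
move=> bu cu; rewrite rmorphB /=.
have h1 := mulbVr bu; have h2 := mulrbV cu; rewrite -!/(resolvent _) in h1 h2.
have -> : resolvent b * (iota b - iota c) * z * resolvent c =
  resolvent b * ((1 - iota c * z) * resolvent c)
   - (resolvent b * (1 - iota b * z)) * resolvent c by nc_ring.
by rewrite h1 h2 mulr1 mul1r.
Qed.

Lemma resE b : bunit (1 - iota b * z) -> resolvent b - 1 = iota b * (z * resolvent b).
Proof.
move=> /mulrbV; rewrite -/(resolvent b) => h.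
by rewrite -[X in _ - X]h; nc_ring.
Qed.

Lemma bunit_1D (w : B) : bnorm w <= 1 / 2 ->
  bunit (1 + w) /\ bnorm (binv (1 + w)) <= 2.
Proof.
move=> w2; rewrite -[w]opprK.
split; first by apply: neumann; rewrite bnormN; lra.
have := @neumann_bound _ _ (- w) (1 / 2) ltac:(by rewrite bnormN) ltac:(lra).
by have -> : (1 - 1 / 2 : R)^-1 = 2 by field.
Qed.

Lemma res_frechet b : bunit (1 - iota b * z) ->
  frechet resolvent b (fun v => resolvent b * iota v * z * resolvent b).
Proof.
move=> bu.
have D1 : frechet (fun c => - (iota c * z)) b (fun v => - (iota v * z)).
  apply: frechet_blin; first by move=> a u v; rewrite linearP mulrDl -scalerAl; lmod_ring.
  exists (bnorm z); first exact: bnorm_ge0.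
  by move=> h; rewrite bnormN mulrC -(ncps_iota HE) bnormM.
have D2 := frechet_add (frechet_cst 1 b) D1.
apply: (frechet_ext (frechet_comp D2 (frechet_inv bu))); last by exists 1.
by move=> v /=; rewrite -!/(resolvent _); nc_ring.
Qed.

Lemma theta_frechet b : bunit (1 - iota b * z) -> frechet theta b (dtheta b).
Proof.
move=> bu.
have D1 := frechet_mul (frechet_cst z b) (res_frechet bu).
have EB : exists2 K : R, 0 <= K & forall h, bnorm (E h) <= K * bnorm h.
  have [K EK] := ncps_bounded HE; exists `|K| => // h.
  by apply: (le_trans (EK h)); rewrite ler_wpM2r ?bnorm_ge0 ?ler_norm.
have D2 := frechet_blin (z * resolvent b) (fun a u v => linearP E a u v) EB.
apply: (frechet_ext (frechet_comp D1 D2)); last by exists 1.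
by move=> v /=; rewrite mul0r add0r.
Qed.

Lemma dtheta_linear b : linear (dtheta b).
Proof.
move=> a u v; rewrite /dtheta -linearP; congr (E _).
rewrite linearP mulrDr !mulrDl -!scalerAr -!scalerAl mulrDr -scalerAr.
by [].
Qed.


(** psi_z(c) = w amounts to c = w theta(c)^-1, a contraction in c for small w.
    The derivative of psi_z at chi(w) is v |-> v theta(chi(w)) up to a small
    term, and is inverted by a second contraction. *)
Lemma S_germ_exists : exists chi s dchi r0 r1 C, S_germ chi s dchi r0 r1 C.
Proof.
(* K bounds E, M bounds theta(0)^-1, and T is a Lipschitz constant of theta;
   r0 keeps theta invertible, r1 makes c |-> w theta(c)^-1 a contraction of the
   ball of radius r0 with factor at most 1/2. *)
have [K0 EK0] := ncps_bounded HE; pose K := `|K0| + 1.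
have K1 : 1 <= K by rewrite /K; have := normr_ge0 K0; lra.
have EK a : bnorm (E a) <= K * bnorm a.
  apply: (le_trans (EK0 a)); rewrite ler_wpM2r ?bnorm_ge0 // /K.
  by have := ler_norm K0; lra.
pose n := bnorm z; have n0 : 0 <= n := bnorm_ge0 z.
pose M := bnorm (binv (E z)) + 1.
have M1 : 1 <= M by rewrite /M; have := bnorm_ge0 (binv (E z)); lra.
pose T := 4 * K * (n * n).
have T0 : 0 <= T by rewrite /T !mulr_ge0 //; lra.
have MT0 : 0 <= M * T by rewrite mulr_ge0 //; lra.
pose D := 4 * (1 + n + M * T); have D0 : 0 < D by rewrite /D; lra.
pose r0 := D^-1; have r00 : 0 < r0 by rewrite invr_gt0.
have Dr0 : D * r0 = 1 by rewrite mulfV // gt_eqF.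
have hn : r0 * n <= 1 / 4.
  have := mulr_ge0 (ltW r00) MT0; rewrite /D in Dr0; lra.
have hMT : M * T * r0 <= 1 / 4.
  have := mulr_ge0 (ltW r00) n0; rewrite /D in Dr0; lra.
have r04 : r0 <= 1 / 4.
  have := mulr_ge0 (ltW r00) n0; have := mulr_ge0 (ltW r00) MT0; rewrite /D in Dr0; lra.
pose r1 := r0 / (4 * M).
have r10 : 0 < r1 by rewrite divr_gt0 //; lra.
have Mr1 : M * r1 = r0 / 4 by rewrite /r1; field; rewrite gt_eqF //; lra.
have r1r0 : r1 <= r0 / 4 by rewrite -Mr1 ler_peMl // ltW.
have MMT : 4 * M * M * T * r1 <= 1 / 4.
  have -> : 4 * M * M * T * r1 = 4 * (M * r1) * (M * T) by ring.
  by rewrite Mr1; lra.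
clearbody r1 r0.
have resb b : bnorm b <= r0 -> bunit (1 - iota b * z) /\ bnorm (resolvent b) <= 2.
  move=> br; apply: res_bound.
  have : bnorm b * bnorm z <= r0 * n by apply: ler_wpM2r.
  by lra.
have dthb b v : bnorm b <= r0 -> bnorm (dtheta b v) <= T * bnorm v.
  move=> /resb[_ rb]; apply: (le_trans (EK _)).
  have : bnorm (z * (resolvent b * iota v * z * resolvent b)) <= n * (2 * bnorm v * n * 2).
    by do ?(apply: bnormM_le => //); rewrite (ncps_iota HE).
  have K00 : 0 <= K by lra.
  move=> /(ler_wpM2l K00) /le_trans; apply.
  by rewrite le_eqVlt; apply/orP; left; apply/eqP; rewrite /T; ring.
have thB b c : bnorm b <= r0 -> bnorm c <= r0 ->
    bnorm (theta b - theta c) <= T * bnorm (b - c).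
  move=> /resb[bu rb] /resb[cu rc]; rewrite /theta -linearB -mulrBr resB //.
  apply: (le_trans (EK _)).
  have : bnorm (z * (resolvent b * iota (b - c) * z * resolvent c))
      <= n * (2 * bnorm (b - c) * n * 2).
    by do ?(apply: bnormM_le => //); rewrite (ncps_iota HE).
  have K00 : 0 <= K by lra.
  move=> /(ler_wpM2l K00) /le_trans; apply.
  by rewrite le_eqVlt; apply/orP; left; apply/eqP; rewrite /T; ring.
have zr0 : bnorm (0 : B) <= r0 by rewrite bnorm0 ltW.
have th0 : theta 0 = E z.
  rewrite /theta /resolvent rmorph0 mul0r subr0.
  by rewrite (binv_uniq (mulr1 1) (mulr1 1)) mulr1.
have thu b : bnorm b <= r0 -> bunit (theta b) /\ bnorm (binv (theta b)) <= 2 * M.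
  move=> br; have := thB b 0 br zr0; rewrite subr0 th0 => h.
  have -> : theta b = E z + (theta b - E z) by lmod_ring.
  apply: binv_perturb => //; first by rewrite /M; lra.
  have : M * bnorm (theta b - E z) <= M * (T * r0).
    apply: ler_wpM2l; first by lra.
    by apply: (le_trans h); apply: ler_wpM2l.
  by rewrite mulrA; lra.
pose eta b := binv (theta b).
have etaB b c : bnorm b <= r0 -> bnorm c <= r0 ->
    bnorm (eta b - eta c) <= 4 * M * M * T * bnorm (b - c).
  move=> br cr; have [bu be] := thu b br; have [cu ce] := thu c cr.
  have -> : eta b - eta c = eta b * (theta c - theta b) * eta c.
    rewrite mulrBr mulrBl -mulrA [theta c * _]mulrbV // mulr1 [eta b * _]mulbVr //.
    by rewrite mul1r.
  have := bnormM_le (bnormM_le be (thB c b cr br)) ce.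
  rewrite (bnormBC c) => /le_trans; apply.
  by rewrite le_eqVlt; apply/orP; left; apply/eqP; ring.
have half (a : B) : bnorm a <= 1 / 2 * bnorm a -> a = 0.
  by move=> h; apply: bnorm_eq0; have := bnorm_ge0 a; lra.
have momE b : bnorm b <= r0 -> moment b = b * theta b.
  by move=> /resb[bu _]; rewrite /moment resE // EiotaM.
have fixE w c : bnorm c <= r0 -> (c = w * eta c) <-> moment c = w.
  move=> cr; have [cu _] := thu c cr; rewrite momE //; split.
    by move=> cE; rewrite {1}cE -mulrA mulbVr // mulr1.
  by move=> <-; rewrite -mulrA mulrbV // mulr1.
pose chi w : B := xget 0 [set c | bnorm c <= r0 /\ c = w * eta c].
have etaM w c : bnorm c <= r0 -> bnorm (w * eta c) <= 2 * M * bnorm w.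
  by move=> cr; rewrite mulrC; apply: bnormM_le => //; have [] := thu c cr.
have chiP w : bnorm w <= r1 -> bnorm (chi w) <= r0 /\ chi w = w * eta (chi w).
  move=> wr; rewrite /chi; case: xgetP => [c _ //|none].
  have [||||||c cr cE] := @contraction_fixpoint R B (fun c => bnorm c <= r0)
    (fun c => w * eta c) (1 / 2) 0; last by case: (none c); split.
  - exact: zr0.
  - move=> c cr; apply: (le_trans (etaM w c cr)).
    have : M * bnorm w <= M * r1 by apply: ler_wpM2l; lra.
    by lra.
  - exact: ball_closed.
  - by lra.
  - by lra.
  - move=> c c' cr cr'; rewrite -mulrBr.
    apply: (le_trans (bnormM_le wr (etaB c c' cr cr'))).
    rewrite mulrA (mulrC r1); apply: ler_wpM2r; [exact: bnorm_ge0|lra].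
have chi_uniq w c : bnorm w <= r1 -> bnorm c <= r0 -> moment c = w -> chi w = c.
  move=> wr cr /(fixE w c cr) cE; have [dr dE] := chiP w wr.
  apply/subr0_eq/half; rewrite {1}dE {1}cE -mulrBr.
  apply: (le_trans (bnormM_le wr (etaB _ _ dr cr))).
  rewrite mulrA (mulrC r1); apply: ler_wpM2r; [exact: bnorm_ge0|lra].
have chi_lip w w' : bnorm w <= r1 -> bnorm w' <= r1 ->
    bnorm (chi w - chi w') <= 4 * M * bnorm (w - w').
  move=> wr wr'; have [cr cE] := chiP w wr; have [cr' cE'] := chiP w' wr'.
  have E2 : chi w - chi w' = (w - w') * eta (chi w) + w' * (eta (chi w) - eta (chi w')).
    by rewrite {1}cE {1}cE'; nc_ring.
  have b1 := etaM (w - w') _ cr.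
  have b2 := bnormM_le wr' (etaB _ _ cr cr').
  have b3 : r1 * (4 * M * M * T * bnorm (chi w - chi w')) <= 1 / 4 * bnorm (chi w - chi w').
    by rewrite mulrA (mulrC r1); apply: ler_wpM2r => //; exact: bnorm_ge0.
  have := bnormD ((w - w') * eta (chi w)) (w' * (eta (chi w) - eta (chi w'))).
  have : 0 <= M * bnorm (w - w') by rewrite mulr_ge0 ?bnorm_ge0 //; lra.
  by rewrite -E2; lra.
pose dchi w u : B := xget 0 [set v | v * theta (chi w) + chi w * dtheta (chi w) v = u].
have dfix w u v : bnorm w <= r1 ->
    v * theta (chi w) + chi w * dtheta (chi w) v = u <->
    v = u * eta (chi w) - chi w * dtheta (chi w) v * eta (chi w).
  move=> wr; have [cr _] := chiP w wr; have [tu _] := thu _ cr; split.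
    by move=> <-; rewrite mulrDl -mulrA mulrbV // mulr1 addrK.
  move=> vE; rewrite {1}vE mulrBl -!mulrA mulbVr // !mulr1 subrK //.
have dcon w v v' : bnorm w <= r1 ->
    bnorm (chi w * (dtheta (chi w) v - dtheta (chi w) v') * eta (chi w))
      <= 1 / 2 * bnorm (v - v').
  move=> wr; have [cr _] := chiP w wr; have [tu tb] := thu _ cr.
  have -> : dtheta (chi w) v - dtheta (chi w) v' = dtheta (chi w) (v - v').
    have := dtheta_linear (chi w) (-1) v' v; rewrite !scaleN1r addrC => <-.
    by rewrite addrC.
  have := bnormM_le (bnormM_le cr (dthb _ (v - v') cr)) tb => /le_trans; apply.
  rewrite (_ : r0 * _ * _ = 2 * (M * T * r0) * bnorm (v - v')); last by ring.
  by apply: ler_wpM2r; [exact: bnorm_ge0|lra].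
have dchiP w u : bnorm w <= r1 ->
    dchi w u * theta (chi w) + chi w * dtheta (chi w) (dchi w u) = u.
  move=> wr; rewrite /dchi; case: xgetP => [v _ //|none].
  have [||||||v _ vE] := @contraction_fixpoint R B (fun=> True)
    (fun v => u * eta (chi w) - chi w * dtheta (chi w) v * eta (chi w)) (1 / 2) 0;
    last by case: (none v); apply/dfix.
  - by [].
  - by [].
  - by [].
  - by lra.
  - by lra.
  - move=> v v' _ _; rewrite bnormBC.
    rewrite (_ : _ - _ = chi w * (dtheta (chi w) v - dtheta (chi w) v') * eta (chi w)).
      exact: dcon.
    by nc_ring.
have dchi_uniq w u v : bnorm w <= r1 ->
    v * theta (chi w) + chi w * dtheta (chi w) v = u -> dchi w u = v.
  move=> wr /(dfix w u v wr) vE; have /(dfix w u _ wr) dE := dchiP w u wr.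
  apply/subr0_eq/half; rewrite {1}dE {1}vE bnormBC.
  rewrite (_ : _ - _ = chi w * (dtheta (chi w) (dchi w u) - dtheta (chi w) v) * eta (chi w)).
    exact: dcon.
  by nc_ring.
have dchi_lin w : bnorm w <= r1 -> linear (dchi w).
  move=> wr a u v; apply: dchi_uniq => //.
  rewrite dtheta_linear -[in RHS](dchiP w u wr) -[in RHS](dchiP w v wr).
  rewrite !mulrDl mulrDr -!scalerAl -scalerAr; lmod_ring.
have dchi_bound w u : bnorm w <= r1 -> bnorm (dchi w u) <= 4 * M * bnorm u.
  move=> wr; have /(dfix w u _ wr) dE := dchiP w u wr; have [cr _] := chiP w wr.
  have := dcon w (dchi w u) 0 wr.
  have -> : dtheta (chi w) 0 = 0.
    by have := dtheta_linear (chi w) (-1) 0 0; rewrite scaleN1r oppr0 addr0 scaleN1r addNr.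
  rewrite !subr0.
  have := bnormB (u * eta (chi w)) (chi w * dtheta (chi w) (dchi w u) * eta (chi w)).
  have : 0 <= M * bnorm u by rewrite mulr_ge0 ?bnorm_ge0 //; lra.
  by rewrite -dE; have := etaM u _ cr; lra.
have chiD w : bnorm w < r1 -> frechet chi w (dchi w).
  move=> wr; have wr' := ltW wr; have [cr cE] := chiP w wr'; have [bu _] := resb _ cr.
  have near_w h : bnorm h <= r1 - bnorm w -> bnorm (w + h) <= r1.
    by move=> hr; apply: (le_trans (bnormD _ _)); lra.
  have D1 := frechet_mul (frechet_id (chi w)) (theta_frechet bu).
  apply: (frechet_inverse D1).
  - exists (4 * M); first by lra.
    exists (r1 - bnorm w); first by lra.
    move=> h hr; have := chi_lip (w + h) w (near_w h hr) wr'.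
    by rewrite (_ : w + h - w = h) //; lmod_ring.
  - exact: dchi_lin.
  - by exists (4 * M); [lra|move=> h; exact: dchi_bound].
  - by move=> v; apply: dchi_uniq.
  exists (r1 - bnorm w); first by lra.
  move=> h hr; have [hr0 hE] := chiP _ (near_w h hr).
  by rewrite -momE //; apply/fixE.
pose s w := (1 + w) * eta (chi w).
have rhoP (w : B) : bnorm w <= r1 -> bunit (1 + w) /\ bnorm (binv (1 + w)) <= 2.
  move=> wr; have w2 : bnorm w <= 1 / 2 by lra.
  exact: bunit_1D w2.
have sV w : bnorm w <= r1 -> bunit (s w) /\ binv (s w) = theta (chi w) * binv (1 + w).
  move=> wr; have [wu _] := rhoP w wr; have [cr _] := chiP w wr; have [tu _] := thu _ cr.
  have h1 : s w * (theta (chi w) * binv (1 + w)) = 1.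
    by rewrite /s mulrA -(mulrA (1 + w)) mulbVr // mulr1 mulrbV.
  have h2 : theta (chi w) * binv (1 + w) * s w = 1.
    by rewrite /s mulrA -(mulrA _ (binv _)) mulbVr // mulr1 mulrbV.
  by split; [exists (theta (chi w) * binv (1 + w))|exact: binv_uniq].
exists chi, s, dchi, r0, r1, (4 * M + 4 * K * n).
have Kn0 : 0 <= K * n by apply: mulr_ge0 => //; lra.
split=> //.
- by rewrite r10; lra.
- by lra.
- by move=> b /resb[].
- by move=> b /thu[].
- by move=> w /chiP[].
- move=> w wr; have [cr cE] := chiP w wr; rewrite {1}cE.
  apply: (le_trans (etaM _ _ cr)); apply: ler_wpM2r; [exact: bnorm_ge0|lra].
- by move=> w wr; have [cr cE] := chiP w wr; apply/fixE.
- by move=> c cr mr; apply: chi_uniq.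
- move=> w u wr; apply: (le_trans (dchi_bound w u wr)).
  by apply: ler_wpM2r; [exact: bnorm_ge0|lra].
- move=> w wr; have [cr cE] := chiP w wr; rewrite {1}cE /rho /s.
  have [wu _] := rhoP w wr.
  rewrite mulrA; congr (_ * _); rewrite -mulrA.
  have -> : w * (1 + w) = (1 + w) * w by nc_ring.
  by rewrite mulrA mulbVr // mul1r.
- by move=> w wr; have [] := sV w wr.
- move=> w wr; have [cr _] := chiP w wr; have := etaM (1 + w) _ cr.
  have := bnormD 1 w; rewrite bnorm1 => h.
  have : M * bnorm (1 + w) <= M * (5 / 4) by apply: ler_wpM2l; lra.
  by rewrite -/(s w); lra.
- move=> w wr; have [_ ->] := sV w wr; have [cr _] := chiP w wr.
  have [_ wb] := rhoP w wr; have [_ rb] := resb _ cr.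
  have tb : bnorm (theta (chi w)) <= K * (n * 2).
    apply: (le_trans (EK _)); apply: ler_wpM2l; first by lra.
    exact: bnormM_le.
  by have := bnormM_le tb wb; lra.
move=> w wr; have wr' := ltW wr; have [cr cE] := chiP w wr'.
have [bu _] := resb _ cr; have [tu _] := thu _ cr.
have D2 : frechet (fun v : B => 1 + v) w id.
  apply: (frechet_ext (frechet_add (frechet_cst 1 w) (frechet_id w))); last by exists 1.
  by move=> v; rewrite /= add0r.
have D3 := frechet_comp (frechet_comp (chiD w wr) (theta_frechet bu)) (frechet_inv tu).
apply: (frechet_ext (frechet_mul D2 D3)); last by exists 1.
by move=> v /=; nc_ring.
Qed.

End STransform.

(** * Freeness with amalgamation and norm closures *)

Section Freeness.
Context {R : realType} {A B : banachAlgType R}.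
Variables (iota : {lrmorphism B -> A}) (E : {linear A -> B}).

Record subalg_over (S : A -> Prop) : Prop := SubalgOver {
  so_iota : forall b, S (iota b) ;
  so_add : forall a b, S a -> S b -> S (a + b) ;
  so_mul : forall a b, S a -> S b -> S (a * b)
}.

Definition free_family (S : bool -> A -> Prop) : Prop :=
  forall (n : nat) (i : nat -> bool) (a : nat -> A), (0 < n)%N ->
    (forall k, (k.+1 < n)%N -> i k <> i k.+1) ->
    (forall k, (k < n)%N -> S (i k) (a k)) ->
    (forall k, (k < n)%N -> E (a k) = 0) ->
    E (\prod_(0 <= k < n) a k) = 0.

Definition adherent (S : A -> Prop) (a : A) : Prop :=
  forall e : R, 0 < e -> exists2 a', S a' & bnorm (a - a') <= e.

(** With two subalgebras, the first index of an alternating word determines the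
    others. *)
Fixpoint alternates (P : bool -> A -> Prop) (i : bool) (l : seq A) : Prop :=
  if l is a :: l' then P i a /\ alternates P (~~ i) l' else True.

Lemma adherent_self (S : A -> Prop) a : S a -> adherent S a.
Proof. by move=> Sa e e0; exists a => //; rewrite subrr bnorm0 ltW. Qed.

Lemma alternates_nth P i l k : alternates P i l -> (k < size l)%N ->
  P (iter k negb i) (nth 0 l k).
Proof.
elim: l i k => [//|a l IH] i [|k] /= [Pa Pl] //.
by rewrite ltnS -iterS iterSr => /(IH _ _ Pl).
Qed.

Lemma alternates_adherent P i l (e : R) : 0 < e ->
  alternates (fun j => adherent (P j)) i l ->
  exists l', [/\ alternates P i l', size l' = size l &
    bnorm (\prod_(a <- l) a - \prod_(a <- l') a) <= e].
Proof.
elim: l i e => [|a l IH] i e e0 /=.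
  by exists [::]; split=> //; rewrite subrr bnorm0 ltW.
move=> [Pa Pl]; set L := \prod_(b <- l) b in IH *.
pose c := bnorm a + bnorm L + 2; have c0 : 0 < c.
  by rewrite /c; have := bnorm_ge0 a; have := bnorm_ge0 L; lra.
pose e1 := Num.min 1 (e / c).
have e10 : 0 < e1 by rewrite lt_min ltr01 divr_gt0.
have [l' [Pl' sl' Ll']] := IH _ _ e10 Pl.
have [a' Pa' aa'] := Pa _ e10.
exists (a' :: l'); split=> //=; first by rewrite sl'.
rewrite !big_cons; set L' := \prod_(b <- l') b in Ll' *.
rewrite -/L (_ : a * L - a' * L' = a * (L - L') + (a - a') * L'); last by nc_ring.
have e11 : e1 <= 1 by rewrite /e1 ge_min lexx.
have L'b : bnorm L' <= bnorm L + 1.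
  have := bnormB L (L - L'); rewrite (_ : L - (L - L') = L'); last by lmod_ring.
  by lra.
have b1 := bnormM_le (lexx (bnorm a)) Ll'; have b2 := bnormM_le aa' L'b.
apply: (le_trans (bnormD _ _)); apply: (le_trans (lerD b1 b2)).
have : e1 * c <= e by rewrite -ler_pdivlMr // /e1 ge_min lexx orbT.
by rewrite /c; lra.
Qed.

Hypothesis HE : ncps iota E.

Lemma E_bound_pos : exists2 K : R, 0 < K & forall a, bnorm (E a) <= K * bnorm a.
Proof.
have [K EK] := ncps_bounded HE; exists (`|K| + 1).
  by have := normr_ge0 K; lra.
move=> a; apply: (le_trans (EK a)); rewrite ler_wpM2r ?bnorm_ge0 //.
by have := ler_norm K; lra.
Qed.

Variable S : bool -> A -> Prop.
Hypothesis Salg : forall i, subalg_over (S i).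
Hypothesis Sfree : free_family S.

Let centered i a := S i a /\ E a = 0.

Lemma free_alternating i l : l != [::] -> alternates centered i l ->
  E (\prod_(a <- l) a) = 0.
Proof.
move=> l0 lP; rewrite (big_nth 0).
apply: (Sfree (i := fun k => iter k negb i)); first by case: (l) l0.
- by move=> k _ /=; case: (iter k negb i).
- by move=> k kl; have [] := alternates_nth lP kl.
- by move=> k kl; have [] := alternates_nth lP kl.
Qed.

(** An approximation of a centred element is recentred by subtracting its
    expectation, which is small. *)
Lemma adherent_centered i a : adherent (S i) a -> E a = 0 -> adherent (centered i) a.
Proof.
move=> Sa Ea e e0; have [K K0 EK] := E_bound_pos.
have e1 : 0 < e / (K + 1) by rewrite divr_gt0 //; lra.
have [a' Sa' aa'] := Sa _ e1.
exists (a' + iota (-1) * iota (E a')).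
  split; first by do ?[apply: (so_add (Salg i)) => //|apply: (so_mul (Salg i))|apply: (so_iota (Salg i))].
  by rewrite linearD -rmorphM /= (ncps_id HE) mulN1r subrr.
rewrite (rmorphN1 iota) mulN1r opprD opprK addrA (le_trans (bnormD _ _)) //.
rewrite (ncps_iota HE).
have : bnorm (E a') <= K * bnorm (a - a').
  by rewrite -bnormN -[- _]add0r -Ea -linearB.
have : (K + 1) * bnorm (a - a') <= e by rewrite mulrC -ler_pdivlMr //; lra.
by lra.
Qed.

(** Resolvents lie in the norm closures of the subalgebras only; by continuity
    of products and of E, freeness holds there too. *)
Lemma free_adherent i l : l != [::] ->
  alternates (fun j a => adherent (S j) a /\ E a = 0) i l -> E (\prod_(a <- l) a) = 0.
Proof.
move=> l0 lP; have [K K0 EK] := E_bound_pos.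
have lP' : alternates (fun j => adherent (centered j)) i l.
  elim: l i lP {l0} => //= a l IH i [[Sa Ea] lP]; split; last exact: IH.
  exact: adherent_centered.
apply: bnorm_eq0_small => e e0.
have [l' [lP'' sl' ll']] := alternates_adherent (e := e / K) ltac:(by rewrite divr_gt0) lP'.
have l'0 : l' != [::] by rewrite -size_eq0 sl' size_eq0.
rewrite -[E _]subr0 -(free_alternating l'0 lP'') -linearB.
by apply: (le_trans (EK _)); rewrite mulrC -ler_pdivlMr.
Qed.

Lemma adherent_add i a b : adherent (S i) a -> adherent (S i) b -> adherent (S i) (a + b).
Proof.
move=> Sa Sb e e0; have [a' Sa' aa'] := Sa (e / 2) ltac:(lra).
have [b' Sb' bb'] := Sb (e / 2) ltac:(lra).
exists (a' + b'); first exact: (so_add (Salg i)).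
rewrite (_ : a + b - (a' + b') = (a - a') + (b - b')); last by lmod_ring.
by apply: (le_trans (bnormD _ _)); lra.
Qed.

Lemma adherent_mull i x a : S i x -> adherent (S i) a -> adherent (S i) (x * a).
Proof.
move=> Sx Sa e e0; have x0 := bnorm_ge0 x.
have e1 : 0 < e / (bnorm x + 1) by rewrite divr_gt0 //; lra.
have [a' Sa' aa'] := Sa _ e1.
exists (x * a'); first exact: (so_mul (Salg i)).
rewrite -mulrBr; apply: (le_trans (bnormM _ _)).
move: aa'; rewrite ler_pdivlMr; last by lra.
by have := bnorm_ge0 (a - a'); lra.
Qed.

Lemma adherent_iota i b : adherent (S i) (iota b).
Proof. by apply: adherent_self; apply: (so_iota (Salg i)). Qed.

(** The resolvent is the fixed point of u |-> 1 + b x u, which preserves the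
    closure of the subalgebra. *)
Lemma adherent_resolvent i x b : S i x -> bnorm b * bnorm x <= 1 / 2 ->
  adherent (S i) (resolvent iota x b).
Proof.
move=> Sx bx; have [bu _] := res_bound HE bx.
have n1 : bnorm (iota b * x) <= 1 / 2 by apply: le_trans bx; rewrite -(ncps_iota HE) bnormM.
have [||||||c cS cE] := @contraction_fixpoint R A (adherent (S i))
  (fun u => 1 + iota b * x * u) (1 / 2) 0.
- by rewrite -(rmorph0 iota); apply: adherent_iota.
- move=> u Su; apply: adherent_add; first by rewrite -(rmorph1 iota); apply: adherent_iota.
  by rewrite -mulrA; apply: adherent_mull; [apply: (so_iota (Salg i))|apply: adherent_mull].
- move=> u l uS ul e e0; have [n un] := ul (e / 2) ltac:(lra).
  have [a' Sa' ua'] := uS n (e / 2) ltac:(lra).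
  exists a' => //; apply: (le_trans (bnorm_tri (u n) _ _)); rewrite (bnormBC l); lra.
- by lra.
- by lra.
- by move=> u v _ _; rewrite opprD addrACA subrr add0r -mulrBr; apply: bnormM_le.
suff -> : resolvent iota x b = c by [].
rewrite -[LHS]mulr1; have <- : (1 - iota b * x) * c = 1 by rewrite mulrBl mul1r -[X in X - _]cE addrK.
by rewrite mulrA mulbVr // mul1r.
Qed.

(** In (1 - q)^-1 = 1 + q + ... + q^(N-1) + q^N (1 - q)^-1 only the last term
    contributes, and it tends to 0. *)
Lemma geometric_vanish P q Q : bnorm q < 1 -> (forall N, E (P * q ^+ N * Q) = 0) ->
  E (P * binv (1 - q) * Q) = 0.
Proof.
move=> q1 van; have qu := neumann q1; set D := binv (1 - q).
have DE : D = 1 + q * D by have := mulrbV qu; rewrite -/D mulrBl mul1r => <-; rewrite subrK.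
have step N : E (P * D * Q) = E (P * (q ^+ N * D) * Q).
  elim: N => [|N ->]; first by rewrite expr0 mul1r.
  rewrite {1}DE mulrDr mulr1 mulrA -exprSr mulrDr mulrDl linearD /= van add0r.
  by [].
have [K K0 EK] := E_bound_pos.
apply: bnorm_eq0_small => e e0.
have [N qN] := small_expr (K * (bnorm P * bnorm D * bnorm Q)) (bnorm_ge0 q) q1 e0.
rewrite (step N); apply: (le_trans (EK _)); apply: (le_trans _ qN).
have h : bnorm (q ^+ N) <= bnorm q ^+ N.
  elim: (N) => [|m IH]; first by rewrite !expr0 bnorm1.
  by rewrite !exprS; apply: bnormM_le.
have := bnormM_le (bnormM_le (lexx (bnorm P)) (bnormM_le h (lexx (bnorm D)))) (lexx (bnorm Q)).
move=> /(ler_wpM2l (ltW K0)) /le_trans; apply.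
by rewrite le_eqVlt; apply/orP; left; apply/eqP; ring.
Qed.

Lemma alternates_word i N (G H : A) (P : bool -> A -> Prop) (l : seq A) :
  P i G -> P (~~ i) H -> alternates P i l ->
  alternates P i (flatten (nseq N [:: G; H]) ++ l).
Proof. by move=> PG PH Pl; elim: N => //= N IH; rewrite negbK. Qed.

Lemma prod_word N (G H : A) : \prod_(a <- flatten (nseq N [:: G; H])) a = (G * H) ^+ N.
Proof.
elim: N => [|N IH]; first by rewrite big_nil expr0.
by rewrite /= !big_cons IH exprS mulrA.
Qed.

End Freeness.

(** * Multiplicativity of the S-transform *)

(** The algebraic heart of multiplicativity.  Here u = 1 + w, k = u^-1,
    r = k w = 1 - k, and X, Y, Z are the resolvents of x, y, x y at r.  If g and
    h have expectation u, then G and Hk are centred, and the right-hand side is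
    g plus a sum of words in which Gk and Hk alternate, once D = (1 - Gk Hk)^-1
    is expanded.  The identity comes from X (1 - r x y) Y = u (1 - Gk Hk). *)
Lemma product_identity {R : realType} {A : banachAlgType R}
    (k u r x y X Y Z D g h G Gk Hk : A) :
  k * u = 1 -> u * k = 1 -> r = 1 - k ->
  X * (1 - r * x) = 1 -> (1 - r * x) * X = 1 -> (1 - r * y) * Y = 1 ->
  Z * (1 - r * (x * y)) = 1 -> (1 - Gk * Hk) * D = 1 ->
  g = x * X -> h = y * Y -> G = g - u -> Gk = k * r * G -> Hk = k * (h - u) ->
  x * y * Z = (G + u) * Hk * D * (1 + Gk) + g.
Proof.
move=> ku uk rk XV VX VY ZV qD gE hE GE GkE HkE.
have kr : k = 1 - r by rewrite rk; lmod_ring.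
have XE : X = 1 + r * g by rewrite gE -VX; nc_ring.
have YE : Y = 1 + r * h by rewrite hE -VY; nc_ring.
have kHE : Hk = k * h - 1 by rewrite HkE mulrBr ku.
set q := Gk * Hk in qD *.
have uq : u * (1 - q) = 1 + r * g + r * h - r * g * k * h.
  have -> : u * (1 - q) = u - (u * k) * r * G * Hk by rewrite /q GkE; nc_ring.
  rewrite uk mul1r kHE.
  have -> : r * G * (k * h - 1) = r * g * k * h - r * g - r * (u * k) * h + r * u.
    by rewrite GE; nc_ring.
  rewrite uk mulr1.
  have -> : r * u = u - 1 by rewrite rk mulrBl mul1r ku.
  by lmod_ring.
have Xrx : X * r * x = X - 1 by rewrite -XV; nc_ring.
have XYE : X * (1 - r * (x * y)) * Y = u * (1 - q).
  have -> : X * (1 - r * (x * y)) * Y = X * Y - X * r * x * h by rewrite hE; nc_ring.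
  rewrite Xrx uq XE YE.
  have -> : r * g * k * h = r * g * h - r * g * r * h by rewrite kr; nc_ring.
  by nc_ring.
have e1 : (1 - r * (x * y)) * Y = (1 - r * x) * (u * (1 - q)).
  by rewrite -XYE !mulrA VX mul1r.
have e2 : Y = Z * (1 - r * x) * u * (1 - q).
  by rewrite -!mulrA -e1 [RHS]mulrA ZV mul1r.
have ZE : Z = Y * D * k * X.
  rewrite e2 -(mulrA _ (1 - q)) qD mulr1 -(mulrA _ u) uk mulr1.
  by rewrite -mulrA VX mulr1.
have hX : h = X * (k * h - 1) + u * (1 - q).
  rewrite uq XE; have e : h = k * h + r * h by rewrite rk; nc_ring.
  by rewrite {1}e; nc_ring.
have xhE : x * h = g * Hk + x * u * (1 - q).
  by rewrite kHE {1}hX gE; nc_ring.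
have kXE : k * X = 1 + Gk.
  have e : 1 = k + k * r * u.
    rewrite rk; have -> : k * (1 - k) * u = k * u - k * (k * u) by nc_ring.
    by rewrite ku mulr1 addrC subrK.
  by rewrite XE GkE GE {2}e; nc_ring.
have -> : x * y * Z = x * h * D * (k * X) by rewrite ZE hE; nc_ring.
have -> : G + u = g by rewrite GE subrK.
rewrite xhE (mulrDl _ _ D) (mulrDl _ _ (k * X)).
rewrite -[x * u * (1 - q) * D]mulrA qD mulr1 [x * u * (k * X)]mulrA -(mulrA x u k) uk mulr1 -gE.
by rewrite -!mulrA kXE.
Qed.

Section Core.
Context {R : realType} {A B : banachAlgType R}.
Variables (iota : {lrmorphism B -> A}) (E : {linear A -> B}).
Hypothesis HE : ncps iota E.
Variable S : bool -> A -> Prop.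
Hypothesis Salg : forall i, subalg_over iota (S i).
Hypothesis Sfree : free_family E S.

(** The case S_x(w) = S_y(w) = 1 of multiplicativity: theta(rho(w)) = 1 + w says
    that the S-transform of the element takes the value 1 at w. *)
Lemma normalized_product (w : B) (x y : A) :
  bnorm w <= 1 / 2 -> S false x -> S true y ->
  bnorm (rho w) * bnorm x <= 1 / 2 -> bnorm (rho w) * bnorm y <= 1 / 2 ->
  bnorm (rho w) * bnorm (x * y) <= 1 / 2 ->
  4 * bnorm (rho w) * ((2 * bnorm x + 2) * (2 * bnorm y + 2)) <= 1 / 2 ->
  theta iota E x (rho w) = 1 + w -> theta iota E y (rho w) = 1 + w ->
  theta iota E (x * y) (rho w) = 1 + w.
Proof.
move=> w2 Sx Sy rx ry rxy small tx ty.
have [wu wb] := bunit_1D w2.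
set kB := binv (1 + w) in wb.
set X := resolvent iota x (rho w) in tx; set Y := resolvent iota y (rho w) in ty.
set Z := resolvent iota (x * y) (rho w).
have [Xu Xb] := res_bound HE rx; have [Yu Yb] := res_bound HE ry.
have [Zu _] := res_bound HE rxy.
rewrite /theta in tx ty *.
pose r := iota (rho w); pose k := iota kB; pose u := iota (1 + w).
have ku : k * u = 1 by rewrite -rmorphM /= mulbVr // rmorph1.
have uk : u * k = 1 by rewrite -rmorphM /= mulrbV // rmorph1.
have rk : r = 1 - k.
  have e : kB + kB * w = 1 by rewrite -[X in X + _]mulr1 -mulrDr mulbVr.
  by rewrite -(rmorph1 iota) -e rmorphD /= -/k [k + _]addrC addrK.
pose g := x * X; pose h := y * Y; pose G := g - u; pose H := h - u.
pose Gk := k * r * G; pose Hk := k * H; pose q := Gk * Hk.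
have wb1 : bnorm (1 + w) <= 2 by have := bnormD 1 w; rewrite bnorm1; lra.
have Gb : bnorm G <= 2 * bnorm x + 2.
  apply: (le_trans (bnormB _ _)); apply: lerD; last by rewrite (ncps_iota HE).
  by rewrite mulrC; apply: bnormM_le.
have Hb : bnorm H <= 2 * bnorm y + 2.
  apply: (le_trans (bnormB _ _)); apply: lerD; last by rewrite (ncps_iota HE).
  by rewrite mulrC; apply: bnormM_le.
have kb : bnorm k <= 2 by rewrite (ncps_iota HE).
have qb : bnorm q < 1.
  have rb : bnorm r <= bnorm (rho w) by rewrite (ncps_iota HE).
  have := bnormM_le (bnormM_le (bnormM_le kb rb) Gb) (bnormM_le kb Hb).
  rewrite -/q (_ : _ * (2 * (2 * bnorm y + 2)) =
    4 * bnorm (rho w) * ((2 * bnorm x + 2) * (2 * bnorm y + 2))); last by ring.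
  by lra.
have Du := neumann qb; set D := binv (1 - q).
have total : x * y * Z = (G + u) * Hk * D * (1 + Gk) + g.
  apply: (@product_identity _ A k u r x y X Y Z D) => //; try exact: erefl.
  - exact: mulbVr Xu.
  - exact: mulrbV Xu.
  - exact: mulrbV Yu.
  - exact: mulbVr Zu.
  - exact: mulrbV Du.
rewrite total linearD /= tx.
suff -> : E ((G + u) * Hk * D * (1 + Gk)) = 0 by rewrite add0r.
have cg : adherent (S false) g.
  by apply: (adherent_mull Salg) => //; apply: (adherent_resolvent HE).
have ch : adherent (S true) h.
  by apply: (adherent_mull Salg) => //; apply: (adherent_resolvent HE).
have uN : - u = iota (- (1 + w)) by rewrite rmorphN.
have cG : adherent (S false) G.
  by apply: (adherent_add Salg) => //; rewrite uN; apply: (adherent_iota Salg).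
have cH : adherent (S true) H.
  by apply: (adherent_add Salg) => //; rewrite uN; apply: (adherent_iota Salg).
have EG : E G = 0 by rewrite linearB /= tx (ncps_id HE) subrr.
have EH : E H = 0 by rewrite linearB /= ty (ncps_id HE) subrr.
have cGk : adherent (S false) Gk /\ E Gk = 0.
  rewrite /Gk -rmorphM /=; split.
    by apply: (adherent_mull Salg) => //; apply: so_iota.
  by rewrite (EiotaM HE) EG mulr0.
have cHk : adherent (S true) Hk /\ E Hk = 0.
  split; first by apply: (adherent_mull Salg) => //; apply: so_iota.
  by rewrite (EiotaM HE) EH mulr0.
apply: (geometric_vanish HE qb) => N.
pose W := flatten (nseq N [:: Gk; Hk]).
have vanish (i : bool) (l : seq A) : l != [::] ->
    alternates (fun j a => adherent (S j) a /\ E a = 0) i l -> E (\prod_(a <- l) a) = 0.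
  exact: (free_adherent HE Salg Sfree).
have aW (l : seq A) : alternates (fun j a => adherent (S j) a /\ E a = 0) false l ->
    alternates (fun j a => adherent (S j) a /\ E a = 0) false (W ++ l).
  exact: alternates_word.
have -> : (G + u) * Hk * q ^+ N * (1 + Gk) =
  \prod_(a <- G :: Hk :: W ++ [::]) a + \prod_(a <- G :: Hk :: W ++ [:: Gk]) a
  + u * \prod_(a <- Hk :: W ++ [::]) a + u * \prod_(a <- Hk :: W ++ [:: Gk]) a.
  rewrite !big_cons !big_cat /= !big_seq1 !big_nil !prod_word -/q.
  by nc_ring.
rewrite !linearD /= !(EiotaM HE).
rewrite (vanish false); first last.
- by split=> //; split=> //; apply: aW.
- by [].
rewrite (vanish false); first last.
- by split=> //; split=> //; apply: aW.
- by [].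
rewrite (vanish true); first last.
- by split=> //; apply: aW.
- by [].
rewrite (vanish true); first last.
- by split=> //; apply: aW.
- by [].
by rewrite !mulr0 !addr0.
Qed.

End Core.

Lemma binvM {R : realType} {A : banachAlgType R} (a b : A) : bunit a -> bunit b ->
  binv (a * b) = binv b * binv a.
Proof.
move=> au bu; apply: binv_uniq.
  by rewrite mulrA -(mulrA a) mulrbV // mulr1 mulrbV.
by rewrite mulrA -(mulrA _ (binv a)) mulbVr // mulr1 mulbVr.
Qed.

Lemma binvK {R : realType} {A : banachAlgType R} (a : A) : bunit a -> binv (binv a) = a.
Proof. by move=> au; apply: binv_uniq; [exact: mulbVr|exact: mulrbV]. Qed.

Lemma rho_bound {R : realType} {B : banachAlgType R} (w : B) : bnorm w <= 1 / 2 ->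
  bnorm (rho w) <= 2 * bnorm w.
Proof. by move=> w2; have [_ b] := bunit_1D w2; apply: bnormM_le. Qed.

Lemma rho_conj {R : realType} {B : banachAlgType R} (w s : B) : bunit s ->
  bunit (1 + w) -> rho (binv s * w * s) = binv s * rho w * s.
Proof.
move=> su wu; rewrite /rho.
have -> : binv (1 + binv s * w * s) = binv s * binv (1 + w) * s.
  have E : 1 + binv s * w * s = binv s * (1 + w) * s.
    by rewrite mulrDr mulrDl mulr1 mulbVr.
  rewrite E !binvM ?binvK ?mulrA //; try exact: bunitV.
  by apply: bunitM => //; exact: bunitV.
by rewrite !mulrA -(mulrA _ s) mulrbV // mulr1.
Qed.

Section Multiplicativity.
Context {R : realType} {A B : banachAlgType R}.
Variables (iota : {lrmorphism B -> A}) (E : {linear A -> B}).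
Hypothesis HE : ncps iota E.

(** Multiplication of z by s on the left, and conjugation by s, move s into the
    argument of theta; this is how elements are normalised at w. *)
Lemma theta_left (z : A) (s b : B) :
  theta iota E (iota s * z) b = s * theta iota E z (b * s).
Proof.
rewrite /theta -(EiotaM HE) /resolvent rmorphM mulrA; congr (E _).
by rewrite !mulrA.
Qed.

Lemma theta_conj (z : A) (s b : B) : bunit s ->
  bunit (1 - iota (binv s * b * s) * z) ->
  theta iota E (iota s * z * iota (binv s)) b =
  s * theta iota E z (binv s * b * s) * binv s.
Proof.
move=> su ru.
have ss : iota s * iota (binv s) = 1 by rewrite -rmorphM /= mulrbV // rmorph1.
have ss' : iota (binv s) * iota s = 1 by rewrite -rmorphM /= mulbVr // rmorph1.
rewrite /theta -(ncps_bimod HE); congr (E _).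
have -> : resolvent iota (iota s * z * iota (binv s)) b =
   iota s * resolvent iota z (binv s * b * s) * iota (binv s).
  have E1 : 1 - iota b * (iota s * z * iota (binv s)) =
      iota s * (1 - iota (binv s * b * s) * z) * iota (binv s).
    rewrite mulrBr mulr1 mulrBl ss !rmorphM /= !mulrA ss mul1r //.
  apply: binv_uniq; rewrite E1.
    rewrite !mulrA -(mulrA _ (iota (binv s)) (iota s)) ss' mulr1.
    by rewrite -(mulrA (iota s)) [X in iota s * X]mulrbV // mulr1.
  rewrite !mulrA -(mulrA _ (iota (binv s)) (iota s)) ss' mulr1.
  by rewrite -(mulrA (iota s)) [X in iota s * X]mulbVr // mulr1.
by rewrite !mulrA -(mulrA _ (iota (binv s)) (iota s)) ss' mulr1.
Qed.

End Multiplicativity.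

(** Twisted multiplicativity, without division by w.  With s = S_y(w) and
    t = S_x(s^-1 w s), the elements s t x s^-1 and s y are normalised at w and
    their product is s t (x y); so the normalised case computes theta of x y at
    rho(w) s t, which is therefore the value at w of the inverse of psi_(x y). *)
Theorem S_transform_mul {R : realType} {A B : banachAlgType R}
    (iota : {lrmorphism B -> A}) (E : {linear A -> B}) (HE : ncps iota E)
    (S : bool -> A -> Prop) (Salg : forall i, subalg_over iota (S i))
    (Sfree : free_family E S) (x y : A) (Sx : S false x) (Sy : S true y)
    chix sx dx r0x r1x Cx chiy sy dy r0y r1y Cy chip sp dp r0p r1p Cp :
  S_germ iota E x chix sx dx r0x r1x Cx -> S_germ iota E y chiy sy dy r0y r1y Cy ->
  S_germ iota E (x * y) chip sp dp r0p r1p Cp ->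
  exists2 r : R, 0 < r & forall w, bnorm w <= r ->
    bnorm (binv (sy w) * w * sy w) < r1x /\
    sp w = sy w * sx (binv (sy w) * w * sy w).
Proof.
move=> gx gy gp.
have Cx0 := sg_C gx; have Cy0 := sg_C gy.
have /andP[r1x0 r1x2] := sg_r1 gx; have /andP[r1y0 r1y2] := sg_r1 gy.
have /andP[r1p0 r1p2] := sg_r1 gp; have r0p0 := sg_r0 gp.
have nx := bnorm_ge0 x; have ny := bnorm_ge0 y.
pose bx := Cy * Cx * bnorm x * Cy; pose bY := Cy * bnorm y.
have bx0 : 0 <= bx by rewrite /bx !mulr_ge0.
have bY0 : 0 <= bY by rewrite /bY !mulr_ge0.
have bxy0 := mulr_ge0 bx0 bY0; have CC0 := mulr_ge0 Cy0 Cy0; have CC1 := mulr_ge0 Cy0 Cx0.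
pose D := 16 * ((2 * bx + 2) * (2 * bY + 2)).
have D0 : 64 <= D by rewrite /D; lra.
have D1 : 4 * bx <= D by rewrite /D; lra.
have D2 : 4 * bY <= D by rewrite /D; lra.
have D3 : 4 * (bx * bY) <= D by rewrite /D; lra.
pose r := Num.min (Num.min (Num.min r1y r1p) (D^-1))
   (Num.min (r1x / 2 / (Cy * Cy + 1)) (r0p / 2 / (Cy * Cx + 1))).
have r0 : 0 < r.
  by rewrite !lt_min r1y0 r1p0 invr_gt0 !divr_gt0 //; lra.
exists r => // w; rewrite /r !le_min => /andP[/andP[/andP[wy wp] wD] /andP[]].
move=> wx w0p.
have {}wx : bnorm w * (Cy * Cy + 1) <= r1x / 2 by rewrite -ler_pdivlMr //; lra.
have {}w0p : bnorm w * (Cy * Cx + 1) <= r0p / 2 by rewrite -ler_pdivlMr //; lra.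
have w0 := bnorm_ge0 w.
have wD' : D * bnorm w <= 1.
  by rewrite mulrC -ler_pdivlMr ?div1r //; lra.
have w2 : bnorm w <= 1 / 2 by lra.
set s := sy w; set w' := binv s * w * s.
have su : bunit s := sg_sunit gy wy.
have sb : bnorm s <= Cy := sg_s_bound gy wy; have sVb : bnorm (binv s) <= Cy := sg_sV_bound gy wy.
have w'b : bnorm w' < r1x.
  have := bnormM_le (bnormM_le sVb (lexx (bnorm w))) sb.
  rewrite -/w' => h; apply: (le_lt_trans h).
  by lra_from wx w0 r1x0.
have w'r := ltW w'b; split=> //.
set t := sx w'.
have tu : bunit t := sg_sunit gx w'r; have tb : bnorm t <= Cx := sg_s_bound gx w'r.
have [wu _] := bunit_1D w2; have rb := rho_bound w2.
have rw0 := bnorm_ge0 (rho w).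
have chiy_r0 := sg_chi_r0 gy wy.
have thy : s * theta iota E y (chiy w) = 1 + w.
  rewrite /s (sg_s gy wy) -mulrA mulbVr ?mulr1 //; exact: sg_theta gy _ _.
have thx : t * theta iota E x (chix w') = 1 + w'.
  rewrite /t (sg_s gx w'r) -mulrA mulbVr ?mulr1 //.
  by apply: (sg_theta gx); apply: (sg_chi_r0 gx).
pose x1 := iota s * (iota t * x) * iota (binv s); pose y1 := iota s * y.
have x1b : bnorm x1 <= bx.
  rewrite /bx (_ : Cy * Cx * bnorm x * Cy = Cy * (Cx * bnorm x) * Cy); last by ring.
  by do ?apply: bnormM_le => //; rewrite (ncps_iota HE).
have y1b : bnorm y1 <= bY by apply: bnormM_le => //; rewrite (ncps_iota HE).
have x1y1 : x1 * y1 = iota (s * t) * (x * y).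
  rewrite /x1 /y1 mulrA -(mulrA _ (iota (binv s))) -rmorphM /= mulbVr // rmorph1 mulr1.
  by rewrite rmorphM /= !mulrA.
have wDb z : 0 <= z -> 4 * z <= D -> bnorm (rho w) * z <= 1 / 2.
  move=> z0 zD; have : bnorm (rho w) * z <= 2 * bnorm w * z by apply: ler_wpM2r.
  have : bnorm w * (4 * z) <= bnorm w * D by apply: ler_wpM2l.
  by lra_from wD'.
have mono (a z : R) : bnorm (rho w) * z <= 1 / 2 -> a <= z -> bnorm (rho w) * a <= 1 / 2.
  move=> h az; apply: le_trans h; exact: ler_wpM2l.
have key : theta iota E (x1 * y1) (rho w) = 1 + w.
  apply: (normalized_product HE Salg Sfree w2).
  - by do ?[apply: so_iota|apply: (so_mul (Salg _))].
  - by do ?[apply: so_iota|apply: (so_mul (Salg _))].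
  - by apply: (mono _ bx) => //; apply: wDb.
  - by apply: (mono _ bY) => //; apply: wDb.
  - by apply: (mono _ (bx * bY)); [apply: wDb|apply: bnormM_le].
  - rewrite (_ : 4 * _ * _ = bnorm (rho w) * (4 * ((2 * bnorm x1 + 2) * (2 * bnorm y1 + 2))));
      last by ring.
    apply: (mono _ (4 * ((2 * bx + 2) * (2 * bY + 2)))).
      have P0 : 0 <= (2 * bx + 2) * (2 * bY + 2) by apply: mulr_ge0; lra_from bx0 bY0.
      by apply: wDb; rewrite /D; lra_from P0.
    have n1 := bnorm_ge0 x1; have n2 := bnorm_ge0 y1.
    by rewrite ler_pM2l //; apply: ler_pM; lra_from n1 n2 x1b y1b.
  - have chiE : chix w' = binv s * rho w * s * t by rewrite (sg_chi_s gx w'r) rho_conj.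
    rewrite (theta_conj HE) //; last first.
      by rewrite mulrA -rmorphM /= -chiE; apply: (sg_res gx); apply: (sg_chi_r0 gx).
    rewrite (theta_left HE) -chiE thx /w' mulrDr mulrDl mulr1 mulrbV // !mulrA mulrbV // mul1r.
    by rewrite -(mulrA w) mulrbV // mulr1.
  - by rewrite (theta_left HE) -(sg_chi_s gy wy).
rewrite x1y1 (theta_left HE) in key.
set d := rho w * (s * t) in key.
have db : bnorm d <= r0p.
  have : bnorm d <= (2 * bnorm w) * (Cy * Cx).
    by apply: bnormM_le => //; exact: bnormM_le.
  by lra_from w0p w0 r0p0.
have stu := bunitM su tu.
have thp : theta iota E (x * y) d = binv (s * t) * (1 + w).
  by rewrite -key mulrA mulbVr // mul1r.
have md : moment iota E (x * y) d = w.
  rewrite (sg_momentE gp db) thp mulrA /d -(mulrA (rho w)) mulrbV // mulr1.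
  rewrite /rho -mulrA (_ : w * (1 + w) = (1 + w) * w); last by nc_ring.
  by rewrite mulrA mulbVr // mul1r.
have chid : chip w = d by have := sg_chi_moment gp db; rewrite md; apply.
rewrite (sg_s gp wp) chid thp binvM //; last exact: bunitV.
by rewrite binvK // mulrA mulrbV // mul1r.
Qed.

(** * Dual numbers *)

Section Dual.
Context {R : realType} (B : banachAlgType R).

(** B[eps] with eps^2 = 0 and eps central: the pair (a, b) stands for
    a + eps b. *)
Definition dual : Type := (B * B)%type.
HB.instance Definition _ := GRing.Lmodule.on dual.

Definition dual_mul (a b : dual) : dual := (a.1 * b.1, a.1 * b.2 + a.2 * b.1).
Definition dual_one : dual := (1, 0).

Fact dual_mulA : associative dual_mul.
Proof.
move=> a b c; congr pair => /=; first by rewrite mulrA.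
by rewrite mulrDl mulrDr !mulrA addrA.
Qed.
Fact dual_mul1l : left_id dual_one dual_mul.
Proof. by case=> a b; congr pair => /=; rewrite !mul1r // mul0r addr0. Qed.
Fact dual_mul1r : right_id dual_one dual_mul.
Proof. by case=> a b; congr pair => /=; rewrite !mulr1 // mulr0 add0r. Qed.
Fact dual_mulDl : left_distributive dual_mul +%R.
Proof. by move=> a b c; congr pair => /=; rewrite !mulrDl // addrACA. Qed.
Fact dual_mulDr : right_distributive dual_mul +%R.
Proof. by move=> a b c; congr pair => /=; rewrite !mulrDr // addrACA. Qed.
Fact dual_one_neq0 : dual_one != 0.
Proof. by apply/eqP => -[] /eqP; rewrite oner_eq0. Qed.

HB.instance Definition _ := GRing.Zmodule_isNzRing.Build dual
  dual_mulA dual_mul1l dual_mul1r dual_mulDl dual_mulDr dual_one_neq0.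

Fact dual_scaleAl (k : R[i]) (a b : dual) : k *: (a * b) = (k *: a : dual) * b.
Proof.
rewrite [LHS]surjective_pairing [RHS]surjective_pairing; congr pair => /=.
  by rewrite scalerAl.
by rewrite scalerDr !scalerAl.
Qed.
HB.instance Definition _ := GRing.Lmodule_isLalgebra.Build R[i] dual dual_scaleAl.
Fact dual_scaleAr (k : R[i]) (a b : dual) : k *: (a * b) = a * (k *: b : dual).
Proof.
rewrite [LHS]surjective_pairing [RHS]surjective_pairing; congr pair => /=.
  by rewrite scalerAr.
by rewrite scalerDr !scalerAr.
Qed.
HB.instance Definition _ := GRing.Lalgebra_isAlgebra.Build R[i] dual dual_scaleAr.

Definition dual_norm (a : dual) : R := bnorm a.1 + bnorm a.2.

Fact dual_norm_ge0 a : 0 <= dual_norm a.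
Proof. by apply: addr_ge0; apply: bnorm_ge0. Qed.
Fact dual_norm_eq0 a : dual_norm a = 0 -> a = 0.
Proof.
case: a => a b /eqP; rewrite paddr_eq0 ?bnorm_ge0 //= => /andP[/eqP a0 /eqP b0].
by rewrite (bnorm_eq0 _ a0) (bnorm_eq0 _ b0).
Qed.
Fact dual_normD a b : dual_norm (a + b) <= dual_norm a + dual_norm b.
Proof. by rewrite /dual_norm addrACA lerD // bnormD. Qed.
Fact dual_normZ (k : R[i]) a : dual_norm (k *: a) = rnorm k * dual_norm a.
Proof. by rewrite /dual_norm mulrDr -!bnormZ. Qed.
Fact dual_normM a b : dual_norm (a * b) <= dual_norm a * dual_norm b.
Proof.
rewrite /dual_norm /=.
have h1 := bnormM a.1 b.1; have h2 := bnormM a.1 b.2; have h3 := bnormM a.2 b.1.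
have h4 := bnormD (a.1 * b.2) (a.2 * b.1).
have h5 := mulr_ge0 (bnorm_ge0 a.2) (bnorm_ge0 b.2).
by lra.
Qed.
Fact dual_norm1 : dual_norm 1 = 1.
Proof. by rewrite /dual_norm /= bnorm1 bnorm0 addr0. Qed.
Fact dual_complete (u : nat -> dual) :
  (forall e, 0 < e -> exists N, forall m n, (N <= m)%N -> (N <= n)%N ->
     dual_norm (u m - u n) <= e) ->
  exists l, forall e, 0 < e -> exists N, forall n, (N <= n)%N ->
     dual_norm (u n - l) <= e.
Proof.
move=> cau.
have [|l1 h1] := @bnorm_complete R B (fun n => (u n).1).
  move=> e /cau[N uN]; exists N => m n mN nN; apply: le_trans (uN m n mN nN).
  by rewrite /dual_norm lerDl bnorm_ge0.
have [|l2 h2] := @bnorm_complete R B (fun n => (u n).2).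
  move=> e /cau[N uN]; exists N => m n mN nN; apply: le_trans (uN m n mN nN).
  by rewrite /dual_norm lerDr bnorm_ge0.
exists (l1, l2) => e e0.
have [N1 g1] := h1 (e / 2) ltac:(lra); have [N2 g2] := h2 (e / 2) ltac:(lra).
exists (maxn N1 N2) => n; rewrite geq_max => /andP[/g1 k1 /g2 k2].
by rewrite /dual_norm /=; lra.
Qed.

HB.instance Definition _ := Algebra_isBanach.Build R dual dual_norm_ge0 dual_norm_eq0
  dual_normD dual_normZ dual_normM dual_norm1 dual_complete.

Lemma dual_bnormE (a : dual) : bnorm a = bnorm a.1 + bnorm a.2.
Proof. by []. Qed.

Lemma dual_mulE (a b : dual) : a * b = (a.1 * b.1, a.1 * b.2 + a.2 * b.1).
Proof. by []. Qed.

Lemma dual_oneE : (1 : dual) = (1, 0).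
Proof. by []. Qed.

Lemma dual_inv (a : dual) : bunit a.1 ->
  bunit a /\ binv a = (binv a.1, - (binv a.1 * a.2 * binv a.1)).
Proof.
case: a => a b /= au; set b' := _ * b * _.
have h1 : ((a, b) : dual) * (binv a, - b') = 1.
  rewrite dual_mulE /= mulrbV // mulrN /b' !mulrA mulrbV // mul1r addNr.
  by [].
have h2 : ((binv a, - b') : dual) * (a, b) = 1.
  rewrite dual_mulE /= mulbVr // mulNr /b' -!mulrA mulbVr // mulr1 subrr.
  by [].
by split; [exists (binv a, - b')|exact: binv_uniq].
Qed.

End Dual.

Section DualMaps.
Context {R : realType} {A B : banachAlgType R}.

Section Iota.
Variable iota : {lrmorphism B -> A}.
Definition dual_iota (b : dual B) : dual A := (iota b.1, iota b.2).
Fact dual_iota_linear : linear dual_iota.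
Proof. by move=> k a b; congr pair; rewrite /= linearP. Qed.
HB.instance Definition _ := GRing.isLinear.Build R[i] (dual B) (dual A) *:%R dual_iota
  dual_iota_linear.
Fact dual_iota_monoid : monoid_morphism dual_iota.
Proof.
split; first by congr pair; rewrite /= ?rmorph1 ?rmorph0.
by move=> a b; congr pair; rewrite /= ?rmorphD ?rmorphM.
Qed.
HB.instance Definition _ := GRing.isMonoidMorphism.Build (dual B) (dual A) dual_iota
  dual_iota_monoid.
End Iota.

Variables (E E' : {linear A -> B}).
(** E + eps E', extended to A[eps] by B[eps]-linearity. *)
Definition dual_E (a : dual A) : dual B := (E a.1, E' a.1 + E a.2).
Fact dual_E_linear : linear dual_E.
Proof. by move=> k a b; congr pair; rewrite /= ?linearP //= scalerDr addrACA. Qed.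
HB.instance Definition _ := GRing.isLinear.Build R[i] (dual A) (dual B) *:%R dual_E
  dual_E_linear.

End DualMaps.

(** * Infinitesimal freeness as freeness over the dual numbers *)

Section DualNcps.
Context {R : realType} {A B : banachAlgType R}.
Variables (iota : {lrmorphism B -> A}) (E E' : {linear A -> B}).
Hypothesis HE : ncps iota E.
Hypothesis E'_bound : exists K : R, forall a, bnorm (E' a) <= K * bnorm a.
Hypothesis E'_bimod : forall b1 a b2, E' (iota b1 * a * iota b2) = b1 * E' a * b2.
Hypothesis E'_1 : E' 1 = 0.

Lemma E'iotaM b a : E' (iota b * a) = b * E' a.
Proof. by have := E'_bimod b a 1; rewrite rmorph1 !mulr1. Qed.

Lemma E'iota b : E' (iota b) = 0.
Proof. by rewrite -[iota b]mulr1 E'iotaM E'_1 mulr0. Qed.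

Lemma dual_ncps : ncps (dual_iota iota) (dual_E E E').
Proof.
have [K EK] := ncps_bounded HE; have [K' EK'] := E'_bound.
split.
- by move=> b; rewrite !dual_bnormE /= !(ncps_iota HE).
- exists (`|K| + `|K'|) => a; rewrite !dual_bnormE /=.
  have a1 := bnorm_ge0 a.1; have a2 := bnorm_ge0 a.2.
  have h1 := EK a.1; have h2 := EK a.2; have h3 := EK' a.1.
  have h4 := bnormD (E' a.1) (E a.2).
  have k1 : K * bnorm a.1 <= `|K| * bnorm a.1 by rewrite ler_wpM2r // ler_norm.
  have k2 : K * bnorm a.2 <= `|K| * bnorm a.2 by rewrite ler_wpM2r // ler_norm.
  have k3 : K' * bnorm a.1 <= `|K'| * bnorm a.1 by rewrite ler_wpM2r // ler_norm.
  have k4 : 0 <= `|K'| * bnorm a.2 by rewrite mulr_ge0.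
  by lra.
- by case=> b1 b2; rewrite /= /dual_E /= E'iota add0r !(ncps_id HE).
move=> b1 a b2; rewrite !dual_mulE /= /dual_E /=; congr pair.
  by rewrite (ncps_bimod HE).
rewrite E'_bimod mulrDl !linearD /= !(ncps_bimod HE) !mulrDr !mulrDl.
by lmod_ring.
Qed.

Lemma dual_prod (n : nat) (a : nat -> dual A) :
  \prod_(0 <= k < n) a k =
  (\prod_(0 <= k < n) (a k).1,
   \sum_(0 <= j < n) \prod_(0 <= k < j) (a k).1 * (a j).2
       * \prod_(j.+1 <= k < n) (a k).1) :> dual A.
Proof.
elim: n => [|n IH]; first by rewrite !big_geq.
rewrite [LHS]big_nat_recr // IH -[LHS]/(@GRing.mul (dual A) _ _) dual_mulE /=; congr (_, _); rewrite big_nat_recr //=.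
rewrite (big_geq (m := n.+1)) // mulr1 addrC; congr (_ + _).
rewrite mulr_suml; apply: eq_big_nat => j /andP[_ jn].
by rewrite [in RHS]big_nat_recr //= !mulrA.
Qed.

(** Let a_j + eps c_j be centred letters: E(a_j) = 0 and E'(a_j) + E(c_j) = 0.
    By the formula for E' of a product, the eps-part of the expectation of their
    product is a sum of expectations of alternating words in which one a_j is
    replaced by E'(a_j) + c_j, which is centred as well. *)
Lemma dual_free (S : bool -> A -> Prop) :
  (forall i, subalg_over iota (S i)) ->
  (forall (n : nat) (i : nat -> bool) (a : nat -> A), (0 < n)%N ->
    (forall k, (k.+1 < n)%N -> i k <> i k.+1) ->
    (forall k, (k < n)%N -> S (i k) (a k)) ->
    (forall k, (k < n)%N -> E (a k) = 0) ->
    E (\prod_(0 <= k < n) a k) = 0 /\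
    E' (\prod_(0 <= k < n) a k) =
      \sum_(0 <= j < n)
        E (\prod_(0 <= k < j) a k * iota (E' (a j)) * \prod_(j.+1 <= k < n) a k)) ->
  free_family (dual_E E E') (fun i a => S i a.1 /\ S i a.2).
Proof.
move=> Salg Sfree n i a n0 ialt Sa Ea.
have Ea1 k : (k < n)%N -> E (a k).1 = 0 by move=> /Ea []; rewrite /=.
have Ea2 k : (k < n)%N -> E' (a k).1 + E (a k).2 = 0 by move=> /Ea [].
rewrite dual_prod /= /dual_E /=.
have [-> ->] := Sfree n i (fun k => (a k).1) n0 ialt (fun k kn => proj1 (Sa k kn)) Ea1.
congr pair; rewrite linear_sum /= -big_split /=.
rewrite big_nat_cond big1 // => j; rewrite andbT => /andP[_ jn].
rewrite -linearD /= -mulrDl -mulrDr.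
pose c k := if k == j then iota (E' (a j).1) + (a j).2 else (a k).1.
have cprod : \prod_(0 <= k < n) c k = \prod_(0 <= k < j) (a k).1
    * (iota (E' (a j).1) + (a j).2) * \prod_(j.+1 <= k < n) (a k).1.
  rewrite (big_cat_nat (n := j)) ?(ltnW jn) //= (big_ltn jn) mulrA {2}/c eqxx.
  congr (_ * _ * _); apply: eq_big_nat => k /andP[k1 k2]; rewrite /c.
    by rewrite ltn_eqF.
  by rewrite gtn_eqF.
rewrite -cprod; apply: (proj1 (Sfree n i c n0 ialt _ _)) => k kn; rewrite /c.
  case: eqP => [->|_]; last by have [] := Sa k kn.
  by apply: so_add => //; [apply: so_iota|have [] := Sa j jn].
case: eqP => [_|_]; last exact: Ea1.
by rewrite linearD /= (ncps_id HE) Ea2.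
Qed.

Lemma dual_subalg (S : A -> Prop) : subalg_over iota S ->
  subalg_over (dual_iota iota) (fun a : dual A => S a.1 /\ S a.2).
Proof.
move=> Salg; split=> [b|a b [a1 a2] [b1 b2]|a b [a1 a2] [b1 b2]].
- by split; apply: so_iota.
- by split; apply: (so_add Salg).
by split; [apply: (so_mul Salg)|apply: (so_add Salg); apply: (so_mul Salg)].
Qed.

Section Germs.
Variable z : A.
Let dz : dual A := (z, 0).

(** The function d psi_z attached to E'. *)
Definition dmoment (b : B) : B := E' (resolvent iota z b - 1).

Lemma dual_res (c v : B) : bunit (1 - iota c * z) ->
  resolvent (dual_iota iota) dz (c, v) =
  (resolvent iota z c, resolvent iota z c * iota v * z * resolvent iota z c).
Proof.
move=> cu; rewrite /resolvent.
have E1 : (1 : dual A) - dual_iota iota (c, v) * dz = (1 - iota c * z, - (iota v * z)).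
  rewrite dual_oneE dual_mulE /= mulr0 add0r.
  by congr pair; rewrite /= sub0r.
have [_ ->] := @dual_inv _ _ (1 - dual_iota iota (c, v) * dz) ltac:(by rewrite E1).
by rewrite E1 /= mulrN mulNr opprK mulrA.
Qed.

Lemma moment_derivative (c v : B) : bunit (1 - iota c * z) ->
  E (resolvent iota z c * iota v * z * resolvent iota z c) =
  v * theta iota E z c + c * dtheta iota E z c v.
Proof.
move=> cu; have rE := resE cu.
have {1}-> : resolvent iota z c = 1 + iota c * (z * resolvent iota z c).
  by rewrite -rE addrC subrK.
rewrite !mulrDl mul1r linearD /= -!mulrA !(EiotaM HE) /theta /dtheta.
by rewrite !mulrA.
Qed.

Lemma dual_moment (c v : B) : bunit (1 - iota c * z) ->
  moment (dual_iota iota) (dual_E E E') dz (c, v) =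
  (moment iota E z c,
   dmoment c + (v * theta iota E z c + c * dtheta iota E z c v)).
Proof.
move=> cu; rewrite /moment dual_res // dual_oneE /dmoment -moment_derivative //.
by rewrite /= /dual_E /= subr0.
Qed.

Lemma dual_theta (c v : B) : bunit (1 - iota c * z) ->
  theta (dual_iota iota) (dual_E E E') dz (c, v) =
  (theta iota E z c, E' (z * resolvent iota z c) + dtheta iota E z c v).
Proof.
move=> cu; rewrite /theta dual_res // dual_mulE /= mul0r addr0 /dual_E /=.
by rewrite /dtheta.
Qed.

Lemma dual_rho (w : B) : bnorm w <= 1 / 2 -> rho ((w, 0) : dual B) = (rho w, 0).
Proof.
move=> w2; have [wu _] := bunit_1D w2; rewrite /rho.
have E1 : (1 : dual B) + ((w, 0) : dual B) = (1 + w, 0).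
  by rewrite dual_oneE; congr pair; rewrite /= addr0.
have [_ ->] := @dual_inv _ _ (1 + ((w, 0) : dual B)) ltac:(by rewrite E1).
by rewrite E1 dual_mulE /= !mulr0 mul0r oppr0 mul0r addr0.
Qed.

Variables (chi s : B -> B) (dchi : B -> B -> B) (r0 r1 C : R).
Hypothesis g : S_germ iota E z chi s dchi r0 r1 C.
Variables (Chi Sg : dual B -> dual B) (dChi : dual B -> dual B -> dual B) (R0 R1 CC : R).
Hypothesis G : S_germ (dual_iota iota) (dual_E E E') dz Chi Sg dChi R0 R1 CC.

(** The derivative at w of the S-transform. *)
Definition S_deriv (w u : B) : B :=
  let eta := binv (theta iota E z (chi w)) in
  u * eta - (1 + w) * (eta * dtheta iota E z (chi w) (dchi w u) * eta).

Lemma frechet_S_deriv w : bnorm w < r1 -> frechet s w (S_deriv w).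
Proof. exact: (sg_sD g). Qed.

(** The S-transform over the dual numbers is S_z + eps dS_z, extended to
    w + eps u by its Taylor expansion.  The eps-part at u = 0 is the infinitesimal
    S-transform: multiplied by rho(w) it gives the first-order variation of the
    inverse of psi_z when E becomes E + eps E'. *)
Lemma dual_germ : exists2 r : R, 0 < r & forall w, bnorm w <= r ->
  [/\ - dchi w (dmoment (chi w)) = rho w * (Sg (w, 0)).2,
     forall u, bnorm u <= r -> Sg (w, u) = (s w, S_deriv w u + (Sg (w, 0)).2) &
     exists L, frechet (fun v => (Sg (v, 0)).2) w L].
Proof.
have [K' EK'] := E'_bound; pose K := `|K'| + 1.
have K0 : 0 < K by rewrite /K; have := normr_ge0 K'; lra.
have EK a : bnorm (E' a) <= K * bnorm a.
  apply: (le_trans (EK' a)); rewrite ler_wpM2r ?bnorm_ge0 //.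
  by rewrite /K; have := ler_norm K'; lra.
have C0 := sg_C g; have /andP[r10 r12] := sg_r1 g; have r00 := sg_r0 g.
have /andP[R10 R12] := sg_r1 G; have R00 := sg_r0 G.
have n0 := bnorm_ge0 z.
pose P := K * bnorm z * 2 * C; have P0 : 0 <= P by rewrite /P !mulr_ge0 // ltW.
pose Q := C * (1 + P) + C; have Q0 : 0 <= Q.
  by rewrite /Q; have := mulr_ge0 C0 P0; lra.
pose r := Num.min (Num.min (r1 / 2) (R1 / 3)) (Num.min (R0 / (Q + 1))
   (1 / 2 / (C * bnorm z + 1))).
have Cn0 := mulr_ge0 C0 n0.
have r_gt0 : 0 < r by rewrite !lt_min !divr_gt0 //; lra.
have hr1 : r <= r1 / 2 by rewrite /r !ge_min lexx.
have hr2 : r <= R1 / 3 by rewrite /r !ge_min lexx orbT.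
have hr3 : r * (Q + 1) <= R0.
  by rewrite -ler_pdivlMr; [rewrite /r !ge_min lexx !orbT | lra].
have hr4 : r * (C * bnorm z + 1) <= 1 / 2.
  by rewrite -ler_pdivlMr; [rewrite /r !ge_min lexx !orbT | lra].
clearbody r.
exists r => // w w1.
have w0 := bnorm_ge0 w.
have wr : bnorm w <= r1 by lra.
have wr' : bnorm w < r1 by lra.
have cr := sg_chi_r0 g wr; have cs := sg_chi_small g wr.
have cu := sg_res g cr; have tu := sg_theta g cr.
have Cw : C * bnorm w <= C * r by apply: ler_wpM2l.
have [_ rb] : bunit (1 - iota (chi w) * z) /\ bnorm (resolvent iota z (chi w)) <= 2.
  apply: (res_bound HE).
  have : bnorm (chi w) * bnorm z <= C * r * bnorm z by apply: ler_wpM2r => //; lra.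
  by lra.
have dmb : bnorm (dmoment (chi w)) <= P * r.
  rewrite /dmoment (resE cu) E'iotaM.
  have h1 : bnorm (E' (z * resolvent iota z (chi w))) <= K * (bnorm z * 2).
    by apply: (le_trans (EK _)); rewrite ler_pM2l //; apply: bnormM_le.
  have := bnormM_le (le_trans cs Cw) h1; rewrite /P; lra.
have [dlin _ _] := sg_chiD g wr'.
have dchiD u v : dchi w (u + v) = dchi w u + dchi w v.
  by have := dlin 1 u v; rewrite !scale1r.
have dthD u v : dtheta iota E z (chi w) (u + v) =
    dtheta iota E z (chi w) u + dtheta iota E z (chi w) v.
  by have := dtheta_linear iota E z (chi w) 1 u v; rewrite !scale1r.
pose beta u := dchi w (u - dmoment (chi w)).
have ChiE u : bnorm u <= r -> Chi (w, u) = (chi w, beta u).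
  move=> u1; have u0 := bnorm_ge0 u.
  have mE : moment (dual_iota iota) (dual_E E E') dz (chi w, beta u) = (w, u).
    rewrite dual_moment // (sg_moment_chi g wr) (sg_dchi g _ wr).
    by rewrite addrC subrK.
  rewrite -mE; apply: (sg_chi_moment G); last first.
    by rewrite mE dual_bnormE /=; lra.
  rewrite dual_bnormE /=.
  have b1 := sg_dchi_bound g (u - dmoment (chi w)) wr.
  have b2 := bnormB u (dmoment (chi w)).
  have b3 : C * bnorm (u - dmoment (chi w)) <= C * (r + P * r).
    by apply: ler_wpM2l => //; lra.
  by rewrite /beta; rewrite /Q in hr3; lra.
have w0R : bnorm ((w, 0) : dual B) <= R1 by rewrite dual_bnormE /= bnorm0; lra.
have z0r : bnorm (0 : B) <= r by rewrite bnorm0 ltW.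
have SgE u : bnorm u <= r -> Sg (w, u) = (s w, S_deriv w u + (Sg (w, 0)).2).
  have form v : bnorm v <= r -> Sg (w, v) = ((1 + w) * binv (theta iota E z (chi w)),
     - ((1 + w) * (binv (theta iota E z (chi w)) *
        (E' (z * resolvent iota z (chi w)) + dtheta iota E z (chi w) (beta v))
         * binv (theta iota E z (chi w)))) + v * binv (theta iota E z (chi w))).
    move=> v1; have v0 := bnorm_ge0 v.
    have vR : bnorm ((w, v) : dual B) <= R1 by rewrite dual_bnormE /=; lra.
    rewrite (sg_s G vR) ChiE // dual_theta //.
    set T := (theta iota E z (chi w), _) : dual B.
    have [_ ->] := @dual_inv _ _ T tu.
    by rewrite dual_oneE dual_mulE /= add0r mulrN.
  move=> u1; rewrite (form u u1) (form 0 z0r) /= (sg_s g wr); congr pair.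
  have -> : beta u = dchi w u + beta 0 by rewrite /beta sub0r -dchiD.
  by rewrite dthD /S_deriv; nc_ring.
split=> //.
- have := sg_chi_s G w0R; rewrite dual_rho; last by lra.
  rewrite ChiE // dual_mulE /= mul0r addr0 => -[_ <-].
  have e : dchi w (0 - dmoment (chi w)) = - dchi w (dmoment (chi w)).
    by have := dchiD (- dmoment (chi w)) (dmoment (chi w)); rewrite addNr sub0r
      (_ : dchi w 0 = 0) => [/esym/addr0_eq/(congr1 -%R)|];
      [rewrite opprK => ->|have := dchiD 0 0; rewrite addr0 => /esym/eqP; rewrite -subr_eq0 addrK => /eqP].
  by rewrite /beta e.
have lin1 : linear (fun v : B => (v, 0) : dual B).
  by move=> k a b; congr pair; rewrite /= scaler0 addr0.
have D1 : frechet (fun v : B => (v, 0) : dual B) w (fun v => (v, 0)).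
  apply: (frechet_blin _ lin1); exists 1 => // h.
  by rewrite dual_bnormE /= bnorm0 addr0 mul1r.
have lin2 : linear (fun a : dual B => a.2) by [].
have bl2 : exists2 K : R, 0 <= K & forall h : dual B, bnorm h.2 <= K * bnorm h.
  by exists 1 => // h; rewrite dual_bnormE mul1r lerDr bnorm_ge0.
have w0R' : bnorm ((w, 0) : dual B) < R1 by rewrite dual_bnormE /= bnorm0; lra.
have D3 := frechet_blin (Sg (w, 0)) lin2 bl2.
by eexists; apply: (frechet_comp (frechet_comp D1 (sg_sD G w0R')) D3).
Qed.

End Germs.

End DualNcps.

(** * The first-order part of multiplicativity *)

Section InfinitesimalProduct.
Context {R : realType} {A B : banachAlgType R}.
Variables (iota : {lrmorphism B -> A}) (E E' : {linear A -> B}).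
Hypothesis HE : ncps iota E.
Hypothesis E'_bound : exists K : R, forall a, bnorm (E' a) <= K * bnorm a.
Hypothesis E'_bimod : forall b1 a b2, E' (iota b1 * a * iota b2) = b1 * E' a * b2.
Hypothesis E'_1 : E' 1 = 0.

Variable S : bool -> A -> Prop.
Hypothesis Salg : forall i, subalg_over iota (S i).
Hypothesis Sfree : forall (n : nat) (i : nat -> bool) (a : nat -> A), (0 < n)%N ->
    (forall k, (k.+1 < n)%N -> i k <> i k.+1) ->
    (forall k, (k < n)%N -> S (i k) (a k)) ->
    (forall k, (k < n)%N -> E (a k) = 0) ->
    E (\prod_(0 <= k < n) a k) = 0 /\
    E' (\prod_(0 <= k < n) a k) =
      \sum_(0 <= j < n)
        E (\prod_(0 <= k < j) a k * iota (E' (a j)) * \prod_(j.+1 <= k < n) a k).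
Variables x y : A.
Hypotheses (Sx : S false x) (Sy : S true y).

Let d (z : A) : dual A := (z, 0).

Lemma inf_free_E_mul : E (x * y) = E x * E y.
Proof.
pose a k := if k == 0%N then x - iota (E x) else y - iota (E y).
have Sf := Sfree (n := 2%N) (i := fun k => k == 1%N) (a := a) isT.
have Eiota b : E (iota b) = b := ncps_id HE b.
have H1 : forall k, (k.+1 < 2)%N -> (k == 1%N) <> (k.+1 == 1%N) by case.
have N i b : S i (- iota b) by rewrite -rmorphN; apply: so_iota.
have H2 : forall k, (k < 2)%N -> S (k == 1%N) (a k).
  by move=> [|[|k]] // _; apply: (so_add (Salg _)).
have H3 : forall k, (k < 2)%N -> E (a k) = 0.
  by move=> [|[|k]] // _; rewrite /a /= linearB /= Eiota subrr.
have [+ _] := Sf H1 H2 H3; rewrite !big_nat_recr //= big_geq // mul1r /a /=.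
rewrite mulrBl !mulrBr !linearB /= !(EiotaM HE) (EMiota HE) Eiota.
by rewrite subrr addr0 => /subr0_eq.
Qed.

(** The eps-part of the multiplicativity theorem over the dual numbers, at points
    of B. *)
Theorem infinitesimal_product chix sx dx r0x r1x Cx chiy sy dy r0y r1y Cy chip sp dp r0p r1p Cp
    Chix Sgx Dx R0x R1x CCx Chiy Sgy Dy R0y R1y CCy Chip Sgp Dp R0p R1p CCp :
  S_germ iota E x chix sx dx r0x r1x Cx -> S_germ iota E y chiy sy dy r0y r1y Cy ->
  S_germ iota E (x * y) chip sp dp r0p r1p Cp ->
  S_germ (dual_iota iota) (dual_E E E') (d x) Chix Sgx Dx R0x R1x CCx -> S_germ (dual_iota iota) (dual_E E E') (d y) Chiy Sgy Dy R0y R1y CCy ->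
  S_germ (dual_iota iota) (dual_E E E') (d (x * y)) Chip Sgp Dp R0p R1p CCp ->
  exists2 r : R, 0 < r & forall w, bnorm w <= r ->
    let s := sy w in let ds := (Sgy (w, 0)).2 in let w' := binv s * w * s in
    bunit s /\
    (Sgp (w, 0)).2 =
      s * S_deriv iota E x chix dx w' (binv s * w * ds - binv s * ds * binv s * w * s)
      + s * (Sgx (w', 0)).2 + ds * sx w'.
Proof.
move=> gx gy gp Gx Gy Gp.
have HdE := dual_ncps HE E'_bound E'_bimod E'_1.
have dSalg i : subalg_over (dual_iota iota) (fun a : dual A => S i a.1 /\ S i a.2) by apply: dual_subalg.
have dSfree := dual_free HE Salg Sfree.
have S0 i : S i 0 by rewrite -(rmorph0 iota); apply: so_iota.
have Gp' : S_germ (dual_iota iota) (dual_E E E') (d x * d y) Chip Sgp Dp R0p R1p CCp.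
  suff -> : d x * d y = d (x * y) by [].
  by rewrite dual_mulE /= mulr0 mul0r addr0.
have dSx : S false (d x).1 /\ S false (d x).2 by split.
have dSy : S true (d y).1 /\ S true (d y).2 by split.
have [r2 r20 mulS] := S_transform_mul (x := d x) (y := d y) HdE dSalg dSfree dSx dSy Gx Gy Gp'.
have [rx rx0 Hx] := dual_germ HE E'_bound E'_bimod gx Gx.
have [ry ry0 Hy] := dual_germ HE E'_bound E'_bimod gy Gy.
have CC0 := sg_C Gy; have /andP[R1y0 _] := sg_r1 Gy; have /andP[r1y0 _] := sg_r1 gy.
have CCCC := mulr_ge0 CC0 CC0.
pose r := Num.min (Num.min r2 ry) (Num.min (Num.min R1y r1y) (rx / (CCy * CCy + 1))).
have r0 : 0 < r by rewrite !lt_min r20 ry0 R1y0 r1y0 divr_gt0 //; lra.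
exists r => // w; rewrite !le_min => /andP[/andP[w1 w2] /andP[/andP[w3 w4] w5]].
have {}w5 : bnorm w * (CCy * CCy + 1) <= rx by rewrite -ler_pdivlMr //; lra.
have w0 := bnorm_ge0 w.
move=> s ds w'.
have su : bunit s := sg_sunit gy w4.
split=> //.
have dwE : bnorm ((w, 0) : dual B) = bnorm w by rewrite dual_bnormE /= bnorm0 addr0.
have [_ prodE] := mulS (w, 0) ltac:(by rewrite dwE).
have [_ /(_ 0) SyE _] := Hy w w2.
have {}SyE : Sgy (w, 0) = (s, ds).
  by have := SyE ltac:(rewrite bnorm0; exact: ltW) => e; rewrite /ds e.
have dwR : bnorm ((w, 0) : dual B) <= R1y by rewrite dwE.
have b1 := sg_s_bound Gy dwR; have b2 := sg_sV_bound Gy dwR.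
have := bnormM_le (bnormM_le b2 (lexx (bnorm ((w, 0) : dual B)))) b1.
rewrite prodE SyE.
have [_ ->] := @dual_inv _ _ ((s, ds) : dual B) su.
rewrite !dual_mulE /= mulr0 add0r dwE.
set o := binv s * w * ds + _; rewrite dual_bnormE /= => bo.
have bo' : bnorm (binv s * w * s) + bnorm o <= rx by apply: (le_trans bo); lra.
have ob := bnorm_ge0 o; have wb := bnorm_ge0 (binv s * w * s).
have [_ /(_ o) SxE _] := Hx (binv s * w * s) ltac:(lra).
rewrite SxE /=; last by lra.
rewrite -/w' mulrDr; congr (_ * S_deriv _ _ _ _ _ _ _ + _ + _).
by rewrite /o !mulNr.
Qed.

End InfinitesimalProduct.

(** * Square roots and spectra in C*-algebras *)

Section CStarBanach.
Context {R : realType} (A : cstarAlgType R).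

Fact cs_rnormM (a b : A) : rnorm (a * b) <= rnorm a * rnorm b.
Proof. by rewrite -lecR rmorphM /= -!rnormE; exact: cs_norm_mul. Qed.

Lemma star1 : star (1 : A) = 1.
Proof.
have h : star (star (1 : A)) = 1 by exact: cs_starK.
have starM (a b : A) : star (a * b) = star b * star a by exact: cs_starM.
by have := starM (star 1) 1; rewrite mulr1 h mulr1.
Qed.

Lemma rnorm_star_mul (a : A) : rnorm (star a * a) = rnorm a ^+ 2.
Proof.
apply: complexI; rewrite rmorphXn /= -!rnormE; exact: cs_norm_star.
Qed.

Fact cs_rnorm1 : rnorm (1 : A) = 1.
Proof.
have := rnorm_star_mul 1; rewrite star1 mulr1 => /eqP.
rewrite expr2 -[X in X == _]mulr1 -subr_eq0 -mulrBr mulf_eq0 => /orP[|].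
  by move=> /eqP /rnorm_eq0 /eqP; rewrite oner_eq0.
by rewrite subr_eq0 => /eqP <-.
Qed.

HB.instance Definition _ := Algebra_isBanach.Build R (cs_sort A)
  (@rnorm_ge0 R (cs_space A)) (@rnorm_eq0 R (cs_space A)) (@rnormD R (cs_space A))
  (@rnormZ R (cs_space A)) cs_rnormM cs_rnorm1 (@rnorm_complete R (cs_space A)).

End CStarBanach.

Section CStar.
Context {R : realType} {A : cstarAlgType R}.
Implicit Types a b c u v x y : A.

Lemma starK a : star (star a) = a. Proof. exact: cs_starK. Qed.
Lemma starD a b : star (a + b) = star a + star b. Proof. exact: cs_starD. Qed.
Lemma starZ (k : R[i]) a : star (k *: a) = (k^*)%R *: star a. Proof. exact: cs_starZ. Qed.
Lemma starM a b : star (a * b) = star b * star a. Proof. exact: cs_starM. Qed.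
Lemma starZr (r : R) a : star (r%:C%C *: a) = r%:C%C *: star a.
Proof. by rewrite starZ; congr (_ *: _); apply: CrealP; rewrite complex_real. Qed.
Lemma starN a : star (- a) = - star a.
Proof. by rewrite -scaleN1r starZ rmorphN1 scaleN1r. Qed.
Lemma starZi a : star ('i%C *: a) = - ('i%C *: star a).
Proof. by rewrite starZ -scaleNr; congr (_ *: _); simpc. Qed.

Lemma bnorm_star_mul a : bnorm (star a * a) = bnorm a ^+ 2.
Proof. exact: rnorm_star_mul. Qed.

Lemma bnorm_star_le a : bnorm a <= bnorm (star a).
Proof.
have [->|a0] := eqVneq (bnorm a) 0; first exact: bnorm_ge0.
have ap : 0 < bnorm a by rewrite lt_neqAle eq_sym a0 bnorm_ge0.
by rewrite -(ler_pM2r ap) -expr2 -bnorm_star_mul bnormM.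
Qed.

Lemma bnorm_star a : bnorm (star a) = bnorm a.
Proof. by apply: le_anti; rewrite bnorm_star_le -{2}[a]starK bnorm_star_le. Qed.

Lemma bnormZr (r : R) a : bnorm (r%:C%C *: a) = `|r| * bnorm a.
Proof. by rewrite bnormZ rnorm_real. Qed.

Lemma bnormZi a : bnorm ('i%C *: a) = bnorm a.
Proof. by rewrite bnormZ rnorm_i mul1r. Qed.

Lemma bunit_scale (k : R[i]) a : k != 0 -> bunit a -> bunit (k *: a).
Proof.
move=> k0 [b [ab ba]]; exists (k^-1 *: b).
by rewrite -!scalerAl -!scalerAr !scalerA ab ba mulfV // mulVf // scale1r.
Qed.

Definition selfadj a := star a = a.

(** u + i v is normal, with real part u. *)
Lemma bnorm_sum_squares u v : selfadj u -> selfadj v -> u * v = v * u ->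
  bnorm u ^+ 2 <= bnorm (u * u + v * v).
Proof.
move=> su sv uv; pose n := u + 'i%C *: v.
have sn : star n = u - 'i%C *: v by rewrite starD starZi su sv.
have -> : u * u + v * v = star n * n.
  have jj : 'i%C *: ('i%C *: (v * v)) = - (v * v).
    by rewrite scalerA -expr2 sqr_i scaleN1r.
  by rewrite sn /n mulrDl !mulrDr !mulNr -!scalerAl -!scalerAr uv jj; lmod_ring.
rewrite bnorm_star_mul ler_sqr ?nnegrE ?bnorm_ge0 //.
have : u + u = n + star n by rewrite sn /n; lmod_ring.
have -> : u + u = (2 : R)%:C%C *: u by rewrite rmorph_nat scaler_nat mulr2n.
move=> /(congr1 bnorm); rewrite bnormZr ger0_norm // => e.
by have := bnormD n (star n); rewrite -e bnorm_star; lra.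
Qed.

(** 1 - f solves s = (x + s^2) / 2; selfadjointness and commutation persist along
    the iteration. *)
Lemma sqrt_one_minus x : selfadj x -> bnorm x < 1 -> exists f, 
  [/\ selfadj f, f * f = 1 - x & forall y, y * x = x * y -> y * f = f * y].
Proof.
move=> sx x1; pose q := bnorm x; have q0 : 0 <= q := bnorm_ge0 x.
pose h := (1 / 2 : R)%:C%C; have hh : h + h = 1 :> R[i].
  by rewrite -rmorphD /= (_ : 1 / 2 + 1 / 2 = 1) //; field.
have hn a : bnorm (h *: a) = 1 / 2 * bnorm a by rewrite bnormZr ger0_norm.
have [||||||s [sq ss sc] sE] := @contraction_fixpoint R A
  (fun s => [/\ bnorm s <= q, selfadj s & forall y, y * x = x * y -> y * s = s * y])
  (fun s => h *: (x + s * s)) q 0.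
- split; first by rewrite bnorm0.
    by rewrite /selfadj -[0 : A](scale0r 0) -[0 : R[i]]/((0 : R)%:C%C) starZr !scale0r.
  by move=> y _; rewrite mulr0 mul0r.
- move=> s [sq ss sc]; split.
  + rewrite hn; have := bnormD x (s * s); have := bnormM_le sq sq.
    have : q * q <= q by rewrite ler_piMl // ltW.
    by rewrite -/q; lra.
  + by rewrite /selfadj starZr starD starM ss sx.
  move=> y yx; rewrite -scalerAr -scalerAl mulrDr mulrDl yx mulrA (sc y yx).
  by rewrite -mulrA (sc y yx) mulrA.
- move=> w l wD wl; split.
  + by apply: (ball_closed _ wl) => n; have [] := wD n.
  + apply/subr0_eq/bnorm_eq0_small => e e0; have [n wn] := wl (e / 2) ltac:(lra).
    have [_ sw _] := wD n.
    rewrite (_ : star l - l = - star (w n - l) + (w n - l)); last first.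
      by rewrite starD starN sw; lmod_ring.
    by rewrite (le_trans (bnormD _ _)) // bnormN bnorm_star; lra.
  move=> y yx; apply/subr0_eq/bnorm_eq0_small => e e0.
  have y0 := bnorm_ge0 y.
  have [n wn] := wl (e / 2 / (bnorm y + 1)) ltac:(by rewrite !divr_gt0 //; lra).
  have [_ _ /(_ y yx) cw] := wD n.
  rewrite (_ : y * l - l * y = (w n - l) * y - y * (w n - l)); last first.
    by rewrite mulrBl mulrBr cw; lmod_ring.
  have b1 := bnormM_le wn (lexx (bnorm y)); have b2 := bnormM_le (lexx (bnorm y)) wn.
  rewrite (le_trans (bnormB _ _)) //.
  have : e / 2 / (bnorm y + 1) * bnorm y <= e / 2.
    rewrite mulrAC ler_pdivrMr; last by lra.
    by apply: ler_wpM2l; lra.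
  by lra.
- by [].
- by [].
- move=> s t [sq _ _] [tq _ _].
  rewrite -scalerBr hn (_ : _ - _ = s * (s - t) + (s - t) * t); last by nc_ring.
  have b1 := bnormM_le sq (lexx (bnorm (s - t))).
  have b2 := bnormM_le (lexx (bnorm (s - t))) tq.
  have := bnormD (s * (s - t)) ((s - t) * t).
  by lra.
exists (1 - s); split.
- by rewrite /selfadj starD starN ss star1.
- have e : s + s = x + s * s.
    by rewrite -{1 2}sE -scalerDl hh scale1r.
  have -> : (1 - s) * (1 - s) = 1 - (s + s) + s * s by nc_ring.
  by rewrite e; lmod_ring.
by move=> y yx; rewrite mulrBr mulrBl mulr1 mul1r sc.
Qed.

End CStar.

Section Spectrum.
Context {R : realType} {A : cstarAlgType R}.
Implicit Types a b c u v x y : A.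

Lemma selfadj1 : selfadj (1 : A). Proof. exact: star1. Qed.
Lemma selfadjD a b : selfadj a -> selfadj b -> selfadj (a + b).
Proof. by rewrite /selfadj starD => -> ->. Qed.
Lemma selfadjN a : selfadj a -> selfadj (- a).
Proof. by rewrite /selfadj starN => ->. Qed.
Lemma selfadjZ (r : R) a : selfadj a -> selfadj (r%:C%C *: a).
Proof. by rewrite /selfadj starZr => ->. Qed.
Lemma selfadjM a b : selfadj a -> selfadj b -> a * b = b * a -> selfadj (a * b).
Proof. by rewrite /selfadj starM => -> -> ->. Qed.

Lemma selfadj_sqr_scaled (r : R) a x : 0 <= r -> selfadj a -> selfadj x ->
  bnorm x < 1 -> a * x = x * a ->
  exists b, [/\ selfadj b, b * b = r%:C%C *: (a * a * (1 - x)) &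
    forall y, y * a = a * y -> y * x = x * y -> y * b = b * y].
Proof.
move=> r0 sa sx x1 ax; have [f [sf ff fc]] := sqrt_one_minus sx x1.
have af : a * f = f * a by apply: fc.
exists ((Num.sqrt r)%:C%C *: (a * f)); split.
- by apply: selfadjZ; apply: selfadjM.
- rewrite -scalerAl -scalerAr scalerA -rmorphM /= -expr2 sqr_sqrtr //.
  by congr (_ *: _); rewrite -ff -[LHS]mulrA [f * (a * f)]mulrA -af !mulrA.
move=> y ya yx; rewrite -scalerAr -scalerAl; congr (_ *: _).
by rewrite mulrA ya -mulrA (fc y yx) mulrA.
Qed.

(** The norm of a selfadjoint element is attained on its spectrum.  Let p = c^2
    and d = 1 - p.  If d were invertible, d^2 - eta would be a square k^2 for some
    eta > 0.  Then 1 - d^2 = p (2 - p) is a square m^2 with m^2 + k^2 = 1 - eta, so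
    |m|^2 <= 1 - eta.  But m^2 - t p is also a square for t < 1, so t <= |m|^2. *)
Lemma norm_in_spectrum c : selfadj c -> bnorm c = 1 -> ~ bunit (1 - c * c).
Proof.
move=> sc c1; set p := c * c; set d := 1 - p => du.
have sp : selfadj p by apply: selfadjM.
have sd : selfadj d by apply: selfadjD; [exact: selfadj1|exact: selfadjN].
have p1 : bnorm p = 1.
  by have := bnorm_star_mul c; rewrite sc c1 expr1n.
have cp : c * p = p * c by rewrite mulrA.
set e := binv d; have de : d * e = 1 := mulrbV du; have ed : e * d = 1 := mulbVr du.
have se : selfadj e.
  have h : star e * d = 1 by have := congr1 star de; rewrite starM sd star1.
  by rewrite /selfadj -[LHS]mulr1 -de mulrA h mul1r.
pose be := bnorm e + 1; have be1 : 1 <= be by rewrite /be; have := bnorm_ge0 e; lra.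
pose eta := (be ^+ 2)^-1; have eta0 : 0 < eta by rewrite invr_gt0 exprn_gt0; lra.
have eta1 : eta <= 1 by rewrite invf_le1 ?exprn_ege1 ?exprn_gt0; lra.
pose x := eta%:C%C *: (e * e).
have sx : selfadj x by apply: selfadjZ; apply: selfadjM.
have x1 : bnorm x < 1.
  rewrite bnormZr gtr0_norm // mulrC -ltr_pdivlMr // div1r invrK.
  apply: (le_lt_trans (bnormM _ _)); rewrite -expr2 ltr_sqr ?nnegrE ?bnorm_ge0 ?addr_ge0 ?bnorm_ge0 //.
  by rewrite /be; lra.
have dx : d * x = x * d.
  by rewrite -scalerAr -scalerAl mulrA de mul1r -mulrA ed mulr1.
have [k [sk kk kc]] := selfadj_sqr_scaled (r := 1) ler01 sd sx x1 dx.
have kkE : k * k = d * d - eta%:C%C *: 1.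
  rewrite kk scale1r mulrBr mulr1 -scalerAr; congr (_ - _ *: _).
  by rewrite -mulrA (mulrA d e) de mul1r de.
have comc_d : c * d = d * c by rewrite mulrBr mulrBl mulr1 mul1r cp.
have comc_e : c * e = e * c.
  by rewrite -[LHS]mul1r -ed -mulrA (mulrA d) -comc_d -!mulrA de mulr1.
have comc_k : c * k = k * c.
  apply: kc => //; rewrite -scalerAr -scalerAl mulrA comc_e -mulrA comc_e mulrA.
  by [].
have half_p : bnorm ((1 / 2 : R)%:C%C *: p) < 1.
  by rewrite bnormZr p1 ger0_norm //; lra.
have chp (r : R) : c * (r%:C%C *: p) = r%:C%C *: p * c by rewrite -scalerAr -scalerAl cp.
have [m [sm mm mc]] := selfadj_sqr_scaled (r := 2) ltac:(by []) sc
  (selfadjZ (1 / 2) sp) half_p (chp _).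
have mmE : m * m = 1 - d * d.
  rewrite mm -/p mulrBr mulr1 scalerBr -scalerAr scalerA -rmorphM /=.
  rewrite (_ : 2 * (1 / 2) = 1); last by field.
  rewrite rmorph1 scale1r rmorph_nat scaler_nat mulr2n /d; nc_ring.
have mk : m * k = k * m.
  apply/esym/mc; first by rewrite comc_k.
  by rewrite -scalerAr -scalerAl mulrA -comc_k -!mulrA comc_k.
have b1 : bnorm m ^+ 2 <= 1 - eta.
  have := bnorm_sum_squares sm sk mk; rewrite mmE kkE.
  rewrite (_ : _ + _ = (1 - eta)%:C%C *: 1); last first.
    by rewrite rmorphB rmorph1 scalerBl scale1r; lmod_ring.
  by rewrite bnormZr bnorm1 mulr1 ger0_norm //; lra.
pose t := 1 - eta / 2; have t0 : 0 < t by rewrite /t; lra.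
have t2 : 0 < 2 - t by rewrite /t; lra.
have tp : bnorm ((2 - t)^-1%:C%C *: p) < 1.
  by rewrite bnormZr p1 mulr1 gtr0_norm ?invr_gt0 // invf_lt1 // /t; lra.
have [j [sj jj jc]] := selfadj_sqr_scaled (ltW t2) sc
  (selfadjZ (2 - t)^-1 sp) tp (chp _).
pose n := (Num.sqrt t)%:C%C *: c.
have nn : n * n = t%:C%C *: p.
  by rewrite -scalerAl -scalerAr scalerA -rmorphM /= -expr2 sqr_sqrtr // ltW.
have sum : n * n + j * j = m * m.
  rewrite mmE nn jj -/p mulrBr mulr1 scalerBr -scalerAr scalerA -rmorphM /=.
  have C2 : (2 - t)%:C%C = 2%:R - t%:C%C :> R[i] by rewrite rmorphB rmorph_nat.
  rewrite mulfV ?gt_eqF // rmorph1 scale1r C2 scalerBl scaler_nat mulr2n /d.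
  by nc_ring.
have nj : n * j = j * n.
  rewrite -scalerAl -scalerAr; congr (_ *: _); apply: jc => //; exact: chp.
have := bnorm_sum_squares (selfadjZ _ sc) sj nj.
rewrite sum bnormZr c1 mulr1 ger0_norm ?sqrtr_ge0 // sqr_sqrtr; last exact: ltW.
have := bnorm_star_mul m; rewrite sm => ->.
by rewrite /t; lra.
Qed.

Lemma selfadj_norm_le c (r : R) : selfadj c -> 0 <= r ->
  (forall s : R, r < s -> bunit (s%:C%C%:A - c) /\ bunit (s%:C%C%:A + c)) -> bnorm c <= r.
Proof.
move=> sc r0 cu; rewrite leNgt; apply/negP => rc.
set N := bnorm c in rc; have N0 : 0 < N by lra.
have [u1 u2] := cu N rc.
have iN : N^-1%:C%C * N%:C%C = 1 :> R[i] by rewrite -rmorphM /= mulVf ?gt_eqF // rmorph1.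
apply: (@norm_in_spectrum (N^-1%:C%C *: c)); first exact: selfadjZ.
  by rewrite bnormZr gtr0_norm ?invr_gt0 // mulVf // gt_eqF.
have -> : 1 - N^-1%:C%C *: c * (N^-1%:C%C *: c) =
  (N^-1%:C%C *: (N%:C%C%:A - c)) * (N^-1%:C%C *: (N%:C%C%:A + c)).
  rewrite !(scalerBr, scalerDr) !scalerA iN scale1r.
  by nc_ring.
have k0 : N^-1%:C%C != 0 :> R[i].
  by apply/eqP => /(congr1 (@complex.Re R)) /= /eqP; rewrite invr_eq0 gt_eqF.
by apply: bunitM; apply: bunit_scale.
Qed.

(** By the C*-identity |b + i s|^2 <= |b|^2 + s^2, which is less than
    (s + Im l)^2 when s is large with the sign of Im l. *)
Lemma selfadj_nonreal a (l : R[i]) : selfadj a -> complex.Im l != 0 -> bunit (a - l%:A).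
Proof.
case: l => al tau sa /= tau0.
pose b := a - al%:C%C%:A; have sb : selfadj b.
  by apply: selfadjD => //; apply: selfadjN; apply: selfadjZ; exact: selfadj1.
pose s := (bnorm b ^+ 2 + 1) / (2 * tau).
have stau : 2 * s * tau = bnorm b ^+ 2 + 1 by rewrite /s; field.
pose w := b + 'i%C *: (s%:C%C%:A).
have wb : bnorm w ^+ 2 <= bnorm b ^+ 2 + s ^+ 2.
  rewrite -bnorm_star_mul /w starD sb starZi starZr star1.
  have -> : (b - 'i%C *: s%:C%C%:A) * (b + 'i%C *: s%:C%C%:A) = b * b + (s ^+ 2)%:C%C%:A.
    rewrite scalerA; set k := 'i%C * s%:C%C.
    have kk : k * k = - (s ^+ 2)%:C%C.
      by rewrite /k mulrACA -expr2 sqr_i mulN1r -rmorphM -expr2.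
    rewrite mulrDl !mulrDr !mulNr !mulr_algl !mulr_algr scalerA kk.
    by lmod_ring.
  apply: (le_trans (bnormD _ _)); rewrite bnormZr bnorm1 mulr1 ger0_norm ?sqr_ge0 //.
  by rewrite lerD2r expr2 bnormM.
pose q := s + tau.
have qq : q ^+ 2 = s ^+ 2 + 2 * s * tau + tau ^+ 2 by rewrite /q; ring.
have sq_b := sqr_ge0 (bnorm b); have sq_s := sqr_ge0 s; have sq_t := sqr_ge0 tau.
have q0 : q != 0.
  by apply/eqP => q0; move: qq; rewrite stau q0 expr0n /=; lra.
have lt : bnorm w < `|q|.
  rewrite -ltr_sqr ?nnegrE ?bnorm_ge0 // real_normK ?num_real // qq stau.
  by apply: (le_lt_trans wb); lra.
pose k : R[i] := 'i%C * q%:C%C.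
have qC0 : q%:C%C != 0 :> R[i].
  by apply/eqP => /(congr1 (@complex.Re R)) /= /eqP; rewrite (negPf q0).
have k0 : k != 0 by rewrite mulf_neq0 // complexiE neq0Ci.
have -> : a - (al +i* tau)%C%:A = - k *: (1 - - ('i%C *: (q^-1%:C%C *: w))).
  have iq : k * q^-1%:C%C = 'i%C by rewrite /k -mulrA -rmorphM /= mulfV // rmorph1 mulr1.
  have -> : - k *: (1 - - ('i%C *: (q^-1%:C%C *: w))) = w - k *: 1.
    rewrite opprK scalerDr scaleNr addrC; congr (_ - _).
    rewrite scaleNr !scalerA mulrA (mulrC k) -mulrA iq -expr2 sqr_i scaleN1r opprK.
    by [].
  have -> : (al +i* tau)%C = al%:C%C + 'i%C * tau%:C%C :> R[i] by simpc.
  by rewrite /w /b /k /q rmorphD /= mulrDr !scalerDl -!scalerA; lmod_ring.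
apply: bunit_scale; first by rewrite oppr_eq0.
apply: neumann; rewrite bnormN bnormZi bnormZr normfV mulrC ltr_pdivrMr ?mul1r //.
by rewrite normr_gt0.
Qed.

End Spectrum.

(** * Boundedness of completely positive maps *)

Section Positivity.
Context {R : realType} {A : cstarAlgType R}.

Definition positive_elt (a : A) := selfadj a /\ forall l : R[i], ~~ (0 <= l) -> bunit (a - l%:A).

Lemma pos_mx (a : A) : positive_mx (a%:M : 'M[A]_1) <-> positive_elt a.
Proof.
have inv1 (b : A) : mx_invertible (b%:M : 'M[A]_1) <-> bunit b.
  split=> [[N [bN Nb]]|[c [bc cb]]]; last first.
    by exists c%:M; rewrite -!scalar_mxM bc cb.
  exists (N 0 0); split.
    by have := congr1 (fun M : 'M[A]_1 => M 0 0) bN; rewrite !mxE big_ord1 !mxE.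
  by have := congr1 (fun M : 'M[A]_1 => M 0 0) Nb; rewrite !mxE big_ord1 !mxE.
have sub (l : R[i]) : (a%:M : 'M[A]_1) - (l%:A)%:M = (a - l%:A)%:M by rewrite raddfB.
split=> [[sa inv]|[sa inv]].
  split; last by move=> l /inv; rewrite sub => /inv1.
  by have := congr1 (fun M : 'M[A]_1 => M 0 0) sa; rewrite !mxE.
split; last by move=> l /inv ?; rewrite sub; apply/inv1.
by apply/matrixP => i j; rewrite !ord1 !mxE /= sa.
Qed.

Lemma pos_norm_minus (a : A) : selfadj a -> positive_elt ((bnorm a)%:C%C%:A - a).
Proof.
move=> sa; have sb : selfadj ((bnorm a)%:C%C%:A - a).
  by apply: selfadjD; [apply: selfadjZ; exact: selfadj1|exact: selfadjN].
split=> // l l0.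
have [im0|] := eqVneq (complex.Im l) 0; last exact: selfadj_nonreal.
case: l im0 l0 => r i /= ->; rewrite lecE /= eqxx /= -ltNge => r0.
have -> : (r +i* 0)%C = r%:C%C by [].
pose n := bnorm a - r; have a0 := bnorm_ge0 a.
have n0 : 0 < n by rewrite /n; lra.
have iN : n%:C%C * n^-1%:C%C = 1 :> R[i] by rewrite -rmorphM /= mulfV ?gt_eqF // rmorph1.
have -> : (bnorm a)%:C%C%:A - a - r%:C%C%:A = n%:C%C *: (1 - n^-1%:C%C *: a).
  by rewrite scalerBr scalerA iN scale1r /n rmorphB /= scalerBl; lmod_ring.
apply: bunit_scale.
  by apply/eqP => /(congr1 (@complex.Re R)) /= /eqP; rewrite gt_eqF.
by apply: neumann; rewrite bnormZr gtr0_norm ?invr_gt0 // mulrC ltr_pdivrMr // mul1r /n; lra.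
Qed.

End Positivity.

(** For selfadjoint a, both |a| - E a and |a| + E a are positive, which confines
    the spectrum of E a to [-|a|, |a|], hence also its norm. *)
Lemma completely_positive_bounded {R : realType} {A B : cstarAlgType R}
    (E : {linear A -> B}) : completely_positive E -> E 1 = 1 ->
  forall a, bnorm (E a) <= 2 * bnorm a.
Proof.
move=> cp E1.
have Epos a : positive_elt a -> positive_elt (E a).
  move=> /pos_mx /cp; have -> : map_mx E (a%:M : 'M[A]_1) = (E a)%:M; last by move/pos_mx.
  by apply/matrixP => i j; rewrite !ord1 !mxE.
have Esc (k : R[i]) : E (k%:A) = k%:A by rewrite linearZ /= E1.
have Esa a : selfadj a -> bnorm (E a) <= bnorm a.
  move=> sa; have [s1 inv1] := Epos _ (pos_norm_minus sa).
  have [_ inv2] := Epos _ (pos_norm_minus (selfadjN sa)).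
  rewrite linearB /= Esc in s1 inv1; rewrite bnormN linearB linearN /= Esc opprK in inv2.
  have sE : selfadj (E a).
    have -> : E a = (bnorm a)%:C%C%:A - ((bnorm a)%:C%C%:A - E a) by lmod_ring.
    by apply: selfadjD; [apply: selfadjZ; exact: selfadj1|exact: selfadjN].
  apply: selfadj_norm_le => //; first exact: bnorm_ge0.
  move=> s ls; have neg : ~~ (0 <= (bnorm a - s)%:C%C :> R[i]) by rewrite ler0c -ltNge; lra.
  have u1 := inv1 _ neg; have u2 := inv2 _ neg.
  rewrite rmorphB /= in u1 u2; split.
    by rewrite (_ : _ - E a = (bnorm a)%:C%C%:A - E a - ((bnorm a)%:C%C - s%:C%C)%:A) //; lmod_ring.
  by rewrite (_ : _ + E a = (bnorm a)%:C%C%:A + E a - ((bnorm a)%:C%C - s%:C%C)%:A) //; lmod_ring.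
move=> a; pose h := (1 / 2 : R)%:C%C.
pose u := h *: (a + star a); pose v := h *: ('i%C *: (star a - a)).
have hh : h + h = 1 :> R[i].
  by rewrite -rmorphD /= (_ : 1 / 2 + 1 / 2 = 1) //; field.
have su : selfadj u by rewrite /u; apply: selfadjZ; rewrite /selfadj starD starK addrC.
have sv : selfadj v.
  by apply: selfadjZ; rewrite /selfadj starZi starD starN starK -scalerN opprB.
have aE : a = u + 'i%C *: v.
  rewrite /u /v !scalerA mulrAC -expr2 sqr_i mulN1r.
  by rewrite -[LHS]scale1r -hh; lmod_ring.
have hn b : bnorm (h *: b : A) = 1 / 2 * bnorm b by rewrite bnormZr ger0_norm.
have ub : bnorm u <= bnorm a.
  by rewrite hn; have := bnormD a (star a); rewrite bnorm_star; lra.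
have vb : bnorm v <= bnorm a.
  by rewrite hn bnormZi; have := bnormB (star a) a; rewrite bnorm_star; lra.
clearbody u v; rewrite {1}aE linearD linearZ /=.
have := bnormD (E u) ('i%C *: E v); rewrite bnormZi.
by have := Esa u su; have := Esa v sv; lra.
Qed.

(** * Uniqueness of analytic extensions *)

Section Bridge.
Context {R : realType} {B : cstarAlgType R}.

Lemma near0_rnorm (P : B -> Prop) :
  (\forall w \near (0 : B), P w) <-> exists2 r : R, 0 < r & forall w : B, bnorm w < r -> P w.
Proof.
split=> [/nbhs_ballP[e /= /posC[eE e0] eP]|[r r0 rP]].
  exists (complex.Re e) => // w wr; apply: eP.
  rewrite -ball_normE /ball_ /= sub0r normrN eE.
  by rewrite [`|w|](rnormE w) ltcR.
apply/nbhs_ballP; exists r%:C%C; first by rewrite /= ltcR.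
move=> w; rewrite -ball_normE /ball_ /= sub0r normrN [`|w|](rnormE w) ltcR.
exact: rP.
Qed.

Lemma differentiable_expansion (f : B -> B) x : differentiable f x ->
  forall e : R, 0 < e -> exists2 d : R, 0 < d & forall h : B, bnorm h <= d ->
     bnorm (f (x + h) - f x - 'd f x h) <= e * bnorm h.
Proof.
move=> /diff_locally/eqaddoP df e e0.
have := df e%:C%C; rewrite /= ltcR => /(_ e0) /near0_rnorm[r r0 rP].
exists (r / 2); first by lra.
move=> h hr; have := rP h ltac:(lra).
rewrite !fctE /= [`|h|](rnormE h) [`|_ - _|](rnormE _) -rmorphM /= lecR.
by rewrite (_ : f (h + x) - (f x + 'd f x h) = f (x + h) - f x - 'd f x h) // [h + x]addrC opprD addrA.
Qed.

Lemma frechet_differentiable (f : B -> B) x L : frechet f x L ->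
  differentiable f x /\ 'd f x = L :> (B -> B).
Proof.
move=> [Ll [K K0 LK] fD].
pose l : {linear B -> B} := HB.pack L (GRing.isLinear.Build R[i] B B *:%R L Ll).
have lc : continuous l.
  move=> y; apply/cvgrPdist_le => e /posC[-> e0].
  apply/nbhs_ballP; exists ((complex.Re e) / (K + 1))%:C%C.
    by rewrite /= ltcR divr_gt0 //; lra.
  move=> t; rewrite -ball_normE /ball_ /= [`|_ - _|](rnormE _) ltcR => yt.
  rewrite -[L y - L t](linearB l) [`|_|](rnormE _) lecR.
  apply: (le_trans (LK _)).
  move: yt; rewrite ltr_pdivlMr; last by lra.
  have := bnorm_ge0 (y - t).
  rewrite -[rnorm (y - t)]/(bnorm (y - t)).
  by lra.
have lo : f \o shift x = cst (f x) + l +o_ 0 id.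
  apply/eqaddoP => e /posC[-> e0].
  apply/near0_rnorm; have [d d0 fd] := fD _ e0; exists d => // h hd.
  rewrite !fctE /= [`|h|](rnormE h) [`|_ - _|](rnormE _) -rmorphM /= lecR.
  have := fd h (ltW hd).
  by rewrite (_ : f (h + x) - (f x + L h) = f (x + h) - f x - L h) // [h + x]addrC opprD addrA.
have dE : 'd f x = l :> (B -> B) by apply: diff_unique.
split=> //; apply/diff_locallyP.
by rewrite dE.
Qed.

Lemma bunit_unit (a : B) : bunit a <-> a \is a GRing.unit.
Proof.
split=> [[b [ab ba]]|/unitrP[b [ba ab]]]; last by exists b.
by apply/unitrP; exists b.
Qed.

Lemma binvE (a : B) : bunit a -> binv a = a^-1.
Proof. by move=> /bunit_unit au; apply: binv_uniq; [exact: divrr|exact: mulVr]. Qed.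

Lemma rnormCM (k l : R[i]) : rnorm (k * l) = rnorm k * rnorm l.
Proof.
have nC (m : R[i]) : (rnorm m)%:C%C = `|m| by rewrite /rnorm RRe_real // ger0_real.
by apply: complexI; rewrite rmorphM /= !nC normrM.
Qed.

Lemma scalar_shift_unit (w : B) (l : R[i]) : bnorm w < rnorm l -> w + l%:A \is a GRing.unit.
Proof.
move=> wl; have l0 : l != 0.
  by apply/eqP => l0; move: wl; rewrite l0 /rnorm normr0 /=; have := bnorm_ge0 w; lra.
have -> : w + l%:A = l *: (1 - - (l^-1 *: w)).
  by rewrite opprK scalerDr scalerA mulfV // scale1r addrC.
apply/bunit_unit; apply: bunit_scale => //; apply: neumann.
have lp : 0 < rnorm l by apply: le_lt_trans wl; exact: bnorm_ge0.
have -> : bnorm (- (l^-1 *: w)) = (rnorm l)^-1 * bnorm w.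
  rewrite bnormN bnormZ; congr (_ * _).
  apply: (mulfI (x := rnorm l)); first by rewrite gt_eqF.
  by rewrite mulfV ?gt_eqF // -rnormCM mulfV // /rnorm normr1.
by rewrite mulrC ltr_pdivrMr // mul1r.
Qed.

End Bridge.

(** Fix a small w.  The difference of the two functions at w + l, for small
    complex l, is holomorphic in l and vanishes for |l| > |w|, where w + l is
    invertible.  Extended by 0 it has compact support, hence is zero at l = 0. *)
Lemma analytic_unique {R : realType} {B : cstarAlgType R} (h1 h2 : B -> B) :
  (\forall w \near (0 : B), differentiable h1 w) ->
  (\forall w \near (0 : B), differentiable h2 w) ->
  (\forall w \near (0 : B), w \is a GRing.unit -> h1 w = h2 w) ->
  \forall w \near (0 : B), h1 w = h2 w.
Proof.
move=> /near0_rnorm[r1 r10 d1] /near0_rnorm[r2 r20 d2] /near0_rnorm[r3 r30 eq12].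
pose r := Num.min (Num.min r1 r2) r3.
have r0 : 0 < r by rewrite !lt_min r10 r20.
have {}d1 (w : B) : bnorm w < r -> differentiable h1 w.
  by rewrite !lt_min => /andP[/andP[w1 _] _]; apply: d1.
have {}d2 (w : B) : bnorm w < r -> differentiable h2 w.
  by rewrite !lt_min => /andP[/andP[_ w1] _]; apply: d2.
have {}eq12 (w : B) : bnorm w < r -> w \is a GRing.unit -> h1 w = h2 w.
  by rewrite !lt_min => /andP[_ w1]; apply: eq12.
clearbody r.
apply/near0_rnorm; exists (r / 8); first by lra.
move=> w wr; apply/subr0_eq.
pose c := r / 4; pose L := 2 * c.
pose lam (x y : R) : R[i] := (x - c)%:C%C + 'i%C * (y - c)%:C%C.
pose v x y : B := w + (lam x y)%:A.
pose box (x y : R) := (0 < x < L) && (0 < y < L).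
pose k x y : B := if box x y then h1 (v x y) - h2 (v x y) else 0.
have lam_le (a b : R) : rnorm (a%:C%C + 'i%C * b%:C%C : R[i]) <= `|a| + `|b|.
  apply: (le_trans (rnormD (V := R[i]^o) _ _)); rewrite rnorm_real lerD2l.
  by rewrite rnormCM rnorm_i rnorm_real mul1r.
have lam_ge (a b : R) : `|a| <= rnorm (a%:C%C + 'i%C * b%:C%C : R[i]) /\
    `|b| <= rnorm (a%:C%C + 'i%C * b%:C%C : R[i]).
  have -> : a%:C%C + 'i%C * b%:C%C = (a +i* b)%C :> R[i] by simpc.
  rewrite /rnorm normc_def /= -!sqrtr_sqr !ler_sqrt ?addr_ge0 ?sqr_ge0 //.
  by have := sqr_ge0 a; have := sqr_ge0 b; split; lra.
have vr x y : box x y -> bnorm (v x y) < r.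
  move=> bxy; apply: (le_lt_trans (bnormD _ _)); rewrite bnormZ bnorm1 mulr1.
  have := lam_le (x - c) (y - c); rewrite -/(lam x y).
  have : `|x - c| <= c by rewrite ler_norml; move: bxy; rewrite /box /L; lra.
  have : `|y - c| <= c by rewrite ler_norml; move: bxy; rewrite /box /L; lra.
  by move: wr; rewrite /c; lra.
have kcc : k c c = h1 w - h2 w.
  have -> : w = v c c.
    by rewrite /v /lam !subrr mulr0 addr0 scale0r addr0.
  by rewrite /k (_ : box c c) // /box /L /c; lra.
rewrite -kcc; apply: (@compact_support_holomorphic_eq0 R (cs_space B) k L); last first.
  by move=> x y; rewrite /k /box => /negPf ->.
move=> x y; case bxy: (box x y); last first.
  exists 0 => e e0; exists (c / 4); first by rewrite /c; lra.
  move=> a b ax bY; rewrite scaler0 subr0.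
  have kz a' b' : `|a' - x| <= c / 4 -> `|b' - y| <= c / 4 -> k a' b' = 0.
    move=> ax' by'; rewrite /k; case bab: (box a' b') => //.
    apply/eqP; rewrite subr_eq0; apply/eqP/eq12; first exact: vr.
    apply: scalar_shift_unit; rewrite /lam.
    have [l1 l2] := lam_ge (a' - c) (b' - c).
    apply: (lt_le_trans wr); rewrite leNgt; apply/negP => small.
    move: bxy; rewrite (_ : box x y = true) //; apply/andP.
    have : `|a' - c| < c / 2 by apply: (le_lt_trans l1); rewrite /c; lra.
    have : `|b' - c| < c / 2 by apply: (le_lt_trans l2); rewrite /c; lra.
    by move: ax' by'; rewrite /L !ler_norml !ltr_norml; lra.
  rewrite !kz // ?subrr ?normr0; try (rewrite /c; lra).
  by rewrite [rnorm _]rnorm0 mulr_ge0 ?addr_ge0 // ltW.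
pose u := v x y; have ur : bnorm u < r := vr x y bxy.
have := differentiable_expansion (d2 u ur); have := differentiable_expansion (d1 u ur).
move: ('d h1 u) ('d h2 u) => D1 D2 hD1 hD2.
exists (D1 1 - D2 1) => e e0.
have [e1 e10 he1] := hD1 (e / 2) ltac:(lra).
have [e2 e20 he2] := hD2 (e / 2) ltac:(lra).
pose dx := Num.min x (L - x); pose dy := Num.min y (L - y).
have /andP[/andP[x0 xL] /andP[y0 yL]] := bxy.
exists (Num.min (Num.min (e1 / 2) (e2 / 2)) (Num.min (dx / 2) (dy / 2))).
  rewrite !lt_min !divr_gt0 // /dx /dy lt_min ?x0 ?y0 subr_gt0 //.
move=> a b; rewrite !le_min !ler_pdivlMr //.
move=> /andP[/andP[a1 a2] /andP[a3 a4]] /andP[/andP[b1 b2] /andP[b3 b4]].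
have bab : box a b.
  move: a3 b4; rewrite /dx /dy !le_min => /andP[c1 c2] /andP[c3 c4].
  have := ler_norm (a - x); have := ler_norm (b - y).
  have := ler_normr (a - x) (x - a); rewrite distrC.
  have := ler_norm (x - a); have := ler_norm (y - b); rewrite (distrC x) (distrC y).
  by rewrite /box; lra.
pose mu : R[i] := (a - x)%:C%C + 'i%C * (b - y)%:C%C.
have muE : v a b = u + mu%:A.
  rewrite /u /v /mu /lam -addrA -scalerDl; congr (_ + _ *: _).
  by rewrite !rmorphB /=; ring.
have mub : bnorm (mu%:A : B) <= `|a - x| + `|b - y|.
  by rewrite bnormZ bnorm1 mulr1; apply: lam_le.
rewrite /k bab bxy muE -/mu.
rewrite (_ : _ - _ = (h1 (u + mu%:A) - h1 u - D1 mu%:A)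
                   - (h2 (u + mu%:A) - h2 u - D2 mu%:A)); last first.
  by rewrite !linearZ /=; lmod_ring.
have m1 : bnorm (mu%:A : B) <= e1 by apply: (le_trans mub); lra_from a1 b1.
have m2 : bnorm (mu%:A : B) <= e2 by apply: (le_trans mub); lra_from a2 b2.
have g1 := he1 _ m1; have g2 := he2 _ m2.
apply: (le_trans (bnormB _ _)).
have g3 : e * bnorm (mu%:A : B) <= e * (`|a - x| + `|b - y|) by rewrite ler_pM2l.
by lra_from g1 g2 g3.
Qed.

(** * The transforms near 0 *)

Section Germs.
Context {R : realType} {B : cstarAlgType R}.

Lemma analytic_extension_germ (f h : B -> B) (r : R) : 0 < r ->
  (forall w : B, bnorm w < r -> exists L, frechet h w L) ->
  (forall w : B, bnorm w < r -> w \is a GRing.unit -> h w = f w) ->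
  exists2 r' : R, 0 < r' & forall w : B, bnorm w < r' -> analytic_extension f w = h w.
Proof.
move=> r0 hD hf.
have hext : is_analytic_extension f h.
  split; apply/near0_rnorm; exists r => //.
  by move=> w /hD[L /frechet_differentiable[]].
rewrite /analytic_extension; case: xgetP => [g _ [gD gf]|none]; last by case: (none h).
apply/near0_rnorm; apply: analytic_unique => //; first by have [] := hext.
have [_ /near0_rnorm[r1 r10 e1]] := hext; move/near0_rnorm: gf => [r2 r20 e2].
apply/near0_rnorm; exists (Num.min r1 r2); first by rewrite lt_min r10.
by move=> w; rewrite lt_min => /andP[w1 w2] wu; rewrite e2 // e1.
Qed.

End Germs.

Section Transfer.
Context {R : realType} {A B : cstarAlgType R}.
Variables (iota : {lrmorphism B -> A}) (E E' : {linear A -> B}).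
Hypothesis HE : ncps iota E.
Variable z : A.
Variables (chi s : B -> B) (dchi : B -> B -> B) (r0 r1 C : R).
Hypothesis g : S_germ iota E z chi s dchi r0 r1 C.

Let psiE (b : B) : bnorm b <= r0 -> psi iota E z b = moment iota E z b.
Proof. by move=> br; rewrite /psi /moment /resolvent binvE //; exact: sg_res g _ br. Qed.

Let dpsiE (b : B) : bnorm b <= r0 -> dpsi iota E' z b = dmoment iota E' z b.
Proof. by move=> br; rewrite /dpsi /dmoment /resolvent binvE //; exact: sg_res g _ br. Qed.

Let chi0 : chi 0 = 0.
Proof.
apply: bnorm_eq0; apply: le_anti; rewrite bnorm_ge0 andbT.
have /andP[r10 _] := sg_r1 g.
by have := sg_chi_small g (w := 0); rewrite bnorm0 mulr0; apply; exact: ltW.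
Qed.

Lemma chi_local_inverse : is_local_inverse (psi iota E z) chi.
Proof.
have /andP[r10 r12] := sg_r1 g; have r00 := sg_r0 g.
split; first exact: chi0.
- have D := sg_chiD g (w := 0) ltac:(by rewrite bnorm0).
  by have [D' _] := frechet_differentiable D; apply: differentiable_continuous.
- apply/near0_rnorm; exists r1 => // w /ltW wr.
  by rewrite psiE ?(sg_moment_chi g) //; exact: sg_chi_r0 g _ wr.
have u0 := sg_res g (b := 0) ltac:(by rewrite bnorm0 ltW).
have [K K0 [d d0 lip]] := frechet_lip (theta_frechet HE u0).
pose M := bnorm (theta iota E z 0) + K * d + 1.
have M1 : 1 <= M by rewrite /M; have := mulr_ge0 K0 (ltW d0); have := bnorm_ge0 (theta iota E z 0); lra.
apply/near0_rnorm; exists (Num.min (Num.min r0 d) (r1 / M)).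
  by rewrite !lt_min r00 d0 divr_gt0 //; lra.
move=> b; rewrite !lt_min => /andP[/andP[b1 b2]]; rewrite ltr_pdivlMr; last by lra.
move=> b3; rewrite psiE; last exact: ltW.
apply: (sg_chi_moment g); first exact: ltW.
rewrite (sg_momentE g (ltW b1)); apply: le_trans (ltW b3).
apply: bnormM_le => //.
have := lip b (ltW b2); rewrite add0r => l.
have := bnormD (theta iota E z b - theta iota E z 0) (theta iota E z 0); rewrite subrK.
have : K * bnorm b <= K * d by apply: ler_wpM2l => //; exact: ltW.
by rewrite /M; lra.
Qed.

(** A local inverse is small near 0 by continuity, and psi is injective there. *)
Lemma psi_inv_germ : exists2 r : R, 0 < r & forall w : B, bnorm w < r -> psi_inv iota E z w = chi w.
Proof.
have /andP[r10 r12] := sg_r1 g; have r00 := sg_r0 g.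
apply/near0_rnorm; rewrite /psi_inv /local_inverse.
case: xgetP => [f _ [f0 fc /near0_rnorm[e e0 fP] _]|none]; last by case: (none chi chi_local_inverse).
have small : \forall w \near (0 : B), bnorm (f w) < r0.
  move: fc => /cvgrPdist_lt /(_ r0%:C%C); rewrite ltcR f0 => /(_ r00).
  by apply: filterS => w; rewrite sub0r normrN [`|_|](rnormE _) ltcR.
move/near0_rnorm: small => [e' e'0 small].
apply/near0_rnorm; exists (Num.min (Num.min e e') r1); first by rewrite !lt_min e0 e'0.
move=> w; rewrite !lt_min => /andP[/andP[w1 w2] w3].
have fr := ltW (small w w2).
have m := fP w w1; rewrite psiE // in m.
by have := sg_chi_moment g fr; rewrite m => ->//; exact: ltW.
Qed.

Lemma rho_cancel (w v : B) : bnorm w <= r1 -> w \is a GRing.unit ->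
  w^-1 * (1 + w) * (rho w * v) = v.
Proof.
have /andP[r10 r12] := sg_r1 g; move=> wr wu.
have [u _] := bunit_1D (w := w) ltac:(lra).
rewrite /rho !mulrA -(mulrA w^-1) mulrbV // mulr1 mulVr // mul1r.
by [].
Qed.

Lemma S_transform_germ : exists2 r : R, 0 < r & forall w : B, bnorm w < r ->
  S_transform iota E z w = s w.
Proof.
have /andP[r10 r12] := sg_r1 g.
have [r rp psiP] := psi_inv_germ.
apply: (@analytic_extension_germ R B _ s (Num.min r r1)); first by rewrite lt_min rp.
  by move=> w; rewrite lt_min => /andP[_ wr]; eexists; exact: sg_sD g _ wr.
move=> w; rewrite lt_min => /andP[w1 w2] wu.
by rewrite psiP // (sg_chi_s g (ltW w2)) rho_cancel // ltW.
Qed.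

Lemma dS_transform_germ (sigma : B -> B) (r : R) : 0 < r ->
  (forall w, bnorm w <= r ->
     - dchi w (dmoment iota E' z (chi w)) = rho w * sigma w /\
     exists L, frechet sigma w L) ->
  exists2 r : R, 0 < r & forall w : B, bnorm w < r -> dS_transform iota E E' z w = sigma w.
Proof.
have /andP[r10 r12] := sg_r1 g.
move=> rp sP; have [r2 r2p psiP] := psi_inv_germ.
pose r3 := Num.min (Num.min r r1) (r2 / 2).
have r3p : 0 < r3 by rewrite !lt_min rp r10 divr_gt0.
apply: (@analytic_extension_germ R B _ sigma r3) => // w; rewrite !lt_min => /andP[/andP[w1 w2] w3].
  by have [_] := sP w (ltW w1).
move=> wu; have w4 : bnorm w < r2 by have := bnorm_ge0 w; lra.
have D : frechet (psi_inv iota E z) w (dchi w).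
  apply: (frechet_ext (sg_chiD g w2)) => //; exists (r2 / 2); first by lra.
  by move=> h hr; rewrite psiP //; apply: (le_lt_trans (bnormD _ _)); lra.
have [_ dE] := frechet_differentiable D.
rewrite /dpsi_inv dE psiP // dpsiE; last by apply: (sg_chi_r0 g); exact: ltW.
have [-> _] := sP w (ltW w1).
by rewrite rho_cancel // ltW.
Qed.

End Transfer.

Lemma gen_subalgebra_over (R : realType) (A B : cstarAlgType R)
    (iota : {lrmorphism B -> A}) (x : A) : subalg_over iota (gen_subalgebra iota x).
Proof.
split.
- by move=> b; apply: sub_gen_smallest; left; exists b.
- move=> a b Sa Sb S [Sc Sg]; have [_ Sl _] := Sc.
  have /set_mem := Sl 1 a b (mem_set (Sa S (conj Sc Sg))) (mem_set (Sb S (conj Sc Sg))).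
  by rewrite scale1r.
move=> a b Sa Sb S [Sc Sg]; have [_ _ Sm] := Sc.
exact: set_mem (Sm a b (mem_set (Sa S (conj Sc Sg))) (mem_set (Sb S (conj Sc Sg)))).
Qed.

Lemma gen_subalgebra_self (R : realType) (A B : cstarAlgType R)
    (iota : {lrmorphism B -> A}) (x : A) : gen_subalgebra iota x x.
Proof. by apply: sub_gen_smallest; right. Qed.

Section OVI.
Context {R : realType} {A B : cstarAlgType R}.
Variables (iota : {lrmorphism B -> A}) (E E' : {linear A -> B}).
Hypothesis H : cstar_ovi iota E E'.

Lemma ovi_ncps : ncps iota E.
Proof.
have E1 : E 1 = 1 by rewrite -(rmorph1 iota) (E_id H).
split.
- by move=> b; rewrite /bnorm /= /rnorm (iota_norm H).
- by exists 2 => a; apply: completely_positive_bounded => //; exact: E_cp H.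
- exact: E_id H.
- exact: E_bimod H.
Qed.

Lemma ovi_E'_bounded : exists K : R, forall a, bnorm (E' a) <= K * bnorm a.
Proof.
have [C EC] := E'_bounded H.
have C0 : 0 <= C.
  have n1 : `|(1 : A)| = 1 :> R[i] by rewrite rnormE cs_rnorm1.
  have h : `|E' 1| <= C * `|(1 : A)| := EC 1.
  by rewrite n1 mulr1 in h; apply: le_trans h.
have CE : C = (complex.Re C)%:C%C by rewrite RRe_real ?ger0_real.
exists (complex.Re C) => a; have := EC a.
by rewrite [`|E' a|](rnormE _) [`|a|](rnormE _) CE -rmorphM /= lecR.
Qed.

End OVI.

Theorem theorem4p10 (R : realType) (A B : cstarAlgType R)
    (iota : {lrmorphism B -> A}) (E E' : {linear A -> B})
    (HOVI : cstar_ovi iota E E') (x y : A)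
    (x_sa : star x = x) (y_sa : star y = y)
    (xy_free : inf_free iota E E' x y)
    (Ex_unit : E x \is a GRing.unit) (Ey_unit : E y \is a GRing.unit) :
  let Sx := S_transform iota E x in
  let Sy := S_transform iota E y in
  let dSx := dS_transform iota E E' x in
  let dSy := dS_transform iota E E' y in
  let dSxy := dS_transform iota E E' (x * y) in
  \forall w \near (0 : B),
    dSxy w =
      Sy w * ('d Sx ((Sy w)^-1 * w * Sy w) : B -> B)
               ((Sy w)^-1 * w * dSy w
                - (Sy w)^-1 * dSy w * (Sy w)^-1 * w * Sy w)
      + Sy w * dSx ((Sy w)^-1 * w * Sy w)
      + dSy w * Sx ((Sy w)^-1 * w * Sy w).
Proof.
move=> Sx Sy dSx dSy dSxy.
have HE := ovi_ncps HOVI; have E'b := ovi_E'_bounded HOVI.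
have E'm := E'_bimod HOVI; have E'1 := E'_1 HOVI.
have HdE := dual_ncps HE E'b E'm E'1.
pose S (second : bool) : A -> Prop := gen_subalgebra iota (if second then y else x).
have Salg i : subalg_over iota (S i) by exact: gen_subalgebra_over.
have Sfx : S false x by exact: gen_subalgebra_self.
have Sty : S true y by exact: gen_subalgebra_self.
have ux : bunit (E x) by apply/bunit_unit.
have uy : bunit (E y) by apply/bunit_unit.
have uxy : bunit (E (x * y)).
  by rewrite (inf_free_E_mul HE Salg xy_free Sfx Sty); exact: bunitM.
have dual_unit (z : A) : bunit (E z) -> bunit (dual_E E E' ((z, 0) : dual A)).
  by move=> zu; have [] := @dual_inv _ _ (dual_E E E' ((z, 0) : dual A)) zu.
have [chix [sx [dx [r0x [r1x [Cx gx]]]]]] := S_germ_exists HE ux.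
have [chiy [sy [dy [r0y [r1y [Cy gy]]]]]] := S_germ_exists HE uy.
have [chip [sp [dp [r0p [r1p [Cp gp]]]]]] := S_germ_exists HE uxy.
have [Chix [Sgx [Dx [R0x [R1x [CCx Gx]]]]]] := S_germ_exists HdE (dual_unit x ux).
have [Chiy [Sgy [Dy [R0y [R1y [CCy Gy]]]]]] := S_germ_exists HdE (dual_unit y uy).
have [Chip [Sgp [Dp [R0p [R1p [CCp Gp]]]]]] := S_germ_exists HdE (dual_unit (x * y) uxy).
have [r rp prodE] := infinitesimal_product HE E'b E'm E'1 Salg xy_free Sfx Sty gx gy gp Gx Gy Gp.
have dgerm z chi s dchi ra rb C Chi Sg dChi Ra Rb CC
    (g : S_germ iota E z chi s dchi ra rb C)
    (G : S_germ (dual_iota iota) (dual_E E E') ((z, 0) : dual A) Chi Sg dChi Ra Rb CC) :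
    exists2 r : R, 0 < r & forall w : B, bnorm w < r ->
      dS_transform iota E E' z w = (Sg (w, 0)).2.
  have [t tp tP] := dual_germ HE E'b E'm g G.
  apply: (dS_transform_germ HE g tp) => w /tP[h1 _ h2]; by split.
have [t1 t1p Px] := S_transform_germ HE gx.
have [t2 t2p Py] := S_transform_germ HE gy.
have [t3 t3p Qx] := dgerm _ _ _ _ _ _ _ _ _ _ _ _ _ gx Gx.
have [t4 t4p Qy] := dgerm _ _ _ _ _ _ _ _ _ _ _ _ _ gy Gy.
have [t5 t5p Qp] := dgerm _ _ _ _ _ _ _ _ _ _ _ _ _ gp Gp.
have C0 := sg_C gy; have CC0 := mulr_ge0 C0 C0.
have /andP[r1y0 _] := sg_r1 gy; have /andP[r1x0 _] := sg_r1 gx.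
pose q := Num.min (Num.min (t1 / 2) t3) r1x.
have qp : 0 < q by rewrite !lt_min t3p r1x0 divr_gt0.
pose r' := Num.min (Num.min (Num.min r t2) (Num.min t4 t5))
  (Num.min r1y (q / (Cy * Cy + 1))).
have r'p : 0 < r' by rewrite !lt_min rp t2p t4p t5p r1y0 divr_gt0 //; lra.
apply/near0_rnorm; exists r' => // w; rewrite !lt_min.
move=> /andP[/andP[/andP[w1 w2] /andP[w4 w5]] /andP[w6 w7]].
have {}w7 : bnorm w * (Cy * Cy + 1) < q by rewrite -ltr_pdivlMr //; lra_from CC0.
have w0 := bnorm_ge0 w.
have [su] := prodE w (ltW w1).
rewrite -(Qp w w5) -(Qy w w4) -(Py w w2) in su *.
rewrite -/dSxy -/Sy -/dSy in su *.
rewrite (binvE su).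
set w' := (Sy w)^-1 * w * Sy w; set o := _ - _.
have w'q : bnorm w' < q.
  have b1 := sg_s_bound gy (ltW w6); have b2 := sg_sV_bound gy (ltW w6).
  rewrite -(Py w w2) -/Sy (binvE su) in b1 b2.
  have b3 := bnormM_le (bnormM_le b2 (lexx (bnorm w))) b1.
  by apply: (le_lt_trans b3); lra_from w7 w0.
move: w'q; rewrite !lt_min => /andP[/andP[q1 q2] q3].
have w'0 := bnorm_ge0 w'.
have D : frechet Sx w' (S_deriv iota E x chix dx w').
  apply: (frechet_ext (frechet_S_deriv gx q3)) => //; exists (t1 / 2); first by lra_from t1p.
  move=> h hr; rewrite /Sx Px //; apply: (le_lt_trans (bnormD _ _)).
  by lra_from q1 hr.
have [_ dE] := frechet_differentiable D.
by rewrite dE -(Qx w' q2) -(Px w') //; lra_from q1 w'0.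
Qed.
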